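(* Let $m,N\in\mathbb{N}$ with $m\ge2$ and $N>2m$. Consider, for $u\in\mathcal{D}^{m,2}(\mathbb{R}^N)$ with $\int_{\mathbb{R}^N}|u|^2\,dx=1$, the equality $$(\ast)\qquad\frac{N}{4m}\log\left(\left(\frac{4me}{C_{N,\log}(N-2m)}\right)^{\frac{N-2m}{N}}\int_{\mathbb{R}^N}|\nabla^m u|^2\,dx\right)=\int_{\mathbb{R}^N}|u|^2\log|u|\,dx.$$ Equality $(\ast)$ holds provided that $u=\frac{u_0}{\|u_0\|_{L^2(\mathbb{R}^N)}}$ and $u_0$ is a ground state solution to $(-\Delta)^m u=g(u)$ in $\mathbb{R}^N$, where $g=G'$ and $G(s)=s^2\log|s|$. Conversely, if $(\ast)$ holds for $u$, then there are uniquely determined $\lambda>0$ and $r>0$ such that $u_0:=\lambda u(r\,\cdot)\in\mathcal{M}$ and $u_0$ is a ground state solution to $(-\Delta)^m u=g(u)$ in $\mathbb{R}^N$.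
   Context: All functions are real-valued. $2^*:=\frac{2N}{N-2m}$. $\mathcal{D}^{m,2}(\mathbb{R}^N)$ is the completion of $C_0^\infty(\mathbb{R}^N)$ with respect to the norm $\left(\sum_{|\alpha|=m}\|D^\alpha u\|_{L^2(\mathbb{R}^N)}^2\right)^{1/2}$; it embeds continuously into $L^{2^*}(\mathbb{R}^N)$. The notation $\nabla^m u$ means $\Delta^{m/2}u$ if $m$ is even and $\nabla\Delta^{(m-1)/2}u$ if $m$ is odd. Let $G(s):=s^2\log|s|$ for $s\ne0$, $G(0):=0$, and $g:=G'$ (so $g(s)=2s\log|s|+s$ for $s\neq0$, $g(0)=0$). Define $$\mathcal{M}:=\Big\{u\in\mathcal{D}^{m,2}(\mathbb{R}^N)\setminus\{0\}: G(u)\in L^1(\mathbb{R}^N),\ \int_{\mathbb{R}^N}|\nabla^m u|^2\,dx=2^*\int_{\mathbb{R}^N}G(u)\,dx\Big\},\qquad J(u):=\frac12\int_{\mathbb{R}^N}|\nabla^m u|^2\,dx-\int_{\mathbb{R}^N}G(u)\,dx,$$ and $$C_{N,\log}:=2^*\Big(\frac12-\frac1{2^*}\Big)^{-\frac{2m}{N-2m}}\Big(\inf_{\mathcal{M}}J\Big)^{\frac{2m}{N-2m}}.$$ A weak solution to $(-\Delta)^m u=g(u)$ is a function $u\in\mathcal{D}^{m,2}(\mathbb{R}^N)$ such that $\int_{\mathbb{R}^N}\nabla^m u\cdot\nabla^m v\,dx=\int_{\mathbb{R}^N}g(u)v\,dx$ for all $v\in C_0^\infty(\mathbb{R}^N)$.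 A ground state solution is a weak solution $u_0\in\mathcal{M}$ with $J(u_0)=\inf_{\mathcal{M}}J$. *)

(* Defs.v *)
From HB Require Import structures.
From mathcomp Require Import all_boot all_order all_algebra.
From mathcomp Require Import all_classical all_reals all_analysis.
Set Implicit Arguments.
Unset Strict Implicit.
Unset Printing Implicit Defensive.
Import Order.TTheory GRing.Theory Num.Theory.
Import numFieldNormedType.Exports.
Local Open Scope classical_set_scope.
Local Open Scope ring_scope.

Definition rv_display : measure_display.
Proof. exact: default_measure_display. Qed.

Section rv_measurable.
Context {R : realType} {n : nat}.

Definition rv_coord (i : 'I_n) (x : 'rV[R]_n) : R := x 0 i.

Let rv_set0 : g_sigma_preimage rv_coord set0.
Proof. exact: sigma_algebra0. Qed.

Let rv_setC A : g_sigma_preimage rv_coord A -> g_sigma_preimage rv_coord (~` A).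
Proof. exact: sigma_algebraC. Qed.

Let rv_bigcup (F : (set 'rV[R]_n)^nat) :
  (forall i, g_sigma_preimage rv_coord (F i)) ->
  g_sigma_preimage rv_coord (\bigcup_i F i).
Proof. exact: sigma_algebra_bigcup. Qed.

(* The sigma-algebra generated by the coordinates, i.e. the Borel one. *)
HB.instance Definition _ := @isMeasurable.Build rv_display 'rV[R]_n
  (g_sigma_preimage rv_coord) rv_set0 rv_setC rv_bigcup.

Lemma measurable_rv_coord (i : 'I_n) : measurable_fun setT (rv_coord i).
Proof.
move=> _ Y mY; rewrite setTI; apply: sub_sigma_algebra => /=.
rewrite -bigcup_seq/=; exists i => /=; first by rewrite mem_index_enum.
by exists Y => //; rewrite setTI.
Qed.

Lemma measurable_fun_rv d (T : measurableType d) (f : T -> 'rV[R]_n) :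
  (forall i, measurable_fun setT (fun t => f t 0 i)) -> measurable_fun setT f.
Proof.
move=> mf _ A mA; rewrite setTI.
suff: g_sigma_preimage rv_coord `<=` [set B | measurable (f @^-1` B)] by exact.
apply: smallest_sub.
  split=> /=.
  - by rewrite preimage_set0.
  - by move=> B mB; rewrite setTD preimage_setC; exact: measurableC.
  - by move=> F mF; rewrite preimage_bigcup; exact: bigcup_measurable.
rewrite -bigcup_seq/=; apply: bigcup_sub => i _ _ [B mB <-] /=.
by rewrite setTI -comp_preimage -[_ @^-1` _]setTI; exact: mf.
Qed.

End rv_measurable.

Section rv_cons.
Context {R : realType}.

Definition rv_cons {n} (p : measurableTypeR R * 'rV[R]_n) : 'rV[R]_n.+1 :=
  row_mx (const_mx p.1 : 'rV_1) p.2.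

Lemma measurable_rv_cons n : measurable_fun setT (@rv_cons n).
Proof.
apply: measurable_fun_rv => i.
rewrite -[i](@fintype.splitK 1 n); case: (fintype.split _) => j /=.
  rewrite (_ : (fun _ => _) = fst)//.
  by apply/funext => x; apply: etrans (row_mxEl _ _ _ _) _; rewrite mxE.
rewrite (_ : (fun _ => _) = rv_coord j \o snd); last first.
  by apply/funext => x; apply: etrans (row_mxEr _ _ _ _) _.
by apply: measurableT_comp => //; exact: measurable_rv_coord.
Qed.

Lemma rv_cons_head n (p : R * 'rV[R]_n) : rv_cons p 0 0 = p.1.
Proof.
rewrite /rv_cons (_ : 0 = lshift n (0 : 'I_1) :> 'I_(1 + n)); last exact/val_inj.
by rewrite (@row_mxEl _ 1 1 n) mxE.
Qed.

Lemma rv_cons_tail n (p : R * 'rV[R]_n) : \row_i rv_cons p 0 (lift 0 i) = p.2.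
Proof.
apply/rowP => i; rewrite mxE /rv_cons.
by rewrite (_ : lift 0 i = rshift 1 i) ?(@row_mxEr _ 1 1 n)//; exact/val_inj.
Qed.

Lemma measurable_rv_tail n :
  measurable_fun setT (fun x : 'rV[R]_n.+1 => \row_i x 0 (lift 0 i)).
Proof.
apply: measurable_fun_rv => i.
rewrite (_ : (fun _ => _) = rv_coord (lift 0 i)); last first.
  by apply/funext => x; rewrite mxE.
exact: measurable_rv_coord.
Qed.

End rv_cons.

Section lebesgue_rv_succ.
Context {R : realType} {n : nat}.
Variable mu : {sigma_finite_measure set 'rV[R]_n -> \bar R}.

Definition lebesgue_rv_succ : set 'rV[R]_n.+1 -> \bar R :=
  pushforward (lebesgue_measure \x mu)%E rv_cons.

Let preim_rv_cons (A : set 'rV[R]_n.+1) :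
  measurable A -> measurable (@rv_cons R n @^-1` A).
Proof. by move=> mA; rewrite -[X in measurable X]setTI; exact: measurable_rv_cons. Qed.

Let succ0 : lebesgue_rv_succ set0 = 0%E.
Proof. by rewrite /lebesgue_rv_succ /pushforward preimage_set0 measure0. Qed.

Let succ_ge0 A : (0 <= lebesgue_rv_succ A)%E.
Proof. by rewrite /lebesgue_rv_succ /pushforward; exact: integral_ge0. Qed.

Let succ_sigma_additive : semi_sigma_additive lebesgue_rv_succ.
Proof.
move=> F mF tF mUF; rewrite /lebesgue_rv_succ /pushforward preimage_bigcup.
apply: measure_semi_sigma_additive.
- by move=> i; exact: preim_rv_cons.
- apply/trivIsetP => /= i j _ _ ij; rewrite -preimage_setI.
  by move/trivIsetP : tF => /(_ _ _ _ _ ij) ->//; rewrite preimage_set0.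
- by rewrite -preimage_bigcup; exact: preim_rv_cons.
Qed.

HB.instance Definition _ := isMeasure.Build _ _ _
  lebesgue_rv_succ succ0 succ_ge0 succ_sigma_additive.

Lemma lebesgue_rv_succE (A : set R) (B : set 'rV[R]_n) :
  measurable A -> measurable B ->
  lebesgue_rv_succ [set x : 'rV[R]_n.+1 | A (x 0 0) /\ B (\row_i x 0 (lift 0 i))] =
  (lebesgue_measure A * mu B)%E.
Proof.
move=> mA mB; rewrite /lebesgue_rv_succ /pushforward -product_measure1E//.
congr (_ \x _)%E; apply/seteqP; split => -[a y] /=.
  by rewrite rv_cons_head rv_cons_tail.
by rewrite rv_cons_head rv_cons_tail.
Qed.

Let succ_sigma_finite : sigma_finite setT lebesgue_rv_succ.
Proof.
have /sigma_finiteP[F [TF ndF Foo]] := sigma_finiteT (@lebesgue_measure R).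
have /sigma_finiteP[G [TG ndG Goo]] := sigma_finiteT mu.
exists (fun k => [set x : 'rV[R]_n.+1 | F k (x 0 0) /\ G k (\row_i x 0 (lift 0 i))]).
  apply/seteqP; split => // x _.
  have [i _ Fi] : (\bigcup_i F i) (x 0 0) by rewrite -TF.
  have [j _ Gj] : (\bigcup_i G i) (\row_i x 0 (lift 0 i)) by rewrite -TG.
  exists (maxn i j) => //; split => /=.
    by move: (x 0 0) Fi; exact/subsetPset/ndF/leq_maxl.
  by move: (\row_i _) Gj; exact/subsetPset/ndG/leq_maxr.
move=> k; have [? ?] := Foo k; have [? ?] := Goo k; split.
  apply: measurableI; rewrite -[X in measurable X]setTI.
    exact: (measurable_rv_coord 0).
  exact: measurable_rv_tail.
by rewrite lebesgue_rv_succE// lte_mul_pinfty// ge0_fin_numE.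
Qed.

HB.instance Definition _ := Measure_isSigmaFinite.Build _ _ _
  lebesgue_rv_succ succ_sigma_finite.

End lebesgue_rv_succ.

Fixpoint lebesgue_rv {R : realType} (n : nat) :
    {sigma_finite_measure set 'rV[R]_n -> \bar R} :=
  if n is k.+1 then lebesgue_rv_succ (lebesgue_rv k) else dirac (0 : 'rV[R]_0).

Lemma lebesgue_rv_box (R : realType) (n : nat) (A : 'I_n -> set R) :
  (forall i, measurable (A i)) ->
  lebesgue_rv n [set x : 'rV[R]_n | forall i, A i (x 0 i)] =
  (\prod_(i < n) lebesgue_measure (A i))%E.
Proof.
elim: n A => [|n IHn] A mA.
  by rewrite big_ord0 /= diracE mem_set//= => -[].
rewrite big_ord_recl -IHn//= -lebesgue_rv_succE//; last first.
  rewrite (_ : [set _ | _] = \bigcap_(i in [set: 'I_n]) (rv_coord i @^-1` A (lift ord0 i))).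
    apply: fin_bigcap_measurable => // i _.
    by rewrite -[X in measurable X]setTI; exact: measurable_rv_coord.
  by apply/seteqP; split => x /= Ax i; [move=> _|]; exact: Ax.
congr (lebesgue_rv_succ _ _); apply/seteqP; split => x /= Ax.
  by split => [|i]; [exact: Ax|rewrite mxE; exact: Ax].
by move=> i; case: (unliftP ord0 i) => [j ->|->]; [have := Ax.2 j; rewrite mxE|exact: Ax.1].
Qed.

Section function_spaces.
Context {R : realType} {N : nat}.
Implicit Types (u v f : 'rV[R]_N -> R) (m : nat).

Definition partial (i : 'I_N) f : 'rV[R]_N -> R :=
  fun x => 'D_(delta_mx 0 i) f x.

Definition multi_partial m (a : {ffun 'I_N -> 'I_m.+1}) f : 'rV[R]_N -> R :=
  foldr (fun i h => iter (a i) (partial i) h) f (enum 'I_N).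

Definition laplacian f : 'rV[R]_N -> R :=
  fun x => \sum_(i < N) partial i (partial i f) x.

Definition smooth f : Prop := forall s : seq 'I_N,
  continuous (foldr partial f s) /\
  forall i x, derivable (foldr partial f s) x (delta_mx 0 i).

Definition test_function f : Prop :=
  smooth f /\ compact (closure [set x | f x != 0]).

(* Multi-indices of length [m] have all their entries at most [m]. *)
Definition Dm2_norm m f : R :=
  Num.sqrt (\sum_(a : {ffun 'I_N -> 'I_m.+1} | (\sum_i a i)%N == m)
    fine ('N[lebesgue_rv N]_2%:E[EFin \o multi_partial a f])%E ^+ 2).

Definition crit_exp m : R := 2 * N%:R / (N%:R - 2 * m%:R).

(* The completion of the test functions is realized inside [L^{2^*}]: its
   elements are the [L^{2^*}] limits of the sequences of test functions which are
   Cauchy for [Dm2_norm]. *)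
Definition Dm2 m u : Prop :=
  u \in Lfun (lebesgue_rv N) (crit_exp m)%:E /\
  exists phi : nat -> 'rV[R]_N -> R,
    [/\ forall k, test_function (phi k),
        forall e : R, 0 < e -> exists k0, forall j k, (k0 <= j)%N -> (k0 <= k)%N ->
          Dm2_norm m (phi j \- phi k) < e &
        ('N[lebesgue_rv N]_(crit_exp m)%:E[EFin \o (u \- phi k)%R])%E @[k --> \oo] --> 0%E].

(* [nabla^m] is a scalar or a vector according to the parity of [m]; summing over this
   list of components gives the inner product in both cases. *)
Definition nabla_ops m : seq (('rV[R]_N -> R) -> 'rV[R]_N -> R) :=
  if odd m then [seq (fun f => partial i (iter m./2 laplacian f)) | i <- enum 'I_N]
  else [:: iter m./2 laplacian].

Definition loc_integrable f : Prop :=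
  measurable_fun setT f /\
  forall K, compact K -> (lebesgue_rv N).-integrable K (EFin \o f).

(* The distribution [P u], for an operator [P] with constant coefficients which is
   homogeneous of order [m] (hence with formal adjoint [(-1)^m P]), as a locally
   integrable function. *)
Definition weak_diff m (P : ('rV[R]_N -> R) -> 'rV[R]_N -> R) u : 'rV[R]_N -> R :=
  get [set w | loc_integrable w /\ forall phi, test_function phi ->
    \int[lebesgue_rv N]_x (u x * P phi x) =
    (-1) ^+ m * \int[lebesgue_rv N]_x (w x * phi x)].

Definition nabla_energy m u : R :=
  \int[lebesgue_rv N]_x (\sum_(P <- nabla_ops m) weak_diff m P u x ^+ 2).

Definition Glog (s : R) : R := s ^+ 2 * ln `|s|. (* [ln 0 = 0] *)

Definition glog : R -> R := derive1 Glog.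

Definition Mset m : set ('rV[R]_N -> R) :=
  [set u | [/\ Dm2 m u, ~ {ae lebesgue_rv N, forall x, u x = 0},
    (lebesgue_rv N).-integrable setT (fun x => (Glog (u x))%:E) &
    nabla_energy m u = crit_exp m * \int[lebesgue_rv N]_x Glog (u x)]].

Definition J m u : R :=
  2^-1 * nabla_energy m u - \int[lebesgue_rv N]_x Glog (u x).

Definition weak_solution m u : Prop :=
  Dm2 m u /\ forall v, test_function v ->
    \int[lebesgue_rv N]_x (\sum_(P <- nabla_ops m) weak_diff m P u x * P v x) =
    \int[lebesgue_rv N]_x (glog (u x) * v x).

Definition ground_state m u : Prop :=
  [/\ weak_solution m u, Mset m u & J m u = inf [set J m v | v in Mset m]].

Definition C_log m : R :=
  let s := 2 * m%:R / (N%:R - 2 * m%:R) in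
  crit_exp m * (2^-1 - (crit_exp m)^-1) `^ (- s) *
  (inf [set J m v | v in Mset m]) `^ s.

(* The right-hand integral is taken in the extended reals, since [u ^+ 2 * ln `|u|]
   need not be integrable: its integral may be [-oo], and then the equality fails. *)
Definition log_sobolev_equality m u : Prop :=
  ((N%:R / (4 * m%:R) *
    ln ((4 * m%:R * expR 1 / (C_log m * (N%:R - 2 * m%:R)))
          `^ ((N%:R - 2 * m%:R) / N%:R) * nabla_energy m u))%:E =
   \int[lebesgue_rv N]_x (`|u x| ^+ 2 * ln `|u x|)%:E)%E.

End function_spaces.

Arguments crit_exp : clear implicits.
Arguments C_log : clear implicits.

(* Main.v *)
Require Import Defs.
From mathcomp Require Import all_boot all_order all_algebra.
From mathcomp Require Import all_classical all_reals all_analysis measurable_realfun.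
From mathcomp Require Import ring lra.
Set Implicit Arguments.
Unset Strict Implicit.
Unset Printing Implicit Defensive.
Import Order.TTheory GRing.Theory Num.Theory.
Import numFieldNormedType.Exports.
Local Open Scope classical_set_scope.
Local Open Scope ring_scope.

(** Throughout, [E u] is [nabla_energy m u], [L u] is the integral of [u ^+ 2],
    [B u] is the integral of [Glog (u x)], [p] is the critical exponent,
    [q = (N - 2 m) / (2 m)] and [c] is the infimum of [J] over the constraint set
    [E = p B], on which [J = (m / N) E].

    The dilation [w(r .)] multiplies [E] by [r^(2m-N)] and [B] by [r^(-N)], so as soon
    as [B w > 0] exactly one dilate of [w] satisfies the constraint, and computing [J]
    there gives
<<
      ln c <= ln (m / N) + (1 + q) ln (E w) - q ln (p B w)          (ln_infJ_le)
>>
    with equality when [w] itself is a minimizer ([minimizer_ln]).  Minimizing [J]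
    under the constraint is thus the same as minimizing the dilation invariant right
    hand side under [B w > 0].  Three consequences carry the theorem.

    - Replacing [w] by [e^s w] changes [B] into [e^(2s) (B + s L)] and the right hand
      side by [2 s - q ln (1 + s L / B)].  At a minimizer this is nonnegative for all
      small [s], which forces [B = (q / 2) L] ([minimizer_Glog]).  After normalization
      to [L = 1], the value of [ln c] is exactly the logarithmic equality
      ([ground_state_log_sobolev]).
    - Conversely the logarithmic equality for [u] with [L u = 1] says that the right
      hand side at [lambda u] is [ln c] for the [lambda] with
      [B (lambda u) = (q / 2) L (lambda u)]; a dilation then gives a minimizer on the
      constraint set.  The value of [lambda] is forced by [minimizer_Glog], and then
      that of [r] by the constraint ([log_sobolev_minimizer]).
    - The right hand side is differentiable along [u + t v] for a test function [v],
      since [Glog] has locally bounded derivative of at most quadratic growth.  Its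
      vanishing derivative at a minimizer is the weak equation, with Lagrange multiplier
      one because [p q = 2 (1 + q)] ([minimizer_weak]).

    All of this takes logarithms of [c], so that [c > 0] is needed ([infJ_gt0]).  The
    energy controls the squared norm of the differences of order [m] of [u]
    ([sqn_iter_fdiff]); averaging them over the translations in a cube of side [t]
    bounds the mass of [u ^+ 2] on [|u| > 2 s] by a multiple of [t^(2m) E], where
    [t^N] is of order [L / s^2] ([large_values_energy]).  Summing over geometric levels
    [s] gives, for all [S > 0],
<<
      B u <= L ln S + K (L / S^2)^(2m/N) E                    (integral_Glog_le)
>>
    and two choices of [S] bound [L], and then [E], from below on the constraint set.

    The remaining parts make these computations legitimate.  Weak derivatives are
    determined almost everywhere by the fundamental lemma of the calculus of variations
    ([du_bois_reymond]); for test functions the components of [nabla^m] have the same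
    total squared norm as all derivatives of order [m], by integration by parts
    ([derivative_energyE]), so that they converge in [L^2] along approximating
    sequences ([diffop_weak_diff]), and energies, pairings and translation estimates
    pass to the limit. *)

(** * Borel sets and affine changes of variables *)

Section borel.
Context {R : realType} {n : nat}.

Lemma coord_le_norm (x : 'rV[R]_n) (i : 'I_n) : `|x 0 i| <= `|x|.
Proof.
by rewrite [leRHS]/Num.norm/= mx_normrE; apply/bigmax_geP; right; exists (0, i).
Qed.

Lemma measurable_rv_preim (i : 'I_n) (Y : set R) :
  measurable Y -> measurable [set x : 'rV[R]_n | Y (x 0 i)].
Proof.
by move=> mY; rewrite -[X in measurable X]setTI; exact: measurable_rv_coord.
Qed.

Lemma measurable_rv_box (A : 'I_n -> set R) :
  (forall i, measurable (A i)) ->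
  measurable [set x : 'rV[R]_n | forall i, A i (x 0 i)].
Proof.
move=> mA; rewrite [X in measurable X](_ : _ = \bigcap_(i in [set: 'I_n]) [set x : 'rV[R]_n | A i (x 0 i)]).
  by apply: fin_bigcap_measurable => // i _; exact: measurable_rv_preim.
by apply/seteqP; split => x /= Ax i; [move=> _|]; exact: Ax.
Qed.

Definition rv_cube (a b : R) : set 'rV[R]_n :=
  [set x | forall i, `[a, b]%classic (x 0 i)].

Lemma measurable_rv_cube a b : measurable (rv_cube a b).
Proof.
apply: (@measurable_rv_box (fun=> `[a, b]%classic)) => i.
exact: measurable_itv.
Qed.

Lemma lebesgue_rv_cube a b : a <= b ->
  lebesgue_rv n (rv_cube a b) = ((b - a) ^+ n)%:E.
Proof.
move=> ab; rewrite (@lebesgue_rv_box _ _ (fun=> `[a, b]%classic)) => [|i]; last first.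
  exact: measurable_itv.
have -> : lebesgue_measure `[a, b]%classic = (b - a)%:E.
  rewrite lebesgue_measure_itv/= lte_fin; move: ab.
  by rewrite le_eqVlt => /predU1P[->|->]//; rewrite ltxx subrr.
elim: (n) => [|k IHk]; first by rewrite big_ord0 expr0.
by rewrite big_ord_recl IHk exprS EFinM.
Qed.

Lemma measurable_rv_ball (x : 'rV[R]_n) (e : R) : 0 < e -> measurable (ball x e).
Proof.
move=> e0; rewrite (_ : ball x e = [set y : 'rV[R]_n | forall i, ball (x 0 i) e (y 0 i)]).
  by apply: (@measurable_rv_box (fun i => ball (x 0 i) e)) => i; apply: open_measurable; exact: ball_open.
apply/seteqP; split => y; first by case=> _ h i; exact: h.
by move=> h; split => // i j; rewrite (ord1 i); exact: h.
Qed.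

(** An open set is the countable union of the balls with rational centre and
    radius [1 / k] that it contains. *)
Lemma open_measurable_rv (A : set 'rV[R]_n) : open A -> measurable A.
Proof.
move=> oA.
(* balls that are not contained in [A] are replaced by the empty set *)
pose F (p : 'rV[rat]_n * nat) : set 'rV[R]_n :=
  let b := ball (\row_i ratr (p.1 0 i) : 'rV[R]_n) (p.2.+1%:R^-1 : R) in
  if `[< b `<=` A >] then b else set0.
rewrite (_ : A = \bigcup_p F p).
  apply: countable_bigcupT_measurable => // p; rewrite /F.
  by case: ifP => // _; apply: measurable_rv_ball; rewrite invr_gt0.
apply/seteqP; split=> [x Ax|x [p _]]; last first.
  by rewrite /F; case: ifPn => // /asboolP; exact.
have /nbhs_ballP[e /= e0 eA] := open_nbhs_nbhs (conj oA Ax).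
have [k ke] : exists k : nat, k.+1%:R^-1 < e / 2.
  have e20 : 0 < e / 2 by rewrite divr_gt0.
  have /cvgrPdist_lt/(_ _ e20)[k _ /(_ k (leqnn k))] := @cvg_harmonic R.
  rewrite /= sub0r normrN ger0_norm ?invr_ge0// => ?.
  by exists k.
have k0 : 0 < k.+1%:R^-1 :> R by rewrite invr_gt0.
have q_ex i : exists q : rat, ball (x 0 i) k.+1%:R^-1 (ratr q : R).
  have xlt : x 0 i < x 0 i + k.+1%:R^-1 by rewrite ltrDl.
  have [q] := rat_in_itvoo xlt.
  rewrite in_itv/= => /andP[h1 h2]; exists q.
  by rewrite /ball/= ltr_distlC h2 andbT; apply: lt_trans h1; rewrite ltrBlDr ltrDl.
pose q := \row_i xget 0 [set q : rat | ball (x 0 i) k.+1%:R^-1 (ratr q : R)].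
have qP i : ball (x 0 i) k.+1%:R^-1 (ratr (q 0 i) : R).
  by rewrite mxE; case: xgetP => [y -> //|]; have [y Py /(_ y)] := q_ex i.
exists (q, k) => //; rewrite /F /= asboolT; last first.
  apply: subset_trans eA => y [_ by_]; split => // i j; rewrite (ord1 i).
  have /lt_trans-/(_ _ ke) h1 := qP j.
  have := by_ 0 j; rewrite mxE => /lt_trans-/(_ _ ke) h2.
  rewrite /ball/= (splitr e) -(subrKA (ratr (q 0 j))).
  by apply: le_lt_trans (ler_normD _ _) _; exact: ltrD.
split => // i j; rewrite (ord1 i) [X in ball X]mxE; exact/ball_sym/qP.
Qed.

Lemma closed_measurable_rv (A : set 'rV[R]_n) : closed A -> measurable A.
Proof.
move=> cA; rewrite -(setCK A); apply: measurableC.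
by apply: open_measurable_rv; exact: closed_openC.
Qed.

Lemma compact_measurable_rv (A : set 'rV[R]_n) : compact A -> measurable A.
Proof. 
move=> cA; apply: closed_measurable_rv; apply: compact_closed => //.
Qed.

Lemma continuous_measurable_rv (f : 'rV[R]_n -> R) :
  continuous f -> measurable_fun setT f.
Proof.
move=> /continuousP cf; apply: (measurability _ (RGenOpens.measurableE R)).
move=> _ [_ [a [b ->]] <-]; rewrite setTI; apply: open_measurable_rv.
by apply: cf; exact: interval_open.
Qed.

End borel.

Section affine.
Context {R : realType}.
Variables (r : R).
Hypothesis r0 : 0 < r.

Let aff1 (a : R) : measurableTypeR R -> measurableTypeR R := fun t => r * t + a.

Let maff1 a : measurable_fun setT (aff1 a).
Proof. by apply: measurable_funD => //; exact: measurable_funM. Qed.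

Let m1 (a : R) : {measure set measurableTypeR R -> \bar R} :=
  mscale (NngNum (ltW r0)) (measure_function_pushforward__canonical__measure_function_Measure (@lebesgue_measure R) (maff1 a)).

Lemma lebesgue_measure_affine (a : R) (A : set R) : measurable A ->
  lebesgue_measure A = (r%:E * lebesgue_measure ((fun t => r * t + a)%R @^-1` A))%E.
Proof.
move=> mA; apply: (@lebesgue_measure_unique R (m1 a)) mA => _ [[x y]] _ <-.
rewrite /= /mscale/= /pushforward lebesgue_measure_itv/=.
rewrite (_ : _ @^-1` _ = `](x - a) / r, (y - a) / r]%classic); last first.
  apply/seteqP; split => t /=; rewrite !in_itv/= /aff1 ltr_pdivrMr// ler_pdivlMr// ltrBlDr lerBrDr [r * t]mulrC//.
rewrite lebesgue_measure_itv/= !lte_fin ltr_pM2r ?invr_gt0// ltrD2r.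
case: ifPn => _; last by rewrite mule0.
by rewrite -!EFinB -EFinM -mulrBl mulrCA divff ?gt_eqF// mulr1 opprB addrA subrK.
Qed.

Context {n : nat}.
Variable a : 'rV[R]_n.

Definition rv_affine (x : 'rV[R]_n) : 'rV[R]_n := r *: x + a.

Lemma measurable_rv_affine : measurable_fun setT rv_affine.
Proof.
apply: measurable_fun_rv => i; rewrite /rv_affine.
under eq_fun do rewrite !mxE.
apply: measurable_funD => //; apply: measurable_funM => //.
exact: measurable_rv_coord.
Qed.

Let m2 : {measure set 'rV[R]_n -> \bar R} :=
  mscale (NngNum (exprn_ge0 n (ltW r0)))
  (measure_function_pushforward__canonical__measure_function_Measure (@lebesgue_rv R n) measurable_rv_affine).

(** Both sides are measures in [A] that agree on boxes, where the claim is the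
    one-dimensional change of variables in each factor; boxes are stable under
    intersection and generate the Borel sets. *)
Lemma lebesgue_rv_affine (A : set 'rV[R]_n) : measurable A ->
  lebesgue_rv n A = ((r ^+ n)%:E * lebesgue_rv n (rv_affine @^-1` A))%E.
Proof.
pose G := [set B : set 'rV[R]_n | exists2 A : 'I_n -> set R,
  (forall i, measurable (A i)) & B = [set x | forall i, A i (x 0 i)]].
pose g (k : nat) := @rv_cube R n (- k%:R) k%:R.
move=> mA; apply: (@measure_unique _ _ _ G g _ _ _ _ (lebesgue_rv n) m2) mA.
- apply/seteqP; split.
    apply: smallest_sub; first exact: smallest_sigma_algebra.
    rewrite -bigcup_seq; apply: bigcup_sub => i _ _ [B mB <-] /=.
    apply: sub_sigma_algebra; exists (fun j => if j == i then B else setT).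
      by move=> j; case: ifP.
    apply/seteqP; split => x /=.
      by move=> [_ Bx] j; case: eqP => [->|].
    by move=> /(_ i); rewrite eqxx.
  apply: smallest_sub; first exact: sigma_algebra_measurable.
  by move=> _ [B mB ->]; exact: measurable_rv_box.
- move=> _ _ [A1 mA1 ->] [A2 mA2 ->]; exists (fun i => A1 i `&` A2 i).
    by move=> i; exact: measurableI.
  by apply/seteqP; split => x /= => [[h1 h2] i|h]; split => //i; case: (h i).
- by move=> k; exists (fun=> `[(- k%:R), k%:R]%classic).
- apply/seteqP; split => // x _.
  exists (Num.truncn `|x|).+1 => // i /=.
  have xi : `|x 0 i| < (Num.truncn `|x|).+1%:R.
    apply: (@le_lt_trans _ _ `|x|); last by rewrite truncnS_gt.
    exact: coord_le_norm.
  by rewrite in_itv/=; move: xi; rewrite ltr_norml => /andP[/ltW-> /ltW].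
- move=> _ [B mB ->].
  rewrite /= /mscale/= /pushforward (_ : _ @^-1` _ =
     [set x : 'rV[R]_n | forall i, ((fun t => r * t + a 0 i) @^-1` B i) (x 0 i)]); last first.
    by apply/seteqP; split => x /= h i; have := h i; rewrite !mxE.
  rewrite !lebesgue_rv_box//.
    under eq_bigr => i _ do rewrite (lebesgue_measure_affine (a 0 i) (mB i)).
    rewrite big_split/=; congr (_ * _)%E.
    elim: (n) => [|k IHk]; first by rewrite big_ord0 expr0.
    by rewrite big_ord_recl IHk exprS EFinM.
  rewrite (@lebesgue_rv_box _ _ (fun i => (fun t : R => r * t + a 0 i) @^-1` B i))// => i.
  by have := maff1 (a 0 i) measurableT (mB i); rewrite setTI.
- move=> k; suff : (lebesgue_rv n (g k) < +oo)%E by [].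
  by rewrite /g lebesgue_rv_cube ?ltry// ge0_cp.
Qed.

Local Open Scope ereal_scope.

Lemma ge0_integral_affine (f : 'rV[R]_n -> \bar R) : measurable_fun setT f ->
  (forall x, 0 <= f x) ->
  \int[lebesgue_rv n]_x f x = (r ^+ n)%:E * \int[lebesgue_rv n]_x f (r *: x + a)%R.
Proof.
move=> mf f0; transitivity (\int[m2]_x f x).
  by apply: eq_measure_integral => // A mA _; exact: lebesgue_rv_affine.
rewrite ge0_integral_mscale// [X in _ * X](@ge0_integral_pushforward _ _ _ _ _ _ measurable_rv_affine)//.
Qed.

End affine.

(** * Integrable and square-integrable functions *)

Section integrability.
Context d (T : measurableType d) (R : realType).
Variable mu : {measure set T -> \bar R}.
Implicit Types f g : T -> R.

Definition integ f := mu.-integrable setT (fun x => (f x)%:E).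

Lemma integ_measurable f : integ f -> measurable_fun setT f.
Proof. by move=> /measurable_int/measurable_EFinP. Qed.

Lemma le_integ f g : measurable_fun setT f -> integ g ->
  (forall x, `|f x| <= g x) -> integ f.
Proof.
move=> mf ig fg; apply: le_integrable ig => //; first exact/measurable_EFinP.
by move=> x _; rewrite /= lee_fin (le_trans (fg x))// ler_norm.
Qed.

Lemma integP f : integ f <->
  measurable_fun setT f /\ (\int[mu]_x (`|f x|)%:E < +oo)%E.
Proof.
split=> [/integrableP[/measurable_EFinP ? ?]//|[? ?]].
by apply/integrableP; split => //; exact/measurable_EFinP.
Qed.

Lemma integD f g : integ f -> integ g -> integ (fun x => f x + g x).
Proof. by move=> fi gi; exact: (integrableD measurableT fi gi). Qed.

Lemma integZ c f : integ f -> integ (fun x => c * f x).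
Proof.
move=> fi; rewrite /integ; under eq_fun do rewrite EFinM.
exact: (integrableZl measurableT c fi).
Qed.

Lemma integN f : integ f -> integ (fun x => - f x).
Proof. by move=> /(integZ (-1)); under eq_fun do rewrite mulN1r. Qed.

Lemma integB f g : integ f -> integ g -> integ (fun x => f x - g x).
Proof. by move=> fi /integN; exact: integD. Qed.

Lemma integ_norm f : integ f -> integ (fun x => `|f x|).
Proof.
move=> fi; apply: (le_integ _ (g := fun x => `|f x|)) => //.
- by apply: measurableT_comp => //; exact: integ_measurable.
- exact: (integrable_norm fi).
- by move=> x; rewrite normr_id.
Qed.

Lemma integ0 : integ (fun=> 0).
Proof. exact: integrable0. Qed.

Lemma integ_sum (I : Type) (s : seq I) (F : I -> T -> R) :
  (forall i, integ (F i)) -> integ (fun x => \sum_(i <- s) F i x).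
Proof.
move=> Fi; elim: s => [|i s IH].
  by under eq_fun do rewrite big_nil; exact: integ0.
by under eq_fun do rewrite big_cons; exact: integD.
Qed.

Lemma Rintegral_sum (I : Type) (s : seq I) (F : I -> T -> R) :
  (forall i, integ (F i)) ->
  \int[mu]_x (\sum_(i <- s) F i x) = \sum_(i <- s) \int[mu]_x F i x.
Proof.
move=> Fi; elim: s => [|i s IH].
  by rewrite big_nil /Rintegral; under eq_integral do rewrite big_nil; rewrite integral0.
rewrite big_cons -IH -RintegralD//; [|exact: Fi|exact: integ_sum].
by apply: eq_Rintegral => x _; rewrite big_cons.
Qed.

Lemma EFin_Rintegral f : integ f ->
  (\int[mu]_x (f x))%R%:E = (\int[mu]_x (f x)%:E)%E.
Proof. by move=> fi; rewrite /Rintegral fineK//; exact: integrable_fin_num. Qed.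

Lemma ae_eq_Rintegral f g : measurable_fun setT f -> measurable_fun setT g ->
  {ae mu, forall x, f x = g x} -> \int[mu]_x f x = \int[mu]_x g x.
Proof.
move=> mf mg fg; rewrite /Rintegral; congr fine; apply: ae_eq_integral => //.
- exact/measurable_EFinP.
- exact/measurable_EFinP.
- by apply: filterS fg => x -> _.
Qed.

Lemma ae_integ f g : measurable_fun setT g ->
  {ae mu, forall x, f x = g x} -> integ f -> integ g.
Proof.
move=> mg fg fi; apply/integP; split => //.
have /integP[mf] := fi; apply: le_lt_trans; rewrite le_eqVlt; apply/orP; left.
apply/eqP; apply: ae_eq_integral => //.
- by apply/measurable_EFinP; exact: measurableT_comp.
- by apply/measurable_EFinP; exact: measurableT_comp.
- by apply: filterS fg => x -> _.
Qed.

Definition L2 f := measurable_fun setT f /\ integ (fun x => f x ^+ 2).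

Definition sqn f := \int[mu]_x (f x ^+ 2).

Definition ip f g := \int[mu]_x (f x * g x).

Lemma L2_integM f g : L2 f -> L2 g -> integ (fun x => f x * g x).
Proof.
move=> [mf f2] [mg g2]; apply: (le_integ _ (integD f2 g2)).
  exact: measurable_funM.
move=> x; rewrite normrM -(real_normK (num_real (f x))) -(real_normK (num_real (g x))).
move: (`|f x|) (`|g x|) => a b; nra.
Qed.

Lemma L2D f g : L2 f -> L2 g -> L2 (fun x => f x + g x).
Proof.
move=> fL gL; split; first by apply: measurable_funD; [exact: fL.1|exact: gL.1].
under eq_fun do rewrite sqrrD.
by apply: integD gL.2; apply: integD fL.2 _; have := integZ 2 (L2_integM fL gL);
  under eq_fun do rewrite mulr_natl.
Qed.

Lemma L2Z c f : L2 f -> L2 (fun x => c * f x).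
Proof.
move=> fL; split; first by apply: measurable_funM => //; exact: fL.1.
by under eq_fun do rewrite exprMn; exact: integZ fL.2.
Qed.

Lemma L2B f g : L2 f -> L2 g -> L2 (fun x => f x - g x).
Proof.
by move=> fL /(L2Z (-1)) gL; have := L2D fL gL; under eq_fun do rewrite mulN1r.
Qed.

Lemma L2_sum (I : Type) (s : seq I) (F : I -> T -> R) :
  (forall i, L2 (F i)) -> L2 (fun x => \sum_(i <- s) F i x).
Proof.
move=> FL; elim: s => [|i s IH].
  under eq_fun do rewrite big_nil; split; first exact: measurable_cst.
  by under eq_fun do rewrite expr0n/=; exact: integ0.
by under eq_fun do rewrite big_cons; exact: L2D.
Qed.

Lemma sqn_ge0 f : 0 <= sqn f.
Proof. by apply: Rintegral_ge0 => x _; exact: sqr_ge0. Qed.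

Lemma sqnE f : sqn f = ip f f.
Proof. by apply: eq_Rintegral => x _; rewrite expr2. Qed.

Lemma sqnZ c f : L2 f -> sqn (fun x => c * f x) = c ^+ 2 * sqn f.
Proof.
by move=> [_ f2]; rewrite /sqn -RintegralZl//; apply: eq_Rintegral => x _; rewrite exprMn.
Qed.

Lemma ipBl f1 f2 g : L2 f1 -> L2 f2 -> L2 g ->
  ip (fun x => f1 x - f2 x) g = ip f1 g - ip f2 g.
Proof.
move=> f1L f2L gL; rewrite /ip -RintegralB//; try exact: L2_integM.
by apply: eq_Rintegral => x _; rewrite mulrBl.
Qed.

Lemma sqnD_scale c f g : L2 f -> L2 g ->
  sqn (fun x => f x + c * g x) = sqn f + 2 * c * ip f g + c ^+ 2 * sqn g.
Proof.
move=> fL gL; have fgi := L2_integM fL gL.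
rewrite /sqn /ip -RintegralZl// -[_ * Rintegral mu _ (fun x => g x ^+ 2)]RintegralZl//; last exact: gL.2.
have [f2 g2] := (fL.2, gL.2).
rewrite -RintegralD//; last exact: integZ.
rewrite -RintegralD//; [|exact: (integD f2 (integZ _ fgi))|exact: integZ].
by apply: eq_Rintegral => x _; ring.
Qed.

Lemma sqnB f g : L2 f -> L2 g ->
  sqn (fun x => f x - g x) = sqn f - 2 * ip f g + sqn g.
Proof.
move=> fL gL; have := sqnD_scale (-1) fL gL; under [X in sqn X]eq_fun do rewrite mulN1r.
by move=> ->; ring.
Qed.

(** The squared norm of [f + c g] is a nonnegative quadratic polynomial in [c]. *)
Lemma cauchy_schwarz f g : L2 f -> L2 g -> ip f g ^+ 2 <= sqn f * sqn g.
Proof.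
move=> fL gL.
have h c : 0 <= sqn f + 2 * c * ip f g + c ^+ 2 * sqn g.
  by rewrite -sqnD_scale// sqn_ge0.
have := sqn_ge0 g; rewrite le_eqVlt => /predU1P[g0|g0]; last first.
  have := h (- (ip f g / sqn g)).
  have -> : sqn f + 2 * - (ip f g / sqn g) * ip f g + (- (ip f g / sqn g)) ^+ 2 * sqn g
    = (sqn f * sqn g - ip f g ^+ 2) / sqn g by field; rewrite gt_eqF.
  by rewrite pmulr_lge0 ?invr_gt0// subr_ge0.
rewrite -g0 mulr0; have [->|ip0] := eqVneq (ip f g) 0; first by rewrite expr0n.
have := h (- ((sqn f + 1) / (2 * ip f g))).
rewrite -g0 mulr0 addr0.
have -> : sqn f + 2 * - ((sqn f + 1) / (2 * ip f g)) * ip f g = -1 by field.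
by rewrite oppr_ge0 ler10.
Qed.

Definition cvg2 (F : nat -> T -> R) f := sqn (fun x => F k x - f x) @[k --> \oo] --> 0.

Lemma cvg_sqr0 (u : nat -> R) : (u k ^+ 2 @[k --> \oo] --> 0) -> u k @[k --> \oo] --> 0.
Proof.
move=> /cvgrPdist_lt h; apply/cvgrPdist_lt => e e0.
have e20 : 0 < e ^+ 2 by rewrite exprn_gt0.
near=> k; rewrite sub0r normrN; have : `|0 - u k ^+ 2| < e ^+ 2 by near: k; exact: h.
by rewrite sub0r normrN normrX ltr_pXn2r// nnegrE// ltW.
Unshelve. all: by end_near. Qed.

Lemma cvg2_ip F f g : (forall k, L2 (F k)) -> L2 f -> L2 g -> cvg2 F f ->
  ip (F k) g @[k --> \oo] --> ip f g.
Proof.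
move=> FL fL gL Ff; apply/subr_cvg0; apply: cvg_sqr0.
apply: (@squeeze_cvgr _ _ _ _ (fun=> 0) (fun k => sqn (fun x => F k x - f x) * sqn g)).
- near=> k; rewrite sqr_ge0/= -ipBl//; apply: cauchy_schwarz => //; exact: L2B.
- exact: cvg_cst.
- by rewrite -[0](mul0r (sqn g)); apply: cvgMr_tmp.
Unshelve. all: by end_near. Qed.

Lemma cvg2_sqn F f : (forall k, L2 (F k)) -> L2 f -> cvg2 F f ->
  sqn (F k) @[k --> \oo] --> sqn f.
Proof.
move=> FL fL Ff.
rewrite (_ : (fun k => sqn (F k)) =
   fun k => sqn (fun x => F k x - f x) + 2 * ip (F k) f - sqn f); last first.
  by apply/funext => k; rewrite sqnB//; ring.
rewrite [X in _ --> X](_ : _ = 0 + 2 * ip f f - sqn f); last by rewrite sqnE; ring.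
apply: cvgB; last exact: cvg_cst.
apply: cvgD => //; apply: cvgM; first exact: cvg_cst.
exact: cvg2_ip.
Qed.

Lemma fatou_sqr (G : nat -> T -> R) g (M : \bar R) :
  (forall j, measurable_fun setT (G j)) -> measurable_fun setT g ->
  {ae mu, forall x, G j x @[j --> \oo] --> g x} ->
  (\forall j \near \oo, (\int[mu]_x ((G j x) ^+ 2)%:E <= M)%E) ->
  (\int[mu]_x ((g x) ^+ 2)%:E <= M)%E.
Proof.
move=> mG mg Gg GM.
have mG2 j : measurable_fun setT (fun x => ((G j x) ^+ 2)%:E).
  by apply/measurable_EFinP; exact: measurable_funX.
have -> : (\int[mu]_x ((g x) ^+ 2)%:E =
    \int[mu]_x limn_einf (fun j => ((G j x) ^+ 2)%:E))%E.
  apply: ge0_ae_eq_integral => //.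
  - by apply/measurable_EFinP; exact: measurable_funX.
  - rewrite /limn_einf; apply: measurableT_comp => //.
    by apply: measurable_fun_limn_esup => j; exact: measurableT_comp.
  - by move=> x _; rewrite lee_fin sqr_ge0.
  - move=> x _; rewrite limn_einf_lim; apply: lime_ge; first exact: is_cvg_einfs.
    apply: nearW => n; apply: le_ereal_inf_tmp => _ [m /= nm <-].
    by rewrite lee_fin sqr_ge0.
  apply: filterS Gg => x Gx _; apply/esym.
  have /cvg_limn_einf_sup[] // : ((G j x) ^+ 2)%:E @[j --> \oo] --> ((g x) ^+ 2)%:E.
  by apply: cvg_EFin; [exact: nearW|rewrite expr2; under eq_fun do rewrite /= expr2; exact: cvgM].
apply: le_trans (fatou mu measurableT mG2 _) _.
  by move=> j x _; rewrite lee_fin sqr_ge0.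
rewrite limn_einf_lim; apply: lime_le; first exact: is_cvg_einfs.
case: GM => k0 _ k0M; apply: nearW => n.
apply: (@le_trans _ _ (\int[mu]_x ((G (maxn n k0) x) ^+ 2)%:E)%E).
  by apply: ereal_inf_lbound; exists (maxn n k0) => //=; rewrite leq_maxl.
by apply: k0M; rewrite /= leq_maxr.
Qed.

Lemma sum_half_le (k : nat) : \sum_(i < k) (2^-1 : R) ^+ i <= 2.
Proof.
suff -> : \sum_(i < k) (2^-1 : R) ^+ i = 2 - 2 * 2^-1 ^+ k by rewrite gerBl mulr_ge0// exprn_ge0.
elim: k => [|k IH]; first by rewrite big_ord0 expr0; lra.
by rewrite big_ord_recr /= IH exprS; lra.
Qed.

(** Along a subsequence with squared increments below [8^-i], the sum of
    [2^i] times the squared increments has finite integral, so the subsequence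
    converges almost everywhere; Fatou's lemma turns the Cauchy condition into
    convergence in mean square of the whole sequence. *)
Lemma L2_complete (F : nat -> T -> R) : (forall k, L2 (F k)) ->
  (forall e, 0 < e -> exists k0, forall j k, (k0 <= j)%N -> (k0 <= k)%N ->
     sqn (fun x => F j x - F k x) < e) ->
  exists2 W, L2 W & cvg2 F W.
Proof.
move=> FL Fc.
have e0 i : 0 < (8^-1 : R) ^+ i by rewrite exprn_gt0// invr_gt0.
have [n0 n0P] := choice (fun i => Fc _ (e0 i)).
(* the maximum makes the chosen ranks nondecreasing *)
pose n i := \max_(k < i.+1) n0 k.
have n0n i : (n0 i <= n i)%N by rewrite /n; apply: (@leq_bigmax _ (fun k : 'I_i.+1 => n0 k) ord_max).
have nd i : (n i <= n i.+1)%N by rewrite /n [leqRHS]big_ord_recr/= leq_maxl.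
have ndn i j : (i <= j)%N -> (n i <= n j)%N.
  by elim: j => [|j IH]; [rewrite leqn0 => /eqP ->|rewrite leq_eqVlt => /predU1P[->//|/IH/leq_trans->]].
pose f i := F (n i).
pose d_ i x := f i.+1 x - f i x.
have dL i : L2 (d_ i) by apply: L2B; exact: FL.
have dsq i : sqn (d_ i) < 8^-1 ^+ i.
  by apply: n0P; rewrite ?n0n// (leq_trans (n0n i)).
pose h i x := (2 ^+ i * d_ i x ^+ 2)%:E.
have mh i : measurable_fun setT (h i).
  by apply/measurable_EFinP/measurable_funM => //; apply: measurable_funX; exact: (dL i).1.
have h0 i x : (0 <= h i x)%E by rewrite lee_fin mulr_ge0 ?sqr_ge0// exprn_ge0.
pose H x := (\sum_(i <oo) h i x)%E.
have mH : measurable_fun setT H by apply: ge0_emeasurable_sum.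
have intH : (\int[mu]_x H x <= 2%:E)%E.
  rewrite integral_nneseries//; apply: lime_le.
    by apply: is_cvg_nneseries => i _ _; exact: integral_ge0.
  apply: nearW => k; apply: (@le_trans _ _ (\sum_(i < k) 2^-1 ^+ i)%:E); last by rewrite lee_fin sum_half_le.
  rewrite -sumEFin big_mkord; apply: lee_sum => i _; rewrite /h.
  rewrite -EFin_Rintegral; last by apply: integZ; exact: (dL i).2.
  rewrite lee_fin RintegralZl//; last exact: (dL i).2.
  apply: (@le_trans _ _ (2 ^+ i * 8^-1 ^+ i)).
    by rewrite ler_pM2l ?exprn_gt0//; exact/ltW/dsq.
  rewrite -exprMn; apply: lerXn2r; rewrite ?nnegrE; lra.
pose A := [set x | (H x < +oo)%E].
have mA : measurable A by rewrite -[A]setTI; apply: measurable_lte.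
have aeA : {ae mu, forall x, A x}.
  have Hi : mu.-integrable setT H.
    apply/integrableP; split => //; apply: le_lt_trans (ltry 2).
    apply: le_trans intH; rewrite le_eqVlt; apply/orP; left; apply/eqP.
    by apply: eq_integral => x _; rewrite gee0_abs// nneseries_ge0.
  apply: filterS (integrable_ae measurableT Hi) => x /(_ Logic.I) Hx.
  by rewrite /A/= ltey_eq Hx.
have cf x : A x -> cvgn (fun i => f i x).
  move=> Ax; rewrite (_ : (fun i => f i x) = fun i => f 0%N x + series (d_ ^~ x) i); last first.
    apply/funext => i; rewrite /series/= /d_.
    by rewrite (telescope_sumr (fun i => f i x))// addrC subrK.
  apply: is_cvgD; first exact: is_cvg_cst.
  apply: normed_cvg.
  apply: (@nondecreasing_is_cvgn _ _).
    by apply/nondecreasing_series => i _ _; exact: normr_ge0.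
  exists (2 + fine (H x)) => _ [k _ <-].
  apply: (@le_trans _ _ (\sum_(i < k) ((2^-1) ^+ i + 2 ^+ i * d_ i x ^+ 2))).
    change (\sum_(0 <= i < k) `|d_ i x| <= \sum_(i < k) (2^-1 ^+ i + 2 ^+ i * d_ i x ^+ 2)).
    rewrite big_mkord; apply: ler_sum => i _.
    have p0 : 0 < 2 ^+ i :> R by rewrite exprn_gt0.
    rewrite exprVn -(real_normK (num_real (d_ i x))).
    have : (2 ^+ i)^-1 * 2 ^+ i = 1 :> R by rewrite mulVf// gt_eqF.
    have : 0 < (2 ^+ i)^-1 :> R by rewrite invr_gt0.
    move: (2 ^+ i) ((2 ^+ i)^-1) (`|d_ i x|) p0 => p q a p0 q0 qp.
    have : 0 <= q * (1 - p * a) ^+ 2 by rewrite mulr_ge0 ?sqr_ge0// ltW.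
    have -> : q * (1 - p * a) ^+ 2 = q - 2 * (q * p) * a + (q * p) * p * a ^+ 2 by ring.
    have := sqr_ge0 (q - p * a ^+ 2); rewrite qp; nra.
  rewrite big_split/= lerD ?sum_half_le//.
  rewrite -lee_fin fineK; last by rewrite ge0_fin_numE// nneseries_ge0.
  rewrite -sumEFin; have := @nneseries_lim_ge _ (h ^~ x) xpredT 0 k.
  rewrite big_mkord; apply => i _ _; exact: h0.
pose g i x := f i x * \1_A x.
have mg i : measurable_fun setT (g i).
  apply: measurable_funM; first exact: (FL _).1.
  exact: measurable_indic.
pose W x := limn (g ^~ x).
have gW x : g i x @[i --> \oo] --> W x.
  apply/cvg_ex; have [Ax|nAx] := pselect (A x).
    have /cvg_ex[l fl] := cf x Ax; exists l.
    rewrite /g; under eq_fun do rewrite indicE mem_set// mulr1; exact: fl.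
  exists 0; rewrite /g; under eq_fun do rewrite indicE memNset// mulr0; exact: cvg_cst.
have mW : measurable_fun setT W by apply: (measurable_fun_cvg mg) => x _; exact: gW.
have fW : {ae mu, forall x, f i x @[i --> \oo] --> W x}.
  apply: filterS aeA => x Ax; have := gW x.
  by rewrite /g; under [X in X @ _ --> _]eq_fun do rewrite indicE mem_set// mulr1.
have est i k : (n i <= k)%N -> (\int[mu]_x ((F k x - W x) ^+ 2)%:E <= (8^-1 ^+ i)%:E)%E.
  move=> nik; apply: (@fatou_sqr (fun j x => F k x - f j x)).
  - by move=> j; apply: measurable_funB; exact: (FL _).1.
  - by apply: measurable_funB => //; exact: (FL _).1.
  - by apply: filterS fW => x fx; apply: cvgB => //; exact: cvg_cst.
  near=> j; have jk : L2 (fun x => F k x - f j x) by apply: L2B; exact: FL.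
  rewrite -EFin_Rintegral; last exact: jk.2.
  rewrite lee_fin ltW//; apply: n0P; first exact: leq_trans nik.
  by apply: (leq_trans (n0n i)); apply: ndn; near: j; exact: nbhs_infty_ge.
have L2FW k : (n 0%N <= k)%N -> L2 (fun x => F k x - W x).
  move=> nk; have mFW : measurable_fun setT (fun x => F k x - W x).
    by apply: measurable_funB => //; exact: (FL _).1.
  split => //; apply/integP; split; first exact: measurable_funX.
  apply: (@le_lt_trans _ _ 1%E); last exact: ltry.
  rewrite -[1%E]/((1 : R)%:E) -(expr0 (8^-1 : R)).
  apply: le_trans (est 0%N k nk); rewrite le_eqVlt; apply/orP; left.
  by apply/eqP; apply: eq_integral => x _; rewrite ger0_norm// sqr_ge0.
exists W.
  have := L2B (FL (n 0%N)) (L2FW _ (leqnn _)).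
  by under eq_fun do rewrite subKr.
apply/cvgrPdist_lt => e e_gt0.
have /cvgrPdist_lt/(_ _ e_gt0)[i _ /(_ i (leqnn i)) ie] : (8^-1 : R) ^+ i @[i --> \oo] --> 0.
  by apply: cvg_expr; rewrite ger0_norm ?invr_ge0// invf_lt1// ltr1n.
near=> k.
have nik : (n i <= k)%N by near: k; exact: nbhs_infty_ge.
rewrite sub0r normrN ger0_norm ?sqn_ge0//; apply: le_lt_trans _ ie.
rewrite sub0r normrN ger0_norm ?exprn_ge0 ?invr_ge0// -lee_fin EFin_Rintegral; first exact: est.
by have [] := L2FW k (leq_trans (ndn _ _ (leq0n i)) nik).
Unshelve. all: by end_near. Qed.

End integrability.

(** * Partial derivatives, smooth functions and test functions *)

Section directional.
Context {R : realType} {N : nat}.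
Implicit Types (f g : 'rV[R]_N -> R) (x v a : 'rV[R]_N).

Lemma is_derive_line0 f x v df :
  is_derive x v f df <-> is_derive (0 : R) 1 (fun h : R => f (h *: v + x)) df.
Proof.
pose q1 := fun h : R => h^-1 *: ((f \o shift x) (h *: v) - f x).
pose g := fun h : R => f (h *: v + x).
pose q2 := fun h : R => h^-1 *: ((g \o shift 0) (h *: 1) - g 0).
have q12 : q1 = q2.
  by apply/funext => h; rewrite /q1 /q2 /g/= scale0r add0r addr0 [_%:A]mulr1.
have dE : derivable f x v <-> derivable g 0 1 by rewrite /derivable -/q1 -/q2 q12.
have DE : 'D_v f x = 'D_1 g 0 by rewrite /derive -/q1 -/q2 q12.
by split=> -[d1 d2]; split; [exact/dE|rewrite -DE|exact/dE|rewrite DE].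
Qed.

Lemma is_derive_line f x v (s : R) df :
  is_derive (s *: v + x) v f df <->
  is_derive s 1 (fun h : R => f (h *: v + x)) df.
Proof.
rewrite is_derive_line0.
pose q1 := fun h : R => h^-1 *:
  (((fun h : R => f (h *: v + (s *: v + x))) \o shift 0) (h *: 1) -
   f (0 *: v + (s *: v + x))).
pose q2 := fun h : R => h^-1 *:
  (((fun h : R => f (h *: v + x)) \o shift s) (h *: 1) - f (s *: v + x)).
have q12 : q1 = q2.
  by apply/funext => h; rewrite /q1 /q2/= scale0r add0r addr0 addrA -scalerDl.
split=> -[d1 d2]; split; move: d1 d2; rewrite /derivable /derive -/q1 -/q2 q12//.
Qed.

Lemma is_derive_affine f (r : R) a x v df :
  is_derive (r *: x + a) v f df ->
  is_derive x v (fun y => f (r *: y + a)) (r * df).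
Proof.
move=> /is_derive_line0 fd; apply/is_derive_line0.
rewrite (_ : (fun h : R => f (r *: (h *: v + x) + a)) =
  (fun k : R => f (k *: v + (r *: x + a))) \o (fun h : R => r * h)); last first.
  by apply/funext => h /=; rewrite scalerDr scalerA addrA.
have rd : is_derive (0 : R) 1 (fun h : R => r * h) r.
  by apply: is_derive_eq; rewrite [_ *: _]mulr1.
rewrite mulrC; apply: is_derive1_comp; first by rewrite mulr0.
Qed.

Lemma is_derive_mul f g x v df dg : is_derive x v f df -> is_derive x v g dg ->
  is_derive x v (fun y => f y * g y) (df * g x + f x * dg).
Proof.
move=> [fd <-] [gd <-]; split; first exact: (derivableM fd gd).
by rewrite (deriveM fd gd) addrC mulrC.
Qed.

Lemma is_derive_add f g x v df dg : is_derive x v f df -> is_derive x v g dg ->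
  is_derive x v (fun y => f y + g y) (df + dg).
Proof.
move=> [fd <-] [gd <-]; split; first exact: (derivableD fd gd).
by rewrite (deriveD fd gd).
Qed.

Definition ei (i : 'I_N) : 'rV[R]_N := delta_mx 0 i.

Lemma is_derive_partial f i x : derivable f x (ei i) ->
  is_derive x (ei i) f (partial i f x).
Proof. by move=> fd; split. Qed.

Lemma partialE f i x df : is_derive x (ei i) f df -> partial i f x = df.
Proof. by case. Qed.

Lemma MVT_partial f i : (forall x, derivable f x (ei i)) ->
  forall x (s : R), exists2 c : R, `|c| <= `|s| &
    f (s *: ei i + x) - f x = s * partial i f (c *: ei i + x).
Proof.
move=> fd.
have main x (s : R) : 0 < s -> exists2 c : R, 0 <= c <= s &
    f (s *: ei i + x) - f x = s * partial i f (c *: ei i + x).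
  move=> s0.
  have dl (h : R) : is_derive h 1 (fun h : R => f (h *: ei i + x)) (partial i f (h *: ei i + x)).
    by apply/is_derive_line; exact: is_derive_partial.
  have [|c cs] := @MVT _ (fun h : R => f (h *: ei i + x)) (fun h => partial i f (h *: ei i + x)) _ _ s0 (fun h _ => dl h).
    apply/continuous_subspaceT => h.
    by apply/differentiable_continuous/derivable1_diffP; exact: (@ex_derive _ _ _ _ _ _ _ (dl h)).
  rewrite scale0r add0r subr0 mulrC => h; exists c => //.
  by move: cs; rewrite in_itv/= => /andP[/ltW-> /ltW->].
move=> x s; have [s0|s0|<-] := ltgtP 0 s.
- have [c /andP[c0 cs] h] := main x s s0; exists c => //.
  by rewrite !ger0_norm// ltW.
- have [|c /andP[c0 cs] h] := main (s *: ei i + x) (- s); first by rewrite oppr_gt0.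
  exists (s + c); first by rewrite !ler0_norm ?(ltW s0)//; lra.
  move: h; rewrite !addrA -!scalerDl addNr scale0r add0r mulNr.
  by rewrite (addrC c) => /(congr1 -%R); rewrite opprB opprK.
- by exists 0; rewrite // scale0r add0r subrr mul0r.
Qed.

End directional.

Lemma affine_continuous {R : realType} {N : nat} (r : R) (a : 'rV[R]_N) :
  continuous (fun y : 'rV[R]_N => r *: y + a).
Proof.
move=> x; apply: (@continuousD _ _ _ (fun y : 'rV[R]_N => r *: y) (fun=> a) x).
  exact: (@scaler_continuous _ 'rV[R]_N r x).
exact: cst_continuous.
Qed.

Section smooth_closure.
Context {R : realType} {N : nat}.
Implicit Types (f g : 'rV[R]_N -> R) (x v a : 'rV[R]_N).

Lemma smooth_continuous f : smooth f -> continuous f.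
Proof. by move=> /(_ [::]) []. Qed.

Lemma smooth_derivable f i x : smooth f -> derivable f x (ei i).
Proof. by move=> /(_ [::]) [_ ]; exact. Qed.
Lemma smooth_is_derive f i x : smooth f -> is_derive x (ei i) f (partial i f x).
Proof. by move=> sf; apply: is_derive_partial; exact: smooth_derivable. Qed.

Lemma smooth_partial f i : smooth f -> smooth (partial i f).
Proof. by move=> sf s; have := sf (rcons s i); rewrite foldr_rcons. Qed.

Lemma smooth_foldr f s : smooth f -> smooth (foldr partial f s).
Proof. by move=> sf; elim: s => [|i s IH]; [exact: sf|exact: smooth_partial]. Qed.

(** Smoothness is the largest class of continuous functions with partial
    derivatives in all directions that is stable under partial derivation. *)
Lemma smooth_coind (C : ('rV[R]_N -> R) -> Prop) :
  (forall f, C f -> [/\ continuous f, forall i x, derivable f x (ei i) &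
    forall i, C (partial i f)]) ->
  forall f, C f -> smooth f.
Proof.
move=> Ccl f Cf s; have : C (foldr partial f s).
  by elim: s => //= i s /Ccl[_ _]; exact.
by case/Ccl.
Qed.

(** Sums and products of smooth functions are not visibly stable under the
    iterated derivatives of the definition of [smooth], while the algebra generated by a
    class of functions is. *)
Inductive alg_closure (B : ('rV[R]_N -> R) -> Prop) : ('rV[R]_N -> R) -> Prop :=
| alg_base f : B f -> alg_closure B f
| alg_cst c : alg_closure B (fun=> c)
| alg_add f g : alg_closure B f -> alg_closure B g ->
    alg_closure B (fun x => f x + g x)
| alg_mul f g : alg_closure B f -> alg_closure B g ->
    alg_closure B (fun x => f x * g x).

Lemma smooth_alg_closure (B : ('rV[R]_N -> R) -> Prop) :
  (forall f, B f -> [/\ continuous f, forall i x, derivable f x (ei i) &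
    forall i, alg_closure B (partial i f)]) ->
  forall f, alg_closure B f -> smooth f.
Proof.
move=> Bcl; apply: smooth_coind => f.
elim=> {f} [f /Bcl//|c|f g Cf [cf df Cdf] Cg [cg dg Cdg]|f g Cf [cf df Cdf] Cg [cg dg Cdg]].
- split=> [|i x|i]; [exact: cst_continuous|exact: derivable_cst|].
  rewrite (_ : partial i _ = fun=> 0); first exact: alg_cst.
  by apply/funext => x; exact: partialE.
- split=> [x|i x|i]; [exact: (cvgD (cf x) (cg x))|exact: derivableD|].
  rewrite (_ : partial i _ = fun x => partial i f x + partial i g x); first exact: alg_add.
  by apply/funext => x; apply: partialE; apply: is_derive_add; exact: is_derive_partial.
- split=> [x|i x|i]; [exact: (cvgM (cf x) (cg x))|exact: derivableM|].
  rewrite (_ : partial i _ = fun x => partial i f x * g x + f x * partial i g x).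
    by apply: alg_add; exact: alg_mul.
  by apply/funext => x; apply: partialE; apply: is_derive_mul; exact: is_derive_partial.
Qed.

Lemma alg_smooth f : alg_closure smooth f -> smooth f.
Proof.
apply: smooth_alg_closure => {}f sf; split; first exact: smooth_continuous.
  by move=> i x; exact: smooth_derivable.
by move=> i; apply: alg_base; exact: smooth_partial.
Qed.

Lemma smoothD f g : smooth f -> smooth g -> smooth (fun x => f x + g x).
Proof. by move=> sf sg; apply: alg_smooth; apply: alg_add; exact: alg_base. Qed.

Lemma smoothM f g : smooth f -> smooth g -> smooth (fun x => f x * g x).
Proof. by move=> sf sg; apply: alg_smooth; apply: alg_mul; exact: alg_base. Qed.

Lemma smooth_cst c : smooth (fun _ : 'rV[R]_N => c).
Proof. by apply: alg_smooth; exact: alg_cst. Qed.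

Lemma smoothZ c f : smooth f -> smooth (fun x => c * f x).
Proof. by move=> sf; exact: (smoothM (smooth_cst c) sf). Qed.

Lemma smooth_sum (I : Type) (s : seq I) (F : I -> 'rV[R]_N -> R) :
  (forall i, smooth (F i)) -> smooth (fun x => \sum_(i <- s) F i x).
Proof.
move=> sF; elim: s => [|i s IH].
  rewrite (_ : (fun x => _) = fun=> 0); first exact: smooth_cst.
  by apply/funext => x; rewrite big_nil.
rewrite (_ : (fun x => _) = fun x => F i x + \sum_(j <- s) F j x).
  exact: (smoothD (sF i) IH).
by apply/funext => x; rewrite big_cons.
Qed.

Lemma partialD f g i : smooth f -> smooth g ->
  partial i (fun x => f x + g x) = fun x => partial i f x + partial i g x.
Proof.
by move=> sf sg; apply/funext => x; apply: partialE; apply: is_derive_add;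
  exact: smooth_is_derive.
Qed.

Lemma partialZ c f i : smooth f ->
  partial i (fun x => c * f x) = fun x => c * partial i f x.
Proof.
move=> sf; apply/funext => x; have h := is_derive_mul (is_derive_cst c x (ei i)) (smooth_is_derive i x sf).
by rewrite (partialE h) mul0r add0r.
Qed.

Lemma partial_affine (c r : R) a f i : smooth f ->
  partial i (fun x => c * f (r *: x + a)) = fun x => c * r * partial i f (r *: x + a).
Proof.
move=> sf; apply/funext => x; 
have h := is_derive_mul (is_derive_cst c x (ei i))
  (is_derive_affine (smooth_is_derive i (r *: x + a) sf)).
by rewrite (partialE h) mul0r add0r mulrA.
Qed.

Lemma smooth_affine (c r : R) a f : smooth f -> smooth (fun x => c * f (r *: x + a)).
Proof.
pose C h := exists f, exists2 c, smooth f & h = fun x => c * f (r *: x + a).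
suff CS h : C h -> smooth h by move=> sf; apply: CS; exists f, c.
apply: smooth_coind => {}h [{}f [{}c sf ->]]; split.
- move=> x.
  have ca := @affine_continuous _ _ r a x.
  have cf : continuous f by exact: smooth_continuous.
  have cfa := continuous_comp ca (cf _).
  exact: (cvgM (cvg_cst c) cfa).
- move=> i x; apply: (@ex_derive _ _ _ _ _ _ _ (is_derive_mul (is_derive_cst c _ _) (is_derive_affine (smooth_is_derive i _ sf)))).
- by move=> i; exists (partial i f), (c * r); [exact: smooth_partial|exact: partial_affine].
Qed.

End smooth_closure.
Arguments smooth_derivable {R N} f i x _.

Section schwarz.
Context {R : realType} {N : nat}.
Implicit Types (f g : 'rV[R]_N -> R) (x v a : 'rV[R]_N).

Lemma norm_ei_le1 (i : 'I_N) : `|ei i : 'rV[R]_N| <= 1.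
Proof.
rewrite [leLHS]/Num.norm/= mx_normrE; apply/bigmax_leP; split => // -[k j] _ /=.
by rewrite mxE; case: (_ && _); rewrite ?normr1 ?normr0.
Qed.

Lemma norm_scale_ei (c : R) (i : 'I_N) : `|c *: ei i : 'rV[R]_N| <= `|c|.
Proof. by rewrite normrZ ler_piMr// norm_ei_le1. Qed.

Let second_difference f i j x (s : R) := f (s *: ei i + (s *: ei j + x))
   - f (s *: ei i + x) - (f (s *: ei j + x) - f x).

Let second_difference_mvt f i j x s : smooth f ->
  exists c c' : R, [/\ `|c| <= `|s|, `|c'| <= `|s| &
    second_difference f i j x s = s ^+ 2 * partial j (partial i f) (c' *: ei j + (c *: ei i + x))].
Proof.
move=> sf.
pose g y := f (s *: ei j + y) + (-1) * f y.
have sg1 : smooth (fun y => f (s *: ei j + y)).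
  rewrite (_ : (fun y => _) = fun y => 1 * f (1 *: y + s *: ei j)).
    exact: smooth_affine.
  by apply/funext => y; rewrite mul1r scale1r addrC.
have sg2 : smooth (fun y => (-1) * f y) by exact: smoothZ.
have sg : smooth g by exact: (smoothD sg1 sg2).
have pg : partial i g = fun y => partial i f (s *: ei j + y) - partial i f y.
  rewrite /g (partialD i sg1 sg2) (partialZ _ _ sf).
  rewrite (_ : (fun y => f (s *: ei j + y)) = fun y => 1 * f (1 *: y + s *: ei j)); last first.
    by apply/funext => y; rewrite mul1r scale1r addrC.
  rewrite (partial_affine _ _ _ _ sf); apply/funext => y.
  by rewrite !mul1r scale1r mulN1r addrC (addrC y) [RHS]addrC.
have [c cs Dc] := MVT_partial (fun x => smooth_derivable g i x sg) x s.
have sfi := smooth_partial i sf.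
have [c' cs' Dc'] := MVT_partial (fun x => smooth_derivable _ j x sfi) (c *: ei i + x) s.
exists c, c'; split => //.
move: Dc; rewrite pg Dc' /g /second_difference !mulN1r => h.
by rewrite expr2 -mulrA -h addrCA opprD opprK; ring.
Qed.

(** Schwarz: by the mean value theorem applied twice, the symmetric second
    difference divided by [s ^+ 2] is a value of either mixed derivative at a point
    close to [x]. *)
Lemma partialC f i j : smooth f -> partial i (partial j f) = partial j (partial i f).
Proof.
move=> sf; apply/funext => x; apply/eqP; rewrite -subr_eq0 -normr_le0.
apply/ler_addgt0Pl => e e0; rewrite addr0.
have near_val g : smooth g -> exists2 d : R, 0 < d &
    forall c c' k l, `|c| <= d -> `|c'| <= d -> `|g x - g (c *: ei k + (c' *: ei l + x))| < e / 2.
  move=> sg; have cg : continuous g by exact: smooth_continuous.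
  have e20 : 0 < e / 2 by rewrite divr_gt0.
  have /cvgrPdist_lt/(_ _ e20)/nbhs_ballP[d /= d0 dg] := cg x.
  exists (d / 3); first by rewrite divr_gt0.
  move=> c c' k l cd cd'; apply: dg; rewrite mx_norm_ball /ball_/=.
  rewrite addrA opprD addrCA subrr addr0 normrN.
  apply: (le_lt_trans (ler_normD _ _)).
  have := norm_scale_ei c k; have := norm_scale_ei c' l; lra.
have [d1 d10 h1] := near_val _ (smooth_partial i (smooth_partial j sf)).
have [d2 d20 h2] := near_val _ (smooth_partial j (smooth_partial i sf)).
pose s := Num.min d1 d2.
have s0 : 0 < s by rewrite lt_min d10.
have ss : `|s| <= d1 /\ `|s| <= d2.
  by rewrite gtr0_norm// /s !ge_min !lexx orbT.
have s2 : s ^+ 2 != 0 by rewrite expf_neq0// gt_eqF.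
have [c [c' [cs cs' Dij]]] := second_difference_mvt i j x s sf.
have [b [b' [bs bs' Dji]]] := second_difference_mvt j i x s sf.
have DC : second_difference f i j x s = second_difference f j i x s.
  by rewrite /second_difference addrCA; move: (f _) (f _) (f _) (f _) => A1 A2 A3 A4; clear; ring.
have E := mulfI s2 (etrans (esym Dji) (etrans (esym DC) Dij)).
have H1 := h1 b' b i j (le_trans bs' ss.1) (le_trans bs ss.1).
have H2 := h2 c' c j i (le_trans cs' ss.2) (le_trans cs ss.2).
move: E H1 H2; clear.
move: (partial i (partial j f) _) (partial j (partial i f) _).
move: (partial i (partial j f) x) (partial j (partial i f) x) => X Y A _ <-.
rewrite !ltr_norml ler_norml => /andP[? ?] /andP[? ?].
by apply/andP; split; lra.
Qed.

End schwarz.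

Section test_functions.
Context {R : realType} {N : nat}.
Implicit Types (f g : 'rV[R]_N -> R) (x v a : 'rV[R]_N).
Local Notation mu := (@lebesgue_rv R N).

(** Continuous functions with compact support. *)
Definition ccs f := continuous f /\ exists M : R, forall x, M < `|x| -> f x = 0.

Lemma rv_norm_le_cube M : [set x : 'rV[R]_N | `|x| <= M] `<=` rv_cube (- M) M.
Proof.
move=> x /= xM i; rewrite /= in_itv/= -ler_norml.
exact: le_trans (coord_le_norm x i) xM.
Qed.

Lemma compact_norm_le M : compact [set x : 'rV[R]_N | `|x| <= M].
Proof.
apply: bounded_closed_compact.
  by exists M; split => [|k Mk x /= xM]; [exact: num_real|exact: le_trans xM (ltW Mk)].
have := @closed_closed_ball_ _ _ (0 : 'rV[R]_N) M; congr closed.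
by apply/seteqP; split => y; rewrite /closed_ball_/= sub0r normrN.
Qed.

Lemma test_functionP f : test_function f <->
  smooth f /\ exists M : R, forall x, M < `|x| -> f x = 0.
Proof.
split=> [[sf cf]|[sf [M fM]]]; split => //.
  have [M [_ Mf]] := compact_bounded cf.
  exists (M + 1) => x Mx; apply: contrapT => /eqP fx.
  have /Mf/(_ x) : M < M + 1 by rewrite ltrDl.
  move=> h; have /h/= : closure [set x | f x != 0] x by exact: subset_closure.
  by rewrite leNgt Mx.
apply: (@subclosed_compact _ (closure [set x | f x != 0]) [set x : 'rV[R]_N | `|x| <= M]).
- exact: closed_closure.
- exact: compact_norm_le.
rewrite [X in _ `<=` X](closure_id _).1; last first.
  by apply: compact_closed; [exact: norm_hausdorff|exact: compact_norm_le].
apply: closureS => x /= fx; rewrite leNgt; apply: contra fx => /fM ->.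
by rewrite eqxx.
Qed.

Lemma test_smooth f : test_function f -> smooth f.
Proof. by case. Qed.

Lemma test_ccs f : test_function f -> ccs f.
Proof. by move=> /test_functionP[sf fM]; split => //; exact: smooth_continuous. Qed.

Lemma ccs_bounded f : ccs f -> exists2 C : R, 0 <= C & forall x, `|f x| <= C.
Proof.
move=> [cf [M fM]].
have /compact_bounded[C [_ Cf]] : compact (f @` [set x : 'rV[R]_N | `|x| <= M]).
  by apply: continuous_compact; [exact: continuous_subspaceT|exact: compact_norm_le].
exists (`|C| + 1); first by rewrite addr_ge0.
move=> x; have [xM|/fM ->] := leP `|x| M; last by rewrite normr0 addr_ge0.
by apply: Cf; [rewrite ltr_pwDr// ler_norm|exists x].
Qed.

Lemma ccs_measurable f : ccs f -> measurable_fun setT f.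
Proof. by move=> [cf _]; exact: continuous_measurable_rv. Qed.

Lemma integ_indic (A : set 'rV[R]_N) : measurable A -> (mu A < +oo)%E ->
  integ mu (\1_A : _ -> R).
Proof.
move=> mA Ay; apply/integP; split; first exact: measurable_indic.
under eq_integral do rewrite ger0_norm//.
by rewrite integral_indic// setIT.
Qed.

Lemma ccs_dominated f : ccs f -> exists C M : R, [/\ 0 <= C, 0 <= M &
  forall x, `|f x| <= C * \1_(rv_cube (- M) M) x].
Proof.
move=> fc; have [C C0 fC] := ccs_bounded fc; have [_ [M fM]] := fc.
exists C, `|M|; split => // x; rewrite indicE; have [Mx|xM] := ltP `|M| `|x|.
  by rewrite fM ?normr0 ?mulr_ge0// (le_lt_trans (ler_norm _) Mx).
by rewrite mem_set ?mulr1//; exact: rv_norm_le_cube.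
Qed.

Lemma lebesgue_rv_cube_lty (M : R) : 0 <= M -> (mu (rv_cube (- M) M) < +oo)%E.
Proof. by move=> M0; rewrite lebesgue_rv_cube ?ltry// ge0_cp. Qed.

Lemma ccs_integ f : ccs f -> integ mu f.
Proof.
move=> fc; have [C [M [C0 M0 fM]]] := ccs_dominated fc.
apply: (le_integ (ccs_measurable fc) _ fM); apply: integZ; apply: integ_indic.
  exact: measurable_rv_cube.
exact: lebesgue_rv_cube_lty.
Qed.

Lemma ccsM f g : continuous f -> ccs g -> ccs (fun x => f x * g x).
Proof.
move=> cf [cg [M gM]]; split; first by move=> x; exact: (cvgM (cf x) (cg x)).
by exists M => x /gM ->; rewrite mulr0.
Qed.

Lemma ccsD f g : ccs f -> ccs g -> ccs (fun x => f x + g x).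
Proof.
move=> [cf [M fM]] [cg [M' gM]]; split; first by move=> x; exact: (cvgD (cf x) (cg x)).
exists (Num.max M M') => x; rewrite gt_max => /andP[/fM -> /gM ->].
by rewrite addr0.
Qed.

Lemma ccs_L2 f : ccs f -> L2 mu f.
Proof.
move=> fc; split; first exact: ccs_measurable.
under eq_fun do rewrite expr2.
by apply: ccs_integ; apply: ccsM => //; exact: fc.1.
Qed.

Lemma ccs_affine (c r : R) a f : 0 < r -> ccs f -> ccs (fun x => c * f (r *: x + a)).
Proof.
move=> r0 [cf [M fM]]; split.
  move=> x; have cfa := continuous_comp (@affine_continuous _ _ r a x) (cf _).
  exact: (cvgM (cvg_cst c) cfa).
exists ((M + `|a|) / r) => x; rewrite ltr_pdivrMr// => xM; rewrite fM ?mulr0//.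
have := ler_normB (r *: x + a) a; rewrite addrK normrZ gtr0_norm//.
by rewrite mulrC; lra.
Qed.

Lemma test_affine (c r : R) a f : 0 < r -> test_function f ->
  test_function (fun x => c * f (r *: x + a)).
Proof.
move=> r0 tf; apply/test_functionP; split.
  by apply: smooth_affine; exact: test_smooth.
by have [] := ccs_affine c a r0 (test_ccs tf).
Qed.

Lemma testD f g : test_function f -> test_function g ->
  test_function (fun x => f x + g x).
Proof.
move=> tf tg; apply/test_functionP; split.
  exact: smoothD (test_smooth tf) (test_smooth tg).
by have [] := ccsD (test_ccs tf) (test_ccs tg).
Qed.

Lemma testZ (c : R) f : test_function f -> test_function (fun x => c * f x).
Proof.
move=> tf; have := @test_affine c 1 0 f ltr01 tf.
by under eq_fun do rewrite scale1r addr0.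
Qed.

Lemma test_partial f i : test_function f -> test_function (partial i f).
Proof.
move=> /test_functionP[sf [M fM]]; apply/test_functionP; split.
  exact: smooth_partial.
exists M => x Mx; rewrite /partial.
rewrite (@near_eq_derive _ _ _ f (cst 0)) ?derive_cst//.
apply: (@filterS _ (nbhs x) _ [set y : 'rV[R]_N | M < `|y|]) => [y /fM //|].
apply/nbhs_ballP; exists (`|x| - M); first by rewrite /= subr_gt0.
by move=> y; rewrite mx_norm_ball /ball_/=; have := lerB_dist x y; lra.
Qed.

Lemma test_foldr f s : test_function f -> test_function (foldr partial f s).
Proof. by move=> tf; elim: s => [|i s IH]; [exact: tf|exact: test_partial]. Qed.

End test_functions.

(** * Translations and integration by parts *)

Section affine_integrals.
Context {R : realType} {N : nat}.
Local Notation mu := (@lebesgue_rv R N).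
Variables (r : R) (a : 'rV[R]_N).
Hypothesis r0 : 0 < r.
Implicit Types f g : 'rV[R]_N -> R.

Lemma measurable_affine f : measurable_fun setT f ->
  measurable_fun setT (fun x : 'rV[R]_N => f (r *: x + a)).
Proof. by move=> mf; exact: (measurableT_comp mf (measurable_rv_affine r a)). Qed.

Let ge0_affine (F : 'rV[R]_N -> \bar R) : measurable_fun setT F ->
  (forall x, 0 <= F x)%E ->
  (\int[mu]_x F (r *: x + a)%R = ((r ^+ N)^-1)%:E * \int[mu]_x F x)%E.
Proof.
move=> mF F0; rewrite (ge0_integral_affine r0 a mF F0) muleA -EFinM mulVf ?mul1e//.
by rewrite gt_eqF// exprn_gt0.
Qed.

Lemma integ_affine f : integ mu f -> integ mu (fun x => f (r *: x + a)).
Proof.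
move=> fi; have /integP[mf fy] := fi; apply/integP; split.
  exact: measurable_affine.
rewrite (@ge0_affine (fun x => (`|f x|)%:E))//; last first.
  by apply/measurable_EFinP; exact: measurableT_comp.
by rewrite lte_mul_pinfty// lee_fin invr_ge0 exprn_ge0// ltW.
Qed.

Lemma Rintegral_affine f : integ mu f ->
  \int[mu]_x f (r *: x + a) = (r ^+ N)^-1 * \int[mu]_x f x.
Proof.
move=> fi; have fai := integ_affine fi.
apply: EFin_inj; rewrite EFin_Rintegral// EFinM EFin_Rintegral//.
have mf : measurable_fun setT (fun x => (f x)%:E).
  by apply/measurable_EFinP; exact: integ_measurable fi.
rewrite integralE [in RHS]integralE muleBr//; last first.
  by apply: fin_num_adde_defr; exact: (integrable_pos_fin_num measurableT fi).
congr (_ - _)%E.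
  rewrite -[RHS](@ge0_affine _ (measurable_funepos mf))//.
  by apply: eq_integral => x _; rewrite !funeposE.
rewrite -[RHS](@ge0_affine _ (measurable_funeneg mf))//.
by apply: eq_integral => x _; rewrite !funenegE.
Qed.

Lemma L2_affine f : L2 mu f -> L2 mu (fun x => f (r *: x + a)).
Proof.
by move=> [mf f2]; split; [exact: measurable_affine|exact: (integ_affine f2)].
Qed.

Lemma sqn_affine f : L2 mu f ->
  sqn mu (fun x => f (r *: x + a)) = (r ^+ N)^-1 * sqn mu f.
Proof. by move=> [mf f2]; exact: (Rintegral_affine f2). Qed.

End affine_integrals.

Section translations.
Context {R : realType} {N : nat}.
Local Notation mu := (@lebesgue_rv R N).
Implicit Types (f g : 'rV[R]_N -> R) (a : 'rV[R]_N).

Lemma L2_shift a f : L2 mu f -> L2 mu (fun x => f (x + a)).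
Proof.
by move=> /(@L2_affine _ _ 1 a ltr01); under eq_fun do rewrite scale1r.
Qed.

Lemma sqn_shift a f : L2 mu f -> sqn mu (fun x => f (x + a)) = sqn mu f.
Proof.
move=> /(@sqn_affine _ _ 1 a ltr01); rewrite expr1n invr1 mul1r => <-.
by apply: eq_Rintegral => x _; rewrite scale1r.
Qed.

Lemma integ_shift a f : integ mu f -> integ mu (fun x => f (x + a)).
Proof.
by move=> /(@integ_affine _ _ 1 a ltr01); under eq_fun do rewrite scale1r.
Qed.

Lemma Rintegral_shift a f : integ mu f ->
  \int[mu]_x f (x + a) = \int[mu]_x f x.
Proof.
move=> /(@Rintegral_affine _ _ 1 a ltr01); rewrite expr1n invr1 mul1r => <-.
by apply: eq_Rintegral => x _; rewrite scale1r.
Qed.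

Lemma test_shift a f : test_function f -> test_function (fun x => f (x + a)).
Proof.
move=> /(@test_affine _ _ 1 1 a f ltr01).
by under eq_fun do rewrite mul1r scale1r.
Qed.

Lemma partial_shift a f i : smooth f ->
  partial i (fun x => f (x + a)) = fun x => partial i f (x + a).
Proof.
move=> sf; rewrite (_ : (fun x => f (x + a)) = fun x => 1 * f (1 *: x + a)).
  by rewrite (partial_affine _ _ _ _ sf); apply/funext => x; rewrite !mul1r scale1r.
by apply/funext => x; rewrite mul1r scale1r.
Qed.

Definition dquot (i : 'I_N) f (s : R) x := s^-1 * (f (x + s *: ei i) - f x).

Lemma dquot_cvg i f x : smooth f ->
  dquot i f n.+1%:R^-1 x @[n --> \oo] --> partial i f x.
Proof.
move=> sf; have fd := smooth_derivable f i x sf.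
have h : h^-1 *: (f (h *: ei i + x) - f x) @[h --> 0^'] --> partial i f x by exact: fd.
have un : (forall n : nat, n.+1%:R^-1 != 0 :> R) /\ (n.+1%:R^-1 : R) @[n --> \oo] --> (0 : R).
  by split=> [n|]; [rewrite invr_neq0|exact: cvg_harmonic].
move/cvgr_dnbhsP : h => /(_ _ un); rewrite /dquot.
by under eq_fun do rewrite [_ *: _ + x]addrC.
Qed.

(** Uniform domination of the difference quotients, for passing to the limit
    under the integral. *)
Lemma dquot_dominated i f : test_function f -> exists C M : R,
  [/\ 0 <= C, 0 <= M & forall s x, `|s| <= 1 -> s != 0 ->
    `|dquot i f s x| <= C * \1_(rv_cube (- M) M) x].
Proof.
move=> tf; have /test_functionP[sfi [M fM]] := test_partial i tf.
have [C C0 fC] := ccs_bounded (test_ccs (test_partial i tf)).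
exists C, (`|M| + 1); split => //.
move=> s x s1 s0.
have [c cs fc] := MVT_partial (fun y => smooth_derivable f i y (test_smooth tf)) x s.
have -> : dquot i f s x = partial i f (c *: ei i + x).
  by rewrite /dquot (addrC x) fc mulrA mulVf// mul1r.
rewrite indicE; have [xM|Mx] := leP `|x| (`|M| + 1).
  by rewrite mem_set ?mulr1//; exact: rv_norm_le_cube.
rewrite fM ?normr0 ?mulr_ge0//.
have h1 : `|x| <= `|c *: ei i + x| + `|c *: ei i : 'rV[R]_N|.
  by rewrite -{1}[x](addrK (c *: ei i)) (addrC x) ler_normB.
have h2 := norm_scale_ei c i.
have h3 := ler_norm M.
lra.
Qed.

Lemma integ_cube (C M : R) : 0 <= M ->
  integ mu (fun x => C * \1_(rv_cube (- M) M) x).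
Proof.
move=> M0; apply: integZ; apply: integ_indic; first exact: measurable_rv_cube.
exact: lebesgue_rv_cube_lty.
Qed.

Lemma dquot_ccs i f s : test_function f -> ccs (dquot i f s).
Proof.
move=> tf; have tf1 := test_shift (s *: ei i) tf.
have tf2 := testZ s^-1 (testD tf1 (testZ (-1) tf)).
have := test_ccs tf2.
by congr ccs; apply/funext => x; rewrite /dquot mulN1r.
Qed.

Lemma dominated_Rintegral (F : nat -> 'rV[R]_N -> R) f g :
  (forall n, measurable_fun setT (F n)) -> measurable_fun setT f ->
  (forall x, F n x @[n --> \oo] --> f x) -> integ mu g ->
  (forall n x, `|F n x| <= g x) ->
  \int[mu]_x F n x @[n --> \oo] --> \int[mu]_x f x.
Proof.
move=> mF mf Ff gi Fg.
have [|||||] := @dominated_convergence _ _ _ mu _ measurableT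
  (fun n x => (F n x)%:E) (fun x => (f x)%:E) (fun x => (g x)%:E).
- by move=> n; exact/measurable_EFinP.
- exact/measurable_EFinP.
- by apply: aeW => x _; apply: cvg_EFin; [exact: nearW|exact: Ff].
- exact: gi.
- by apply: aeW => x n _; rewrite /= lee_fin.
move=> fi _ cv; apply: fine_cvg; rewrite fineK; first exact: cv.
exact: integrable_fin_num.
Qed.

(** The integral of a difference quotient vanishes by translation invariance. *)
Lemma Rintegral_partial0 i f : test_function f -> \int[mu]_x partial i f x = 0.
Proof.
move=> tf; have [C [M [C0 M0 fCM]]] := dquot_dominated i tf.
have n1 (n : nat) : `|n.+1%:R^-1 : R| <= 1 by rewrite ger0_norm// invf_le1// ler1n.
have : \int[mu]_x dquot i f n.+1%:R^-1 x @[n --> \oo] --> \int[mu]_x partial i f x.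
  apply: (@dominated_Rintegral _ _ (fun x => C * \1_(rv_cube (- M) M) x)).
  - by move=> n; apply: ccs_measurable; exact: dquot_ccs.
  - apply: ccs_measurable; apply: test_ccs; exact: test_partial.
  - by move=> x; apply: dquot_cvg; exact: test_smooth.
  - exact: integ_cube.
  - by move=> n x; apply: fCM; rewrite ?invr_neq0.
rewrite (_ : (fun n : nat => _) = fun=> 0).
  by move=> h; apply/esym; exact: (cvg_unique _ (@cvg_cst _ (0 : R) _ _ _) h).
apply/funext => n; rewrite /dquot.
have fi := ccs_integ (test_ccs tf).
rewrite RintegralZl//; last by apply: integB => //; exact: integ_shift.
rewrite RintegralB//; last exact: integ_shift.
by rewrite Rintegral_shift// subrr mulr0.
Qed.

Lemma partialM i f g : smooth f -> smooth g ->
  partial i (fun x => f x * g x) = fun x => partial i f x * g x + f x * partial i g x.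
Proof.
move=> sf sg; apply/funext => x; apply: partialE.
exact: (is_derive_mul (smooth_is_derive i x sf) (smooth_is_derive i x sg)).
Qed.

Lemma testM f g : smooth f -> test_function g -> test_function (fun x => f x * g x).
Proof.
move=> sf tg; apply/test_functionP; split; first exact: smoothM sf (test_smooth tg).
have cf : continuous f by exact: smooth_continuous.
by have [] := ccsM cf (test_ccs tg).
Qed.

Lemma integration_by_parts i f g : smooth f -> test_function g ->
  \int[mu]_x (partial i f x * g x) = - \int[mu]_x (f x * partial i g x).
Proof.
move=> sf tg.
have i1 := ccs_integ (test_ccs (testM (smooth_partial i sf) tg)).
have i2 := ccs_integ (test_ccs (testM sf (test_partial i tg))).
have := Rintegral_partial0 i (testM sf tg).
rewrite (partialM i sf (test_smooth tg)) RintegralD// => /eqP.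
by rewrite addr_eq0 => /eqP.
Qed.

Lemma sqr_sum_le (I : Type) (s : seq I) (F : I -> R) :
  (\sum_(i <- s) F i) ^+ 2 <= (size s)%:R * \sum_(i <- s) F i ^+ 2.
Proof.
elim: s => [|i s IH]; first by rewrite !big_nil expr0n mulr0.
rewrite !big_cons /=; set A := \sum_(_ <- _) _ in IH *; set S := \sum_(_ <- _) _ in IH *.
rewrite -natr1; case: (size s) IH => [|n] IH.
  have A0 : A = 0 by apply/eqP; rewrite -sqrf_eq0 eq_le sqr_ge0 andbT; move: IH; rewrite mul0r.
  by rewrite A0 addr0 add0r mul1r lerDl; apply: sumr_ge0 => j _; exact: sqr_ge0.
have n0 : 0 < n.+1%:R :> R by rewrite ltr0n.
rewrite -(ler_pM2l n0); move: n.+1%:R (F i) n0 IH => p b p0 IH.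
have := sqr_ge0 (A - p * b); nra.
Qed.

Lemma sqn_sum_le (I : Type) (s : seq I) (F : I -> 'rV[R]_N -> R) :
  (forall i, L2 mu (F i)) ->
  sqn mu (fun x => \sum_(i <- s) F i x) <= (size s)%:R * \sum_(i <- s) sqn mu (F i).
Proof.
move=> FL; rewrite /sqn -Rintegral_sum; last by move=> i; exact: (FL i).2.
rewrite -RintegralZl//; last by apply: integ_sum => i; exact: (FL i).2.
apply: le_Rintegral => //.
- exact: (L2_sum s FL).2.
- by apply: integZ; apply: integ_sum => i; exact: (FL i).2.
- by move=> x _; exact: sqr_sum_le.
Qed.

(** Cutting the translation into [n] equal steps bounds the norm by that of a
    difference quotient of step [s / n], which converges to the partial derivative. *)
Lemma sqn_shift_ei i f s : test_function f ->
  sqn mu (fun x => f (x + s *: ei i) - f x) <= s ^+ 2 * sqn mu (partial i f).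
Proof.
move=> tf; have [->|s0] := eqVneq s 0.
  rewrite expr0n mul0r /sqn; under eq_Rintegral do rewrite scale0r addr0 subrr expr0n/=.
  by rewrite Rintegral_cst// mul0r.
have [C [M [C0 M0 fCM]]] := dquot_dominated i tf.
have fL : L2 mu f by apply: ccs_L2; exact: test_ccs.
pose d (n : nat) := s / n.+1%:R.
have d0 n : d n != 0 by rewrite mulf_neq0// invr_neq0.
have dL n : L2 mu (dquot i f (d n)) by apply: ccs_L2; exact: dquot_ccs.
have cvd : sqn mu (dquot i f (d n)) @[n --> \oo] --> sqn mu (partial i f).
  have : exists n0 : nat, forall n, (n0 <= n)%N -> `|d n| <= 1.
    exists (Num.truncn `|s|) => n n0; rewrite normrM normfV ler_pdivrMr ?mul1r ?normr_nat//.
    by apply: (le_trans (ltW (truncnS_gt _))); rewrite ler_nat.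
  move=> [n0 dn1]; rewrite -(cvg_shiftn n0).
  apply: (@dominated_Rintegral _ _ (fun x => C ^+ 2 * \1_(rv_cube (- M) M) x)).
  - by move=> n; apply: measurable_funX; exact: (dL _).1.
  - by apply: measurable_funX; apply: ccs_measurable; apply: test_ccs; exact: test_partial.
  - move=> x; rewrite expr2; under eq_fun do rewrite expr2.
    suff h : dquot i f (d (n + n0)%N) x @[n --> \oo] --> partial i f x by apply: cvgM.
    have fd := smooth_derivable f i x (test_smooth tf).
    have h : h^-1 *: (f (h *: ei i + x) - f x) @[h --> 0^'] --> partial i f x by exact: fd.
    have un : (forall n : nat, d (n + n0)%N != 0) /\ d (n + n0)%N @[n --> \oo] --> (0 : R).
      split => //; rewrite (cvg_shiftn n0).
      have h0 : d n @[n --> \oo] --> s * 0 by apply: cvgM; [exact: cvg_cst|exact: cvg_harmonic].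
      by rewrite mulr0 in h0.
    move/cvgr_dnbhsP : h => /(_ _ un); rewrite /dquot.
    by under eq_fun do rewrite [_ *: _ + x]addrC.
  - exact: integ_cube.
  - move=> n x; rewrite normrX.
    have h := fCM _ x (dn1 _ (leq_addl n n0)) (d0 _).
    apply: (le_trans (lerXn2r 2 _ _ h)); rewrite ?nnegrE ?mulr_ge0//.
    by rewrite exprMn indicE; case: (_ \in _); rewrite ?expr1n ?expr0n.
have bound n : sqn mu (fun x => f (x + s *: ei i) - f x) <= s ^+ 2 * sqn mu (dquot i f (d n)).
  pose F (k : nat) x := d n * dquot i f (d n) (x + (k%:R * d n) *: ei i).
  have FL k : L2 mu (F k) by apply: L2Z; exact: L2_shift.
  rewrite (_ : (fun x => _) = fun x => \sum_(k <- iota 0 n.+1) F k x); last first.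
    apply/funext => x.
    rewrite (_ : \sum_(k <- _) _ = \sum_(0 <= k < n.+1)
       (f (x + (k.+1%:R * d n) *: ei i) - f (x + (k%:R * d n) *: ei i))).
      rewrite (telescope_sumr (fun k => f (x + (k%:R * d n) *: ei i)))//.
      by rewrite mul0r scale0r addr0 /d mulrC divfK.
    rewrite /index_iota subn0; apply: eq_bigr => k _; rewrite /F /dquot mulrA divff// mul1r.
    by rewrite -addrA -scalerDl -natr1 mulrDl mul1r.
  apply: (le_trans (sqn_sum_le _ FL)); rewrite size_iota.
  rewrite (eq_bigr (fun=> d n ^+ 2 * sqn mu (dquot i f (d n)))); last first.
    by move=> k _; rewrite sqnZ ?sqn_shift//; exact: L2_shift.
  rewrite big_const_seq count_predT size_iota iter_addr addr0.
  rewrite -mulr_natl le_eqVlt; apply/orP; left; apply/eqP.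
  move: (sqn mu (dquot i f (d n))) => X; rewrite /d; field.
  by rewrite nat1r pnatr_eq0.
have cv2 : s ^+ 2 * sqn mu (dquot i f (d n)) @[n --> \oo] --> s ^+ 2 * sqn mu (partial i f).
  by apply: cvgM => //; exact: cvg_cst.
rewrite -(cvg_lim _ cv2)//; apply: limr_ge; first by apply/cvg_ex; eexists; exact: cv2.
exact: nearW.
Qed.

(** The one-dimensional estimate is applied coordinate by coordinate along the
    path from [x] to [x + h]. *)
Lemma sqn_shift_le f (h : 'rV[R]_N) (t : R) : (forall i, `|h 0 i| <= t) ->
  test_function f ->
  sqn mu (fun x => f (x + h) - f x) <=
  N%:R * t ^+ 2 * \sum_(i < N) sqn mu (partial i f).
Proof.
move=> ht tf.
(* the point of the path after the first [k] coordinates *)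
pose p (k : nat) : 'rV[R]_N := \row_j (if (j < k)%N then h 0 j else 0).
pose F (k : 'I_N) x := f (x + p k + h 0 k *: ei k) - f (x + p k).
have tF k : test_function (F k).
  have := testD (test_shift (p k + h 0 k *: ei k) tf) (testZ (-1) (test_shift (p k) tf)).
  by congr test_function; apply/funext => x; rewrite /F mulN1r addrA.
have FL k : L2 mu (F k) by apply: ccs_L2; exact: test_ccs.
rewrite (_ : (fun x => _) = fun x => \sum_(k <- index_enum 'I_N) F k x); last first.
  apply/funext => x.
  have -> : x + h = x + p N.
    by congr (x + _); apply/rowP => j; rewrite mxE ltn_ord.
  rewrite -[in LHS](addr0 x) (_ : x + 0 + p N = x + p N) ?addr0//.
  have {2}-> : x = x + p 0%N.
    by rewrite (_ : p 0%N = 0) ?addr0//; apply/rowP => j; rewrite !mxE.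
  rewrite -(telescope_sumr (fun k => f (x + p k)))// big_mkord.
  apply: eq_bigr => k _; rewrite /F -addrA; congr (f (x + _) - _).
  apply/rowP => j; rewrite !mxE eqxx/= ltnS leq_eqVlt (inj_eq val_inj).
  by case: eqVneq => [->|]; rewrite ?ltnn ?mulr1 ?add0r ?mulr0 ?addr0.
apply: (le_trans (sqn_sum_le _ FL)).
have -> : size (index_enum 'I_N) = N by rewrite -[RHS]size_enum_ord enumT.
rewrite -mulrA ler_wpM2l// mulr_sumr; apply: ler_sum => k _.
rewrite [leLHS](_ : _ = sqn mu (fun x => f (x + h 0 k *: ei k) - f x)); last first.
  rewrite -(sqn_shift (p k) (f := fun x => f (x + h 0 k *: ei k) - f x))//.
  apply: L2B; last by apply: ccs_L2; exact: test_ccs.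
  by apply: L2_shift; apply: ccs_L2; exact: test_ccs.
apply: (le_trans (sqn_shift_ei k (h 0 k) tf)); rewrite ler_wpM2r ?sqn_ge0//.
by rewrite -(real_normK (num_real (h 0 k))) lerXn2r// nnegrE// (le_trans _ (ht k)).
Qed.

End translations.

(** * Bump functions and the fundamental lemma of the calculus of variations *)

Section exponential_cutoff.
Context {R : realType}.

(** The function [t^-n exp(-1/t)], extended by zero to the left of the origin;
    the factor [t^-n] makes the family stable under derivation. *)
Definition cutoff (n : nat) (t : R) : R :=
  if 0 < t then t^-1 ^+ n * expR (- t^-1) else 0.

Lemma cutoff_le n (t : R) : `|cutoff n t| <= (n.+1)`!%:R * `|t|.
Proof.
rewrite /cutoff; case: ifPn => t0; last by rewrite normr0 mulr_ge0.
have ti0 : 0 < t^-1 by rewrite invr_gt0.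
rewrite !ger0_norm ?(ltW t0)// ?mulr_ge0 ?exprn_ge0 ?expR_ge0 ?(ltW ti0)//.
have f0 : 0 < (n.+1)`!%:R :> R by rewrite ltr0n fact_gt0.
have := expR_ge1Dxn n (ltW ti0) => h.
have {}h : t^-1 ^+ n.+1 / (n.+1)`!%:R <= expR t^-1 by apply: le_trans h; rewrite lerDr.
rewrite expRN ler_pdivrMr ?expR_gt0//.
rewrite -(ler_pM2l ti0) -exprS -mulrA mulrCA (mulrA t^-1) mulVf ?gt_eqF// mul1r.
by rewrite mulrC -ler_pdivrMr.
Qed.

(** At the origin the derivative vanishes because the quotient is [cutoff n.+1],
    which tends to zero by [cutoff_le]. *)
Lemma is_derive_cutoff n (t : R) :
  is_derive t 1 (cutoff n) (cutoff n.+2 t - n%:R * cutoff n.+1 t).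
Proof.
have [t0|t0|<-] := ltgtP 0 t.
- pose f (s : R) := s^-1 ^+ n * expR (- s^-1).
  have nf : \near t, f t = cutoff n t.
    by near=> s; rewrite /cutoff/f ifT//; near: s; exact: lt_nbhsr.
  apply: (near_eq_is_derive nf).
  have dV : is_derive t 1 (fun s : R => s^-1) (- t ^- 2).
    apply: is_derive_eq; first by apply: is_deriveV; rewrite gt_eqF.
    by rewrite [_ *: _]mulr1.
  have dX : is_derive t 1 (fun s : R => s^-1 ^+ n) (- n%:R * t^-1 ^+ n.+1).
    rewrite (_ : (fun s : R => s^-1 ^+ n) = (fun s : R => s ^+ n) \o (fun s => s^-1)); last by [].
    have dn : is_derive (t^-1) 1 (fun s : R => s ^+ n) (n%:R * t^-1 ^+ n.-1).
      split; first exact: exprn_derivable.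
      by rewrite exp_derive [_ *: _]mulr1.
    have hc := is_derive1_comp dn dV.
    apply: is_derive_eq hc _.
    rewrite -exprVn; case: (n) => [|k]; first by rewrite !mul0r oppr0 mul0r.
    by rewrite /= !exprS; ring.
  have dE : is_derive t 1 (fun s : R => expR (- s^-1)) (expR (- t^-1) * t^-1 ^+ 2).
    have dN : is_derive t 1 (fun s : R => - s^-1) (t^-1 ^+ 2).
      by apply: is_derive_eq; rewrite opprK exprVn.
    exact: (is_derive1_comp (is_derive_expR _) dN).
  have hc := is_deriveM dX dE; apply: is_derive_eq hc _.
  rewrite /cutoff !ifT// !exprS /GRing.scale/=; ring.
- have nf : \near t, cst 0 t = cutoff n t.
    near=> s; rewrite /cutoff ifF//; apply/negbTE; rewrite -leNgt ltW//.
    by near: s; exact: lt_nbhsl.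
  apply: (near_eq_is_derive nf).
  by rewrite /cutoff ltNge (ltW t0)/= mulr0 subr0; exact: is_derive_cst.
- have -> : cutoff n.+2 0 - n%:R * cutoff n.+1 0 = 0 by rewrite /cutoff ltxx mulr0 subr0.
  have h : h^-1 *: ((cutoff n \o shift 0) (h *: (1 : R)) - cutoff n 0) @[h --> 0^'] --> (0 : R).
    rewrite (_ : (fun _ => _) = cutoff n.+1); last first.
      apply/funext => h /=; rewrite addr0 [_%:A]mulr1 /cutoff ltxx subr0.
      by case: ifP => _; rewrite ?scaler0// /GRing.scale/= mulrA -exprS.
    apply/cvgrPdist_lt => e e0.
    have f0 : 0 < (n.+2)`!%:R :> R by rewrite ltr0n fact_gt0.
    near=> s; rewrite sub0r normrN; apply: (le_lt_trans (cutoff_le _ _)).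
    rewrite mulrC -ltr_pdivlMr//; near: s; apply: dnbhs0_lt.
    by rewrite divr_gt0.
  split; first by apply/cvg_ex; exists 0.
  by apply: cvg_lim.
Unshelve. all: by end_near. Qed.

Lemma cutoff0_bounded (t : R) : 0 <= cutoff 0 t <= 1.
Proof.
rewrite /cutoff; case: ifPn => t0; last by rewrite lexx ler01.
by rewrite expr0 mul1r expR_ge0 expR_le1 oppr_le0 invr_ge0 ltW.
Qed.

Lemma cutoff0_cvg (t : R) :
  cutoff 0 (n.+1%:R * t) @[n --> \oo] --> ((0 < t)%R%:R : R).
Proof.
rewrite /cutoff; have [t0|t0] := ltP 0 t; last first.
  under eq_fun do rewrite pmulr_rgt0// ltNge t0/=.
  exact: cvg_cst.
under eq_fun do rewrite pmulr_rgt0// t0 expr0 mul1r invfM mulrC -mulrN.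
have h : t^-1 * - n.+1%:R^-1 @[n --> \oo] --> t^-1 * - 0.
  by apply: cvgM; [exact: cvg_cst|apply: cvgN; exact: cvg_harmonic].
rewrite oppr0 mulr0 in h.
have := continuous_cvg _ (@continuous_expR R 0) h; rewrite expR0; exact.
Qed.

End exponential_cutoff.

Section bump.
Context {R : realType} {N : nat}.
Implicit Types (i : 'I_N) (x : 'rV[R]_N).

Definition coord_cutoff (n : nat) (c d : R) (i : 'I_N) (x : 'rV[R]_N) : R :=
  cutoff n (c * x 0 i + d).

Definition is_coord_cutoff f := exists n c d i, f = coord_cutoff n c d i.

Lemma is_derive_coord_cutoff n c d i j x :
  is_derive x (ei j) (coord_cutoff n c d i)
   (c * (i == j)%:R * (coord_cutoff n.+2 c d i x - n%:R * coord_cutoff n.+1 c d i x)).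
Proof.
apply/is_derive_line0.
rewrite (_ : (fun h : R => _) = cutoff n \o
   (fun h => (c * (i == j)%:R) * h + (c * x 0 i + d))); last first.
  apply/funext => h; rewrite /coord_cutoff/= !mxE eqxx/=; congr cutoff; ring.
rewrite [c * _ * _]mulrC; apply: is_derive1_comp.
  by rewrite mulr0 add0r; exact: is_derive_cutoff.
apply: is_derive_eq.
by rewrite addr0 [_ *: _]mulr1.
Qed.

Lemma coord_continuous_rv i : continuous (fun x : 'rV[R]_N => x 0 i).
Proof. exact: (@coord_continuous R 1 N 0 i). Qed.

Lemma is_coord_cutoff_closed f : is_coord_cutoff f ->
  [/\ continuous f, forall i x, derivable f x (ei i) &
    forall i, alg_closure is_coord_cutoff (partial i f)].
Proof.
move=> [n [c [d [i ->]]]]; split.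
- move=> x; apply: (@continuous_comp _ _ _ (fun x : 'rV[R]_N => c * x 0 i + d) (cutoff n)).
    apply: (@continuousD _ _ _ (fun x : 'rV[R]_N => c * x 0 i) (fun=> d) x).
      have h := cvgM (cvg_cst c) (@coord_continuous_rv i x); exact: h.
    exact: cst_continuous.
  apply/differentiable_continuous/derivable1_diffP.
  exact: (@ex_derive _ _ _ _ _ _ _ (is_derive_cutoff n _)).
- by move=> j x; exact: (@ex_derive _ _ _ _ _ _ _ (is_derive_coord_cutoff n c d i j x)).
- move=> j; rewrite (_ : partial j _ = fun x => (c * (i == j)%:R) *
      (coord_cutoff n.+2 c d i x + (- n%:R) * coord_cutoff n.+1 c d i x)).
    apply: alg_mul; first exact: alg_cst.
    apply: alg_add; first by apply: alg_base; exists n.+2, c, d, i.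
    apply: alg_mul; first exact: alg_cst.
    by apply: alg_base; exists n.+1, c, d, i.
  apply/funext => x; rewrite (partialE (is_derive_coord_cutoff n c d i j x)).
  by rewrite mulNr.
Qed.

Lemma smooth_coord_cutoff n c d i : smooth (coord_cutoff n c d i).
Proof.
apply: (smooth_alg_closure is_coord_cutoff_closed); apply: alg_base.
by exists n, c, d, i.
Qed.

Lemma smooth_prod (I : Type) (s : seq I) (F : I -> 'rV[R]_N -> R) :
  (forall j, smooth (F j)) -> smooth (fun x => \prod_(j <- s) F j x).
Proof.
move=> sF; elim: s => [|j s IH].
  rewrite (_ : (fun x => _) = fun=> 1); first exact: smooth_cst.
  by apply/funext => x; rewrite big_nil.
rewrite (_ : (fun x => _) = fun x => F j x * \prod_(k <- s) F k x).
  exact: (smoothM (sF j) IH).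
by apply/funext => x; rewrite big_cons.
Qed.

Definition open_box (a b : 'rV[R]_N) : set 'rV[R]_N :=
  [set x | forall i, `]a 0 i, b 0 i[%classic (x 0 i)].

(** For large [k], a smooth approximation of the indicator function of the box
    between [a] and [b]. *)
Definition bump (k : R) (a b : 'rV[R]_N) (x : 'rV[R]_N) : R :=
  \prod_(i <- index_enum 'I_N) (coord_cutoff 0 k (- (k * a 0 i)) i x *
     coord_cutoff 0 (- k) (k * b 0 i) i x).

Lemma bumpE k a b x : bump k a b x =
  \prod_(i < N) (cutoff 0 (k * (x 0 i - a 0 i)) * cutoff 0 (k * (b 0 i - x 0 i))).
Proof.
apply: eq_bigr => i _; rewrite /coord_cutoff -mulrBr; congr (cutoff _ _ * cutoff _ _).
by rewrite mulrBr addrC mulNr.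
Qed.

Lemma bump_support k a b x : 0 < k -> `|a| + `|b| < `|x| -> bump k a b x = 0.
Proof.
move=> k0 ax.
have x0 : `|x| != 0 by rewrite gt_eqF// (le_lt_trans _ ax).
have [[j i] /= xi] := mx_norm_neq0 x0; rewrite (ord1 j) in xi.
have {}ax : `|a| + `|b| < `|x 0 i| by rewrite -xi.
rewrite bumpE (bigD1 i)//=.
have ai := coord_le_norm a i; have bi := coord_le_norm b i.
have [xp|xp] := leP 0 (x 0 i).
- rewrite [cutoff 0 (k * (b 0 i - x 0 i))]/cutoff pmulr_rgt0// ltNge.
  suff -> : b 0 i - x 0 i <= 0 by rewrite mulr0 mul0r.
  rewrite subr_le0; rewrite ger0_norm// in ax.
  by have := ler_norm (b 0 i); have := normr_ge0 a; lra.
- rewrite [cutoff 0 (k * (x 0 i - a 0 i))]/cutoff pmulr_rgt0// ltNge.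
  suff -> : x 0 i - a 0 i <= 0 by rewrite !mul0r.
  rewrite subr_le0; rewrite ltr0_norm// in ax.
  by have := ler_norm (- a 0 i); rewrite normrN; have := normr_ge0 b; lra.
Qed.

Lemma test_bump k a b : 0 < k -> test_function (bump k a b).
Proof.
move=> k0; apply/test_functionP; split.
  by apply: smooth_prod => i; apply: smoothM; exact: smooth_coord_cutoff.
by exists (`|a| + `|b|) => x; exact: bump_support.
Qed.

Lemma bump_bounded k a b x : 0 <= bump k a b x <= 1.
Proof.
rewrite bumpE; elim/big_ind : _ => [|u v /andP[u0 u1] /andP[v0 v1]|i _].
- by rewrite ler01 lexx.
- by rewrite mulr_ge0//= mulr_ile1.
- have /andP[? ?] := cutoff0_bounded (k * (x 0 i - a 0 i)).
  have /andP[? ?] := cutoff0_bounded (k * (b 0 i - x 0 i)).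
  by rewrite mulr_ge0//= mulr_ile1.
Qed.

Let cvg_prod (I : Type) (s : seq I) (F : nat -> I -> R) (l : I -> R) :
  (forall j, F n j @[n --> \oo] --> l j) ->
  \prod_(i <- s) F n i @[n --> \oo] --> \prod_(i <- s) l i.
Proof.
move=> Fl; elim: s => [|i s IH].
  rewrite (_ : (fun n => \prod_(i <- [::]) F n i) = fun=> 1); last first.
    by apply/funext => n; rewrite big_nil.
  by rewrite big_nil; exact: cvg_cst.
rewrite (_ : (fun n => \prod_(j <- i :: s) F n j) =
    fun n => F n i * \prod_(j <- s) F n j); last first.
  by apply/funext => n; rewrite big_cons.
by rewrite big_cons; exact: (cvgM (Fl i) IH).
Qed.

Lemma bump_cvg a b x :
  bump n.+1%:R a b x @[n --> \oo] --> (\1_(open_box a b) x : R).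
Proof.
have -> : (\1_(open_box a b) x : R) = \prod_(i < N)
    ((0 < x 0 i - a 0 i)%R%:R * (0 < b 0 i - x 0 i)%R%:R).
  rewrite indicE; have [xab|xab] := boolP (x \in open_box a b).
    apply/esym/big1 => i _; move: xab; rewrite inE => /(_ i)/=.
    by rewrite in_itv/= !subr_gt0 => /andP[-> ->]; rewrite mulr1.
  have : exists i, ~~ ((a 0 i < x 0 i) && (x 0 i < b 0 i)).
    apply: contrapT => h; move/negP: xab; apply; rewrite inE => i /=; rewrite in_itv/=.
    by apply: contrapT => /negP hi; apply: h; exists i.
  move=> [i hi]; apply/esym/eqP; rewrite (bigD1 i)//= !subr_gt0.
  by rewrite mulf_eq0 mulf_eq0 !pnatr_eq0 !eqb0 -negb_and hi.
under eq_fun do rewrite bumpE.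
by apply: cvg_prod => i; apply: cvgM; exact: cutoff0_cvg.
Qed.

End bump.

Section fundamental_lemma.
Context {R : realType} {N : nat}.
Local Notation mu := (@lebesgue_rv R N).
Implicit Types (w f : 'rV[R]_N -> R).

Lemma loc_integ_indic w (K : set 'rV[R]_N) : loc_integrable w -> compact K ->
  integ mu (fun x => w x * \1_K x).
Proof.
move=> [_ wK] cK; have mK := compact_measurable_rv cK.
have := (integrable_mkcond _ mK).1 (wK K cK).
rewrite /integ; congr (mu.-integrable setT _).
apply/funext => x; rewrite patchE indicE; case: (x \in K) => /=.
  by rewrite mulr1.
by rewrite mulr0.
Qed.

Lemma measurable_open_box (a b : 'rV[R]_N) : measurable (open_box a b).
Proof.
apply: (@measurable_rv_box _ _ (fun i => `]a 0 i, b 0 i[%classic)) => i.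
exact: measurable_itv.
Qed.

Let integral_box w a b : loc_integrable w ->
  (forall phi, test_function phi -> \int[mu]_x (w x * phi x) = 0) ->
  \int[mu]_x (w x * \1_(open_box a b) x) = 0.
Proof.
move=> wl w0; pose K := [set x : 'rV[R]_N | `|x| <= `|a| + `|b|].
have k0 (n : nat) : 0 < n.+1%:R :> R by rewrite ltr0n.
have : \int[mu]_x (w x * bump n.+1%:R a b x) @[n --> \oo] -->
    \int[mu]_x (w x * \1_(open_box a b) x).
  apply: (@dominated_Rintegral _ _ _ _ (fun x => `|w x * \1_K x|)).
  - move=> n; apply: measurable_funM; first exact: wl.1.
    by apply: ccs_measurable; apply: test_ccs; exact: test_bump.
  - apply: measurable_funM; first exact: wl.1.
    by apply: measurable_indic; exact: measurable_open_box.
  - by move=> x; apply: cvgM; [exact: cvg_cst|exact: bump_cvg].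
  - by apply: integ_norm; apply: loc_integ_indic => //; exact: compact_norm_le.
  - move=> n x; rewrite !normrM ler_wpM2l//.
    have /andP[b0 b1] := bump_bounded n.+1%:R a b x.
    rewrite indicE; have [xK|xK] := boolP (x \in K); first by rewrite normr1 ger0_norm.
    rewrite bump_support ?normr0//.
    by move/negP: xK; rewrite inE => /negP; rewrite -ltNge.
rewrite (_ : (fun n : nat => _) = fun=> 0).
  by move=> h; apply/esym; exact: (cvg_unique _ (@cvg_cst _ (0 : R) _ _ _) h).
by apply/funext => n; apply: w0; exact: test_bump.
Qed.

(** A class stable under intersection that generates the Borel sets. *)
Definition open_boxes : set (set 'rV[R]_N) :=
  [set A | exists a b : 'rV[R]_N, A = open_box a b].

Lemma open_box_setI a b a' b' : open_box a b `&` open_box a' b' =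
  @open_box R N (\row_i Num.max (a 0 i) (a' 0 i)) (\row_i Num.min (b 0 i) (b' 0 i)).
Proof.
apply/seteqP; split => x.
  move=> [h h'] i; have := h i; have := h' i; rewrite /= !in_itv/= !mxE.
  by rewrite gt_max lt_min => /andP[-> ->] /andP[-> ->].
move=> h; split => i; have := h i; rewrite /= !in_itv/= !mxE gt_max lt_min;
  by case/andP => /andP[h1 h2] /andP[h3 h4]; rewrite ?h1 ?h2 ?h3 ?h4.
Qed.

Lemma open_boxes_generate (A : set 'rV[R]_N) : measurable A -> <<s open_boxes >> A.
Proof.
suff : @measurable _ 'rV[R]_N `<=` <<s open_boxes >> by exact.
apply: smallest_sub; first exact: smallest_sigma_algebra.
rewrite -bigcup_seq; apply: bigcup_sub => i _ _ [Y mY <-] /=; rewrite setTI.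
have {mY} : (RGenOpens.G (R:=R)).-sigma.-measurable Y by rewrite -RGenOpens.measurableE.
move: Y.
suff : <<s @RGenOpens.G R >> `<=` [set Y | <<s open_boxes >> (@rv_coord R N i @^-1` Y)] by exact.
apply: smallest_sub.
  split=> /=.
  - by rewrite preimage_set0; exact: sigma_algebra0.
  - by move=> B mB; rewrite setTD preimage_setC; exact: sigma_algebraC.
  - by move=> F mF; rewrite preimage_bigcup; exact: sigma_algebra_bigcup.
move=> _ [u [v ->]] /=.
rewrite (_ : _ @^-1` _ = \bigcup_k @open_box R N
   (\row_j (if j == i then u else - k%:R)) (\row_j (if j == i then v else k%:R))).
  apply: sigma_algebra_bigcup => k; apply: sub_sigma_algebra.
  by do 2 eexists.
apply/seteqP; split => [x|x [k _ /(_ i)]]; last by rewrite /= !mxE eqxx.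
move=> xuv; exists (Num.truncn `|x|).+1 => // j; rewrite /= !mxE.
case: eqP => [->//|_]; rewrite in_itv/= -ltr_norml.
by apply: (le_lt_trans (coord_le_norm x j)); exact: truncnS_gt.
Qed.

(** Testing against bump functions and taking limits shows that [w] has zero
    integral over every open box, hence over every bounded Borel set. *)
Lemma du_bois_reymond w : loc_integrable w ->
  (forall phi, test_function phi -> \int[mu]_x (w x * phi x) = 0) ->
  {ae mu, forall x, w x = 0}.
Proof.
move=> wl w0.
pose Q (k : nat) := @open_box R N (const_mx (- k%:R)) (const_mx k%:R).
have mQ k : measurable (Q k) by exact: measurable_open_box.
(* [w] cut off to a box is integrable, and Dynkin's lemma applies to it *)
pose W k x := w x * \1_(Q k) x.
have Wi k : integ mu (W k).
  pose K := [set x : 'rV[R]_N | `|x| <= k%:R].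
  apply: (le_integ _ (integ_norm (loc_integ_indic wl (@compact_norm_le _ _ k%:R)))).
    by apply: measurable_funM; [exact: wl.1|exact: measurable_indic].
  move=> x; rewrite /W !normrM ler_wpM2l// !indicE.
  have [xQ|xQ] := boolP (x \in Q k); last by rewrite normr0.
  rewrite mem_set//=; apply: contrapT => /negP; rewrite -ltNge => kx.
  have x0 : `|x| != 0 by rewrite gt_eqF// (le_lt_trans _ kx).
  have [[j i] /= xi] := mx_norm_neq0 x0; rewrite (ord1 j) in xi.
  move: xQ; rewrite inE => /(_ i); rewrite /= in_itv/= !mxE -ltr_norml.
  by move: kx; rewrite [`|x|]xi => /lt_trans h /h; rewrite ltxx.
have W0 k A : measurable A -> \int[mu]_x (W k x * \1_A x) = 0.
  move=> mA; have := open_boxes_generate mA.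
  have WA B : measurable B -> integ mu (fun x => W k x * \1_B x).
    move=> mB; apply: (le_integ _ (integ_norm (Wi k))).
      apply: measurable_funM; first exact: integ_measurable (Wi k).
      exact: measurable_indic.
    by move=> x; rewrite normrM indicE; case: (_ \in _); rewrite ?normr1 ?mulr1 ?normr0 ?mulr0.
  have W1 : \int[mu]_x (W k x) = 0 by exact: integral_box.
  suff : <<s open_boxes >> `<=` [set A | measurable A /\ \int[mu]_x (W k x * \1_A x) = 0].
    by move=> h /h[].
  apply: lambda_system_subset => //.
  - by move=> _ _ [a [b ->]] [a' [b' ->]]; rewrite open_box_setI; do 2 eexists.
  - apply/dynkin_lambda_system; split.
    + split => //; rewrite -[RHS]W1; apply: eq_Rintegral => x _.
      by rewrite indicE in_setT mulr1.
    + move=> B [mB B0]; split; first exact: measurableC.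
      rewrite -[RHS](subrr 0) -{1}W1 -B0 -RintegralB//; [|exact: Wi|exact: WA].
      apply: eq_Rintegral => x _; rewrite !indicE in_setC.
      by case: (x \in B); rewrite /= ?mulr0 ?mulr1 ?subrr ?subr0.
    + move=> F tF FP; split; first by apply: bigcup_measurable => j _; exact: (FP j).1.
      have : \int[mu]_x (W k x * \1_(\big[setU/set0]_(j < n) F j) x) @[n --> \oo] -->
         \int[mu]_x (W k x * \1_(\bigcup_j F j) x).
        apply: (@dominated_Rintegral _ _ _ _ (fun x => `|W k x|)).
        * move=> n; apply: measurable_funM; first exact: integ_measurable (Wi k).
          by apply: measurable_indic; apply: bigsetU_measurable => j _; exact: (FP j).1.
        * apply: measurable_funM; first exact: integ_measurable (Wi k).
          by apply: measurable_indic; apply: bigcup_measurable => j _; exact: (FP j).1.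
        * move=> x; apply: cvgM; first exact: cvg_cst.
          rewrite indicE; have [|xF] := boolP (x \in \bigcup_j F j).
            rewrite inE => -[j _ Fjx]; apply: cvg_near_cst.
            near=> n; rewrite indicE mem_set//.
            rewrite -bigcup_mkord; exists j => //=; near: n; exact: nbhs_infty_gt.
          apply: cvg_near_cst; apply: nearW => n; rewrite indicE memNset//.
          rewrite -bigcup_mkord => -[j _ Fjx]; move/negP: xF; apply.
          by rewrite inE; exists j.
        * exact: integ_norm (Wi k).
        * by move=> n x; rewrite normrM indicE; case: (_ \in _);
            rewrite ?normr1 ?mulr1 ?normr0 ?mulr0.
      rewrite (_ : (fun n : nat => _) = fun=> 0).
        by move=> h; apply/esym; exact: (cvg_unique _ (@cvg_cst _ (0 : R) _ _ _) h).
      apply/funext => n; elim: n => [|n IH].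
        rewrite big_ord0 /Rintegral; under eq_integral do rewrite indic0 mulr0.
        by rewrite integral0.
      rewrite -[RHS](addr0 0) -{1}IH -(FP n).2 -RintegralD//; last 2 first.
        by apply: WA; apply: bigsetU_measurable => j _; exact: (FP j).1.
        by apply: WA; exact: (FP n).1.
      apply: eq_Rintegral => x _; rewrite -mulrDr; congr (_ * _).
      rewrite big_ord_recr/= !indicE in_setU.
      have [xn|xn] := boolP (x \in F n); last by rewrite orbF addr0.
      rewrite orbT memNset ?add0r// -bigcup_mkord => -[j /= jn Fj].
      have /trivIsetP/(_ j n Logic.I Logic.I) := tF; rewrite ltn_eqF// => /(_ isT).
      rewrite -subset0 => /(_ x); apply; split => //.
      by move: xn; rewrite inE.
  - move=> _ [a [b ->]]; split; first exact: measurable_open_box.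
    rewrite -[RHS](integral_box (\row_i Num.max ((const_mx (- k%:R) : 'rV[R]_N) 0 i) (a 0 i))
      (\row_i Num.min ((const_mx k%:R : 'rV[R]_N) 0 i) (b 0 i)) wl w0).
    apply: eq_Rintegral => x _; rewrite -open_box_setI /W -mulrA; congr (_ * _).
    by rewrite !indicE in_setI; case: (_ \in Q k); case: (_ \in open_box a b);
      rewrite ?mulr1 ?mulr0.
have aeW k : {ae mu, forall x, W k x = 0}.
  have := @integral_ae_eq _ _ _ mu setT measurableT (fun=> 0%E) (fun x => (W k x)%:E) (Wi k).
  have m0 : measurable_fun setT (fun _ : 'rV[R]_N => 0%E : \bar R) by exact: measurable_cst.
  move=> /(_ m0); have H : forall E, E `<=` setT -> measurable E ->
     (\int[mu]_(x in E) (W k x)%:E = \int[mu]_(x in E) 0)%E.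
    move=> E _ mE; rewrite integral0 integral_mkcond/=.
    transitivity (\int[mu]_x (W k x * \1_E x)%:E)%E.
      apply: eq_integral => x _; rewrite patchE indicE.
      by case: (x \in E); rewrite ?mulr1 ?mulr0.
    rewrite -EFin_Rintegral; first by rewrite W0.
    apply: (le_integ _ (integ_norm (Wi k))).
      by apply: measurable_funM; [exact: integ_measurable (Wi k)|exact: measurable_indic].
    by move=> x; rewrite normrM indicE; case: (_ \in _); rewrite ?normr1 ?mulr1 ?normr0 ?mulr0.
  by move=> /(_ H); apply: filterS => x /(_ Logic.I) [].
have : {ae mu, forall x k, W k x = 0} by apply/ae_foralln.
apply: filterS => x Wx; have := Wx (Num.truncn `|x|).+1.
rewrite /W indicE mem_set ?mulr1// => i; rewrite /= in_itv/= !mxE -ltr_norml.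
by apply: (le_lt_trans (coord_le_norm x i)); exact: truncnS_gt.
Unshelve. all: by end_near. Qed.

End fundamental_lemma.

(** * Homogeneous differential operators with constant coefficients *)

Local Opaque partial smooth.

Section diffops.
Context {R : realType} {N : nat}.
Local Notation mu := (@lebesgue_rv R N).
Local Notation operator := (('rV[R]_N -> R) -> 'rV[R]_N -> R).
Implicit Types (f g : 'rV[R]_N -> R) (i j : 'I_N) (P : operator).

(** Operators with constant coefficients, homogeneous of order [m]. *)
Inductive diffop : nat -> operator -> Prop :=
| diffop_id : diffop 0 id
| diffop_partial m P i : diffop m P -> diffop m.+1 (fun f => partial i (P f))
| diffop_sum m (P : 'I_N -> operator) : (forall i, diffop m (P i)) ->
    diffop m (fun f x => \sum_(i < N) P i f x).

Lemma diffop_smooth m P f : diffop m P -> smooth f -> smooth (P f).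
Proof.
move=> dP; elim: dP f => {m P} [f sf|m P i _ IH f sf|m P _ IH f sf].
- exact: sf.
- by apply: smooth_partial; exact: IH.
- by apply: (@smooth_sum _ _ _ _ (fun i => P i f)) => i; exact: IH.
Qed.

Lemma partial_sum (s : seq 'I_N) (F : 'I_N -> 'rV[R]_N -> R) i :
  (forall j, smooth (F j)) ->
  partial i (fun x => \sum_(j <- s) F j x) = fun x => \sum_(j <- s) partial i (F j) x.
Proof.
move=> sF; elim: s => [|j s IH].
  rewrite (_ : (fun x => _) = fun=> 0); last by apply/funext => x; rewrite big_nil.
  apply/funext => x; rewrite big_nil; apply: partialE; exact: is_derive_cst.
rewrite (_ : (fun x => _) = fun x => F j x + \sum_(j <- s) F j x); last first.
  by apply/funext => x; rewrite big_cons.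
rewrite (partialD i (sF j) (smooth_sum s sF)) IH.
by apply/funext => x; rewrite big_cons.
Qed.

Lemma diffop_affine m P f (c r : R) a : diffop m P -> smooth f ->
  P (fun x => c * f (r *: x + a)) = fun x => c * r ^+ m * P f (r *: x + a).
Proof.
move=> dP; elim: dP f c => {m P} [f c sf|m P i dP IH f c sf|m P dP IH f c sf].
- by apply/funext => x; rewrite expr0 mulr1.
- rewrite IH// (partial_affine _ _ _ _ (diffop_smooth dP sf)).
  by apply/funext => x; rewrite exprSr mulrA.
- apply/funext => x; rewrite mulr_sumr; apply: eq_bigr => i _.
  by rewrite IH.
Qed.

Lemma diffopD m P f g : diffop m P -> smooth f -> smooth g ->
  P (fun x => f x + g x) = fun x => P f x + P g x.
Proof.
move=> dP; elim: dP f g => {m P} [//|m P i dP IH f g sf sg|m P dP IH f g sf sg].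
- by rewrite (IH _ _ sf sg) (partialD i (diffop_smooth dP sf) (diffop_smooth dP sg)).
- by apply/funext => x; rewrite -big_split/=; apply: eq_bigr => i _; rewrite IH.
Qed.

Lemma diffopZ m P f (c : R) : diffop m P -> smooth f ->
  P (fun x => c * f x) = fun x => c * P f x.
Proof.
move=> dP sf; have := diffop_affine c 1 0 dP sf; rewrite expr1n mulr1.
rewrite (_ : (fun x => c * f (1 *: x + 0)) = fun x => c * f x) => [->|].
  by apply/funext => x; rewrite scale1r addr0.
by apply/funext => x; rewrite scale1r addr0.
Qed.

Lemma diffopB m P f g : diffop m P -> smooth f -> smooth g ->
  P (fun x => f x - g x) = fun x => P f x - P g x.
Proof.
move=> dP sf sg; rewrite (_ : (fun x => _) = fun x => f x + (-1) * g x); last first.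
  by apply/funext => x; rewrite mulN1r.
rewrite (diffopD dP sf (smoothZ (-1) sg)) (diffopZ _ dP sg).
by apply/funext => x; rewrite mulN1r.
Qed.

Lemma diffop_partialC m P i f : diffop m P -> smooth f ->
  partial i (P f) = P (partial i f).
Proof.
move=> dP; elim: dP f => {m P} [//|m P j dP IH f sf|m P dP IH f sf].
- by rewrite -(IH _ sf) (partialC i j (diffop_smooth dP sf)).
- rewrite partial_sum; last by move=> j; exact: diffop_smooth (dP j) sf.
  by apply/funext => x; apply: eq_bigr => j _; rewrite IH.
Qed.

Lemma test_sum (s : seq 'I_N) (F : 'I_N -> 'rV[R]_N -> R) :
  (forall i, test_function (F i)) -> test_function (fun x => \sum_(i <- s) F i x).
Proof.
move=> tF; elim: s => [|i s IH].
  rewrite (_ : (fun x => _) = fun=> 0); last by apply/funext => x; rewrite big_nil.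
  by apply/test_functionP; split; [exact: smooth_cst|exists 0].
rewrite (_ : (fun x => _) = fun x => F i x + \sum_(j <- s) F j x).
  exact: (testD (tF i) IH).
by apply/funext => x; rewrite big_cons.
Qed.

Lemma diffop_test m P f : diffop m P -> test_function f -> test_function (P f).
Proof.
move=> dP; elim: dP f => {m P} [f tf|m P i _ IH f tf|m P _ IH f tf].
- exact: tf.
- by apply: test_partial; exact: IH.
- by apply: (@test_sum _ (fun i => P i f)) => i; exact: IH.
Qed.

(** The sign comes from one integration by parts for each order of derivation;
    the derivatives may be put back in their original order since they commute. *)
Lemma diffop_ibp m P f g : diffop m P -> smooth f -> test_function g ->
  \int[mu]_x (P f x * g x) = (-1) ^+ m * \int[mu]_x (f x * P g x).
Proof.
move=> dP; elim: dP f g => {m P} [f g|m P i dP IH f g sf tg|m P dP IH f g sf tg].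
- by rewrite expr0 mul1r.
- rewrite (integration_by_parts i (diffop_smooth dP sf) tg).
  rewrite (IH _ _ sf (test_partial i tg)) exprS mulN1r mulNr.
  by rewrite (diffop_partialC i dP (test_smooth tg)).
- transitivity (\int[mu]_x (\sum_(i < N) P i f x * g x)).
    by apply: eq_Rintegral => x _; rewrite mulr_suml.
  rewrite (@Rintegral_sum _ _ _ mu _ _ (fun i x => P i f x * g x)); last first.
    move=> i; apply: ccs_integ; apply: test_ccs.
    exact: (testM (diffop_smooth (dP i) sf) tg).
  rewrite (eq_bigr (fun i => (-1) ^+ m * \int[mu]_x (f x * P i g x))); last first.
    by move=> i _; exact: IH.
  rewrite -mulr_sumr -(@Rintegral_sum _ _ _ mu _ _ (fun i x => f x * P i g x)); last first.
    move=> i; apply: ccs_integ; apply: test_ccs.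
    exact: (testM sf (diffop_test (dP i) tg)).
  by congr (_ * _); apply: eq_Rintegral => x _; rewrite mulr_sumr.
Qed.

(** The sum of the squared norms of all derivatives of order [m], each counted
    once for every ordering of its indices. *)
Fixpoint derivative_energy (m : nat) f : R :=
  if m is k.+1 then \sum_(i < N) derivative_energy k (partial i f) else sqn mu f.

Lemma derivative_energy_ge0 m f : 0 <= derivative_energy m f.
Proof.
elim: m f => [|m IH] f /=; first exact: sqn_ge0.
by apply: sumr_ge0 => i _; exact: IH.
Qed.

Lemma diffop_bounded m P : diffop m P -> exists2 C : R, 0 <= C &
  forall f, test_function f -> sqn mu (P f) <= C * derivative_energy m f.
Proof.
elim=> {m P} [|m P i dP [C C0 IH]|m P dP IH].
- by exists 1 => // f _; rewrite mul1r.
- exists C => // f tf; rewrite (diffop_partialC i dP (test_smooth tf)).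
  apply: (le_trans (IH _ (test_partial i tf))); rewrite ler_wpM2l//=.
  by rewrite (bigD1 i)//= lerDl; apply: sumr_ge0 => j _; exact: derivative_energy_ge0.
- have {IH} IH i : exists C : R, 0 <= C /\
     forall f, test_function f -> sqn mu (P i f) <= C * derivative_energy m f.
    by have [C ? ?] := IH i; exists C.
  have [C CP] := choice IH.
  exists ((size (index_enum 'I_N))%:R * \sum_(i < N) C i).
    by rewrite mulr_ge0//; apply: sumr_ge0 => i _; exact: (CP i).1.
  move=> f tf; apply: (le_trans (@sqn_sum_le _ _ _ _ (fun i => P i f) _)).
    by move=> i; apply: ccs_L2; apply: test_ccs; exact: diffop_test (dP i) tf.
  rewrite -mulrA ler_wpM2l// mulr_suml; apply: ler_sum => i _.
  exact: (CP i).2.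
Qed.

(** Two integrations by parts replace the square of a mixed derivative by a
    product of two pure ones. *)
Lemma sqn_partial2 f : test_function f ->
  \sum_(i < N) \sum_(j < N) sqn mu (partial j (partial i f)) = sqn mu (laplacian f).
Proof.
move=> tf; have sf := test_smooth tf.
rewrite [RHS]/sqn /laplacian.
have tp i j : test_function (partial i (partial j f)).
  by apply: test_partial; exact: test_partial.
transitivity (\sum_(i < N) \sum_(j < N)
    \int[mu]_x (partial i (partial i f) x * partial j (partial j f) x)).
  apply: eq_bigr => i _; apply: eq_bigr => j _; rewrite sqnE /ip.
  apply: etrans (integration_by_parts j (smooth_partial i sf) (tp j i)) _.
  apply: etrans (esym (integration_by_parts i (smooth_partial i sf) (tp j j))).
  have -> : partial j (partial j (partial i f)) = partial i (partial j (partial j f)).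
    by rewrite (partialC j i sf) (partialC j i (smooth_partial j sf)).
  by [].
transitivity (\int[mu]_x (\sum_(i < N) \sum_(j < N)
    (partial i (partial i f) x * partial j (partial j f) x))).
  have ti i j : integ mu (fun x => partial i (partial i f) x * partial j (partial j f) x).
    by apply: ccs_integ; apply: test_ccs; exact: (testM (test_smooth (tp i i)) (tp j j)).
  rewrite (@Rintegral_sum _ _ _ mu _ _ (fun i x => \sum_(j < N)
    (partial i (partial i f) x * partial j (partial j f) x))); last first.
    by move=> i; apply: (@integ_sum _ _ _ mu _ _ (fun j x => partial i (partial i f) x * partial j (partial j f) x)) => j.
  apply: eq_bigr => i _.
  by rewrite (@Rintegral_sum _ _ _ mu _ _ (fun j x =>
    partial i (partial i f) x * partial j (partial j f) x)).
apply: eq_Rintegral => x _; rewrite expr2 mulr_suml; apply: eq_bigr => i _.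
by rewrite mulr_sumr.
Qed.

Lemma diffop_laplacian : diffop 2 laplacian.
Proof.
apply: (@diffop_sum 2 (fun i f => partial i (partial i f))) => i.
by apply: diffop_partial; apply: (@diffop_partial 0 id i); exact: diffop_id.
Qed.

Lemma derivative_energySS m f : test_function f ->
  derivative_energy m.+2 f = derivative_energy m (laplacian f).
Proof.
elim: m f => [|m IH] f tf; first exact: sqn_partial2.
rewrite [RHS]/=; rewrite -[LHS]/(\sum_(i < N) derivative_energy m.+2 (partial i f)).
apply: eq_bigr => i _; rewrite IH; last exact: test_partial.
by rewrite (diffop_partialC i diffop_laplacian (test_smooth tf)).
Qed.

(** Derivatives are traded for Laplacians two at a time; for odd [m] one gradient
    remains. *)
Lemma derivative_energyE m f : test_function f ->
  derivative_energy m f = \sum_(P <- nabla_ops m) sqn mu (P f).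
Proof.
move=> tf; have main k g : test_function g ->
   derivative_energy (odd m + k.*2) g = derivative_energy (odd m) (iter k laplacian g).
  elim: k g => [|k IH] g tg; first by rewrite addn0.
  rewrite doubleS !addnS (derivative_energySS _ tg) (IH _ (diffop_test diffop_laplacian tg)).
  by rewrite -iterSr.
rewrite -[in LHS](odd_double_half m) (main _ _ tf) /nabla_ops.
case: (odd m) => /=; last by rewrite big_seq1.
by rewrite big_map big_enum.
Qed.

End diffops.

(** * Spaces of powers and the norm of the completion *)

Section Lp.
Context {R : realType} {N : nat}.
Local Notation mu := (@lebesgue_rv R N).
Implicit Types (f g : 'rV[R]_N -> R) (p : R).

Definition Lp p f := measurable_fun setT f /\ integ mu (fun x => `|f x| `^ p).

Definition pint p f := \int[mu]_x (`|f x| `^ p).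

Lemma pint_ge0 p f : 0 <= pint p f.
Proof. by apply: Rintegral_ge0 => x _; exact: powR_ge0. Qed.

Lemma measurable_norm_powR p f : measurable_fun setT f ->
  measurable_fun setT (fun x => `|f x| `^ p).
Proof.
move=> mf; apply: (@measurableT_comp _ _ _ _ _ _ (fun y : R => y `^ p)).
  exact: measurable_powR.
exact: measurableT_comp.
Qed.

Lemma Lnorm_EFin p f : Lp p f ->
  'N[mu]_p%:E[EFin \o f]%E = (pint p f `^ p^-1)%:E.
Proof.
move=> [mf fi]; rewrite unlock.
rewrite (_ : (\int[mu]_x _)%E = (\int[mu]_x (`|f x| `^ p)%:E)%E); last exact: eq_integral.
by rewrite -EFin_Rintegral// poweR_EFin.
Qed.

Lemma LfunP p f : 0 < p -> f \in Lfun mu p%:E <-> Lp p f.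
Proof.
move=> p0; split=> [/andP[]|[mf fi]].
  rewrite inE => mf; rewrite inE /finite_norm => fy; split => //.
  apply/integP; split; first exact: measurable_norm_powR.
  under eq_integral do rewrite ger0_norm ?powR_ge0//.
  have := poweR_lty p fy; rewrite poweR_Lnorm ?gt_eqF//.
apply/andP; split; rewrite inE//.
by rewrite /finite_norm /= Lnorm_EFin// ltry.
Qed.

Lemma powR_ler p (a b : R) : 0 < p -> 0 <= a -> a <= b -> a `^ p <= b `^ p.
Proof.
by move=> p0 a0 ab; apply: ge0_ler_powR => //; rewrite ?nnegrE ?(ltW p0)// (le_trans a0).
Qed.

Lemma powR_cvg0p p (v : nat -> R) : 0 < p -> (forall k, 0 <= v k) ->
  v k @[k --> \oo] --> 0 -> v k `^ p @[k --> \oo] --> 0.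
Proof.
move=> p0 v0 /cvgrPdist_lt vc; apply/cvgrPdist_lt => e e0.
have e1 : 0 < e `^ p^-1 by rewrite powR_gt0.
near=> k; rewrite sub0r normrN ger0_norm ?powR_ge0//.
have : `|0 - v k| < e `^ p^-1 by near: k; exact: vc.
rewrite sub0r normrN ger0_norm// => h.
have : v k `^ p < (e `^ p^-1) `^ p.
  by apply: gt0_ltr_powR; rewrite ?nnegrE ?v0 ?powR_ge0.
by rewrite -powRrM mulVf ?gt_eqF// powRr1// ltW.
Unshelve. all: by end_near. Qed.

Lemma LpD p f g : 0 < p -> Lp p f -> Lp p g -> Lp p (fun x => f x + g x).
Proof.
move=> p0 [mf fi] [mg gi]; have mfg := measurable_funD mf mg; split => //.
apply: (le_integ _ (integZ (2 `^ p) (integD fi gi))); first exact: measurable_norm_powR.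
move=> x; rewrite ger0_norm ?powR_ge0//.
have : `|f x + g x| <= 2 * Num.max `|f x| `|g x|.
  apply: le_trans (ler_normD _ _) _; rewrite mulr_natl mulr2n.
  by apply: lerD; rewrite le_max lexx ?orbT.
move=> /(powR_ler p0 (normr_ge0 _))/le_trans; apply.
rewrite powRM//.
rewrite ler_wpM2l ?powR_ge0//; case: (leP `|f x| `|g x|) => _.
  by rewrite lerDr powR_ge0.
by rewrite lerDl powR_ge0.
Qed.

Lemma LpZ p (c : R) f : 0 < p -> Lp p f -> Lp p (fun x => c * f x).
Proof.
move=> p0 [mf fi]; split; first exact: measurable_funM.
by under eq_fun do rewrite normrM powRM//; exact: integZ.
Qed.

Lemma LpB p f g : 0 < p -> Lp p f -> Lp p g -> Lp p (fun x => f x - g x).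
Proof.
move=> p0 fL gL; have := LpD p0 fL (LpZ (-1) p0 gL).
by under eq_fun do rewrite mulN1r.
Qed.

Lemma Lp_affine p (c r : R) a f : 0 < p -> 0 < r -> Lp p f ->
  Lp p (fun x => c * f (r *: x + a)).
Proof.
move=> p0 r0 [mf fi]; apply: LpZ => //; split; first exact: measurable_affine.
exact: (integ_affine a r0 fi).
Qed.

Lemma pint_affine p (c r : R) a f : 0 < p -> 0 < r -> Lp p f ->
  pint p (fun x => c * f (r *: x + a)) = `|c| `^ p * ((r ^+ N)^-1 * pint p f).
Proof.
move=> p0 r0 [mf fi].
rewrite /pint -(Rintegral_affine a r0 fi) -RintegralZl//; last exact: (integ_affine a r0 fi).
by apply: eq_Rintegral => x _; rewrite normrM powRM.
Qed.

Lemma ccs_Lp p f : 0 < p -> ccs f -> Lp p f.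
Proof.
move=> p0 fc; have [C [M [C0 M0 fCM]]] := ccs_dominated fc.
split; first exact: ccs_measurable.
apply: (le_integ _ (integ_cube (C `^ p) M0)).
  by apply: measurable_norm_powR; exact: ccs_measurable.
move=> x; rewrite ger0_norm ?powR_ge0//; apply: (le_trans (powR_ler p0 (normr_ge0 _) (fCM x))).
rewrite indicE; case: (_ \in _); first by rewrite !mulr1.
by rewrite !mulr0 powR0// gt_eqF.
Qed.

(** A weak form of Young's inequality: beyond the threshold [d] the power
    dominates. *)
Lemma norm_le_powR p (d t : R) : 1 <= p -> 0 < d ->
  `|t| <= d + d * d^-1 `^ p * `|t| `^ p.
Proof.
move=> p1 d0; have [td|dt] := leP `|t| d.
  by apply: (le_trans td); rewrite lerDl !mulr_ge0 ?powR_ge0// ltW.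
apply: ler_wpDl; first exact: ltW.
rewrite -mulrA -powRM ?invr_ge0 ?(ltW d0)//.
have h : 1 <= d^-1 * `|t| by rewrite mulrC ler_pdivlMr// mul1r ltW.
have := le1r_powR h p1.
by move=> h2; rewrite -ler_pdivrMl.
Qed.

Lemma Lp_ccs_integ p f g : 1 <= p -> Lp p f -> ccs g -> integ mu (fun x => f x * g x).
Proof.
move=> p1 [mf fi] gc; have [C C0 gC] := ccs_bounded gc.
have mg := ccs_measurable gc.
apply: (le_integ _ (integD (integ_norm (ccs_integ gc)) (integZ C fi))).
  exact: measurable_funM.
move=> x; rewrite normrM.
have := norm_le_powR (f x) p1 (@ltr01 R); rewrite invr1 powR1 !mul1r => h.
have := ler_wpM2r (normr_ge0 (g x)) h; move=> /le_trans; apply.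
rewrite mulrDl mul1r lerD2l mulrC ler_wpM2r ?powR_ge0//; exact: gC.
Qed.

(** Young's inequality with a small parameter replaces the conjugate exponent of
    Hoelder's inequality. *)
Lemma pint_cvg_pairing p (F : nat -> 'rV[R]_N -> R) f g : 1 <= p ->
  (forall k, Lp p (F k)) -> Lp p f -> ccs g ->
  pint p (fun x => f x - F k x) @[k --> \oo] --> 0 ->
  \int[mu]_x (F k x * g x) @[k --> \oo] --> \int[mu]_x (f x * g x).
Proof.
move=> p1 FL fL gc Ff; have p0 : 0 < p by rewrite (lt_le_trans ltr01).
have [C C0 gC] := ccs_bounded gc.
have gi := integ_norm (ccs_integ gc).
set A := \int[mu]_x `|g x|.
have A0 : 0 <= A by apply: Rintegral_ge0.
apply/cvgrPdist_lt => e e0.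
(* this choice makes both terms of Young's inequality at most [e / 2] eventually *)
pose d := e / (2 * (A + 1)).
have d0 : 0 < d by rewrite divr_gt0// mulr_gt0// ltr_wpDl.
pose K := C * (d * d^-1 `^ p).
have K0 : 0 <= K by rewrite mulr_ge0// mulr_ge0 ?powR_ge0// ltW.
have e20 : 0 < e / (2 * (K + 1)) by rewrite divr_gt0// mulr_gt0// ltr_wpDl.
have /cvgrPdist_lt/(_ _ e20) Ffe := Ff.
near=> k.
have FLk := LpB p0 fL (FL k).
have i1 : integ mu (fun x => (f x - F k x) * g x) by exact: Lp_ccs_integ FLk gc.
rewrite -RintegralB//; [|exact: Lp_ccs_integ fL gc|exact: Lp_ccs_integ (FL k) gc].
rewrite (_ : Rintegral _ _ _ = \int[mu]_x ((f x - F k x) * g x)); last first.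
  by apply: eq_Rintegral => x _; rewrite mulrBl.
apply: (le_lt_trans (le_normr_Rintegral measurableT i1)).
apply: (@le_lt_trans _ _ (\int[mu]_x (d * `|g x| + K * `|f x - F k x| `^ p))).
  apply: le_Rintegral => //; first exact: integ_norm.
    by apply: integD; apply: integZ => //; exact: FLk.2.
  move=> x _; rewrite normrM.
  have := ler_wpM2r (normr_ge0 (g x)) (norm_le_powR (f x - F k x) p1 d0).
  move=> /le_trans; apply; rewrite mulrDl lerD2l /K mulrC mulrA.
  rewrite ler_wpM2r ?powR_ge0//; apply: ler_wpM2r; last exact: gC.
  by rewrite mulr_ge0 ?powR_ge0// ltW.
rewrite RintegralD//; [|exact: integZ|exact: integZ FLk.2].
rewrite !RintegralZl//; last exact: FLk.2.
have : `|0 - pint p (fun x => f x - F k x)| < e / (2 * (K + 1)) by near: k; exact: Ffe.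
rewrite sub0r normrN ger0_norm ?pint_ge0// -/A /pint => h.
have X0 : 0 <= \int[mu]_x (`|f x - F k x| `^ p) by exact: pint_ge0.
move: (\int[mu]_x (`|f x - F k x| `^ p)) h X0 => X h X0.
have dA : d * A <= e / 2.
  rewrite /d invfM mulrA -[leRHS]mulr1 -mulrA ler_wpM2l//; first by rewrite divr_ge0// ltW.
  by rewrite ler_pdivrMl ?mulr1 ?lerDl// ltr_wpDl.
have KX : K * X < e / 2.
  apply: (@le_lt_trans _ _ ((K + 1) * X)); first by rewrite mulrDl mul1r lerDl.
  by rewrite -ltr_pdivlMl ?ltr_wpDl// (_ : _ * (e / 2) = e / (2 * (K + 1)))// invfM; ring.
by rewrite (splitr e) ler_ltD.
Unshelve. all: by end_near. Qed.

End Lp.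

Section Dm2_norm.
Context {R : realType} {N : nat}.
Local Notation mu := (@lebesgue_rv R N).
Implicit Types (f g : 'rV[R]_N -> R).

Lemma foldr_partial_swap f (s1 s2 : seq 'I_N) : smooth f ->
  foldr partial (foldr partial f s2) s1 = foldr partial (foldr partial f s1) s2.
Proof.
move=> sf; elim: s1 => [//|i s1 IH]; rewrite [LHS]/= IH [RHS]/=.
elim: s2 {IH} => [//|j s2 IH2]; rewrite [LHS]/= [RHS]/= -IH2.
exact: (partialC _ _ (smooth_foldr s2 (smooth_foldr s1 sf))).
Qed.

Lemma foldr_partial_perm f (s1 s2 : seq 'I_N) : smooth f -> perm_eq s1 s2 ->
  foldr partial f s1 = foldr partial f s2.
Proof.
move=> sf h; move: (erefl (foldr partial f s1)).
apply: (catCA_perm_ind (P := fun s => foldr partial f s1 = foldr partial f s)) h => t1 t2 t3.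
by rewrite !foldr_cat => ->; exact: (foldr_partial_swap _ _ (smooth_foldr t3 sf)).
Qed.

Lemma multi_partialE m (a : {ffun 'I_N -> 'I_m.+1}) f :
  multi_partial a f = foldr partial f (flatten [seq nseq (a i) i | i <- enum 'I_N]).
Proof.
rewrite /multi_partial; elim: (enum _) => [//|i s IH] /=.
rewrite foldr_cat -IH; elim: (nat_of_ord (a i)) => [//|n /= ->//].
Qed.

Lemma sum_count_mem (p : pred 'I_N) (s : seq 'I_N) :
  (\sum_(i < N) p i * count_mem i s = count p s)%N.
Proof.
elim: s => [|j s IH] /=; first by rewrite big1// => i _; rewrite muln0.
under eq_bigr do rewrite mulnDr.
rewrite big_split/= IH; congr (_ + _)%N.
by rewrite (bigD1 j)//= eqxx muln1 big1 ?addn0// => i /negbTE; rewrite eq_sym => ->; rewrite muln0.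
Qed.

(** Commuting derivatives can be sorted into a multi-index. *)
Lemma foldr_multi_partial m f (s : seq 'I_N) : smooth f -> size s = m ->
  exists2 a : {ffun 'I_N -> 'I_m.+1}, (\sum_i a i)%N == m &
    foldr partial f s = multi_partial a f.
Proof.
move=> sf sm; have cm i : (count_mem i s < m.+1)%N by rewrite ltnS -sm count_size.
exists [ffun i => Ordinal (cm i)].
  have := sum_count_mem predT s; rewrite count_predT sm => e; apply/eqP; rewrite -[RHS]e.
  by apply: eq_bigr => i _; rewrite ffunE/= mul1n.
rewrite multi_partialE; apply: (foldr_partial_perm sf).
apply/permP => p; rewrite count_flatten -map_comp sumnE big_map big_enum/=.
rewrite -sum_count_mem; apply: eq_bigr => i _.
by rewrite count_nseq ffunE.
Qed.

Lemma size_multi_index m (a : {ffun 'I_N -> 'I_m.+1}) : (\sum_i a i)%N == m ->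
  size (flatten [seq nseq (a i) i | i <- enum 'I_N]) = m.
Proof.
move=> /eqP am; rewrite size_flatten /shape -map_comp sumnE big_map big_enum/= -[RHS]am.
by apply: eq_bigr => i _; rewrite size_nseq.
Qed.

Lemma Lnorm2E f : L2 mu f -> fine ('N[mu]_2%:E[EFin \o f])%E ^+ 2 = sqn mu f.
Proof.
move=> [mf f2].
have E x : `|f x| `^ 2 = f x ^+ 2 by rewrite powR_mulrn// real_normK// num_real.
have fL : Lp 2 f by split => //; under eq_fun do rewrite E.
rewrite (Lnorm_EFin fL) /= powR12_sqrt ?pint_ge0// sqr_sqrtr ?pint_ge0//.
by apply: eq_Rintegral => x _; rewrite E.
Qed.

Lemma sqr_Dm2_norm m f : test_function f -> Dm2_norm m f ^+ 2 =
  \sum_(a : {ffun 'I_N -> 'I_m.+1} | (\sum_i a i)%N == m) sqn mu (multi_partial a f).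
Proof.
move=> tf; rewrite /Dm2_norm sqr_sqrtr; last by apply: sumr_ge0 => a _; exact: sqr_ge0.
apply: eq_bigr => a _; apply: Lnorm2E; rewrite multi_partialE.
by apply: ccs_L2; apply: test_ccs; exact: test_foldr.
Qed.

Lemma derivative_energy_le_foldr m f (B : R) :
  (forall s, size s = m -> sqn mu (foldr partial f s) <= B) ->
  derivative_energy m f <= N%:R ^+ m * B.
Proof.
elim: m f => [|m IH] f fB; first by rewrite mul1r; exact: (fB [::]).
rewrite exprS -mulrA [leLHS]/=; apply: (@le_trans _ _ (\sum_(i < N) N%:R ^+ m * B)).
  apply: ler_sum => i _; apply: IH => s sm.
  by have := fB (rcons s i); rewrite size_rcons sm foldr_rcons; exact.
by rewrite sumr_const card_ord mulr_natl.
Qed.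

(** Each of the [N ^ m] iterated derivatives is one of the terms of the norm. *)
Lemma derivative_energy_le m f : test_function f ->
  derivative_energy m f <= N%:R ^+ m * Dm2_norm m f ^+ 2.
Proof.
move=> tf; apply: derivative_energy_le_foldr => s sm; rewrite (sqr_Dm2_norm _ tf).
have [a am ->] := foldr_multi_partial (test_smooth tf) sm.
by rewrite (bigD1 a)//= lerDl; apply: sumr_ge0 => b _; exact: sqn_ge0.
Qed.

Lemma foldr_partial_affine f (c r : R) a s : smooth f ->
  foldr partial (fun x => c * f (r *: x + a)) s =
  fun x => c * r ^+ size s * foldr partial f s (r *: x + a).
Proof.
move=> sf; elim: s => [|i s IH]; first by apply/funext => x; rewrite /= expr0 mulr1.
rewrite [LHS]/= IH (partial_affine _ _ _ _ (smooth_foldr s sf)).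
by apply/funext => x; rewrite /= exprSr mulrA.
Qed.

Lemma sqr_Dm2_norm_affine m f (c r : R) a : 0 < r -> test_function f ->
  Dm2_norm m (fun x => c * f (r *: x + a)) ^+ 2 =
  c ^+ 2 * r ^+ m ^+ 2 * (r ^+ N)^-1 * Dm2_norm m f ^+ 2.
Proof.
move=> r0 tf; rewrite (sqr_Dm2_norm _ (test_affine c a r0 tf)) (sqr_Dm2_norm _ tf).
rewrite mulr_sumr; apply: eq_bigr => b bm.
rewrite !multi_partialE (foldr_partial_affine _ _ _ _ (test_smooth tf)).
have fL : L2 mu (foldr partial f (flatten [seq nseq (b i) i | i <- enum 'I_N])).
  by apply: ccs_L2; apply: test_ccs; exact: test_foldr.
rewrite (sqnZ _ (L2_affine a r0 fL)) (sqn_affine a r0 fL) size_multi_index//.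
by rewrite exprMn !mulrA.
Qed.

Lemma Dm2_norm_ge0 m f : 0 <= Dm2_norm m f.
Proof. exact: sqrtr_ge0. Qed.

End Dm2_norm.

(** * Weak derivatives of elements of the completion *)

Section weak_derivatives.
Context {R : realType} {N : nat}.
Local Notation mu := (@lebesgue_rv R N).
Local Notation operator := (('rV[R]_N -> R) -> 'rV[R]_N -> R).
Implicit Types (u w f g : 'rV[R]_N -> R) (P : operator).

Lemma loc_integ_ccs w g : loc_integrable w -> ccs g -> integ mu (fun x => w x * g x).
Proof.
move=> wl gc; have [C C0 gC] := ccs_bounded gc; have [_ [M gM]] := gc.
apply: (le_integ _ (integZ C (integ_norm (loc_integ_indic wl (@compact_norm_le _ _ M))))).
  by apply: measurable_funM; [exact: wl.1|exact: ccs_measurable].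
move=> x; rewrite !normrM indicE; have [xM|xM] := boolP (x \in _).
  by rewrite normr1 mulr1 mulrC ler_wpM2r// gC.
rewrite gM ?normr0 ?mulr0//; move/negP: xM; rewrite inE => /negP.
by rewrite /= -ltNge.
Qed.

Lemma loc_integrableB w1 w2 : loc_integrable w1 -> loc_integrable w2 ->
  loc_integrable (fun x => w1 x - w2 x).
Proof.
move=> [m1 h1] [m2 h2]; split; first exact: measurable_funB.
move=> K cK; have mK := compact_measurable_rv cK.
exact: (integrableB mK (h1 K cK) (h2 K cK)).
Qed.

Lemma le_loc_integrable f g : measurable_fun setT f -> integ mu g ->
  (forall x, 0 <= g x) -> (forall x, `|f x| <= 1 + g x) -> loc_integrable f.
Proof.
move=> mf gi g0 fg; split => // K cK; have mK := compact_measurable_rv cK.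
have [M [_ KM]] := compact_bounded cK.
have K1 : (mu K < +oo)%E.
  apply: (@le_lt_trans _ _ (mu (rv_cube (- `|M + 1|) `|M + 1|))).
    apply: le_measure; rewrite ?inE//; first exact: measurable_rv_cube.
    apply: (subset_trans _ (@rv_norm_le_cube _ _ _)) => x Kx /=.
    by apply: (le_trans _ (ler_norm _)); apply: KM => //; rewrite ltrDl.
  exact: lebesgue_rv_cube_lty.
have : integ mu (fun x => f x * \1_K x).
  apply: (le_integ _ (integD (integ_indic mK K1) gi)).
    by apply: measurable_funM => //; exact: measurable_indic.
  move=> x; rewrite normrM indicE.
  by case: (x \in K); rewrite ?normr1 ?normr0 ?mulr1 ?mulr0 ?add0r ?fg ?g0.
move=> h; apply: (integrable_mkcond _ mK).2; move: h; rewrite /integ.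
congr (mu.-integrable setT _); apply/funext => x; rewrite patchE indicE.
by case: (x \in K) => /=; rewrite ?mulr1 ?mulr0.
Qed.

Lemma L2_loc_integrable f : L2 mu f -> loc_integrable f.
Proof.
move=> [mf f2]; apply: (le_loc_integrable mf f2) => x; first exact: sqr_ge0.
rewrite -(real_normK (num_real (f x))).
have := sqr_ge0 (`|f x| - 1); have := normr_ge0 (f x); nra.
Qed.

Lemma Lp_loc_integrable p f : 1 <= p -> Lp p f -> loc_integrable f.
Proof.
move=> p1 [mf fi]; apply: (le_loc_integrable mf fi) => x; first exact: powR_ge0.
by have := norm_le_powR (f x) p1 (@ltr01 R); rewrite invr1 powR1 !mul1r.
Qed.

(** The difference of two candidates is orthogonal to all test functions. *)
Lemma weak_diff_unique m P u w : loc_integrable w ->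
  (forall phi, test_function phi ->
    \int[mu]_x (u x * P phi x) = (-1) ^+ m * \int[mu]_x (w x * phi x)) ->
  loc_integrable (weak_diff m P u) /\ {ae mu, forall x, weak_diff m P u x = w x}.
Proof.
move=> wl wP.
have : exists w, loc_integrable w /\ forall phi, test_function phi ->
    \int[mu]_x (u x * P phi x) = (-1) ^+ m * \int[mu]_x (w x * phi x) by exists w.
move=> /getPex; rewrite -/(weak_diff m P u); set w' := weak_diff m P u => -[w'l w'P].
split => //.
suff : {ae mu, forall x, w' x - w x = 0}.
  by apply: filterS => x /eqP; rewrite subr_eq0 => /eqP.
apply: (du_bois_reymond (loc_integrableB w'l wl)) => phi tphi.
have phic := test_ccs tphi.
under eq_Rintegral do rewrite mulrBl.
rewrite RintegralB//; [|exact: loc_integ_ccs w'l phic|exact: loc_integ_ccs wl phic].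
have := w'P _ tphi; rewrite (wP _ tphi) => /mulfI ->; first by rewrite subrr.
by rewrite signr_eq0.
Qed.

End weak_derivatives.

Section Dm2_structure.
Context {R : realType} {N : nat} (m : nat).
Hypothesis hN : (2 * m < N)%N.
Local Notation mu := (@lebesgue_rv R N).
Local Notation operator := (('rV[R]_N -> R) -> 'rV[R]_N -> R).
Local Notation p := (crit_exp R N m).
Implicit Types (u w f g : 'rV[R]_N -> R) (P : operator) (phi : nat -> 'rV[R]_N -> R).

Lemma dim_gap_gt0 : 0 < N%:R - 2 * m%:R :> R.
Proof. by rewrite subr_gt0 -natrM ltr_nat. Qed.

Lemma crit_exp_ge2 : 2 <= p.
Proof.
rewrite /crit_exp ler_pdivlMr ?dim_gap_gt0// ler_wpM2l//.
by rewrite gerBl mulr_ge0.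
Qed.

Lemma crit_exp_ge1 : 1 <= p.
Proof. by apply: le_trans crit_exp_ge2; rewrite ler1n. Qed.

Lemma crit_exp_gt0 : 0 < p.
Proof. by apply: lt_le_trans crit_exp_ge2; rewrite ltr0n. Qed.

(** The approximating sequences in the definition of the completion, with the
    norm of the power space replaced by the integral of the power. *)
Definition Dm2_approx u phi := [/\ forall k, test_function (phi k),
  forall e : R, 0 < e -> exists k0, forall j k, (k0 <= j)%N -> (k0 <= k)%N ->
    Dm2_norm m (fun x => phi j x - phi k x) < e &
  pint p (fun x => u x - phi k x) @[k --> \oo] --> 0].

Lemma Dm2P u : Dm2 m u <-> Lp p u /\ exists phi, Dm2_approx u phi.
Proof.
have p0 := crit_exp_gt0.
have Lpsub phi k : Lp p u -> test_function (phi k) -> Lp p (fun x => u x - phi k x).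
  by move=> uL tphi; apply: LpB => //; apply: ccs_Lp => //; exact: test_ccs.
split=> [[/(LfunP _ p0) uL [phi [tphi cphi uphi]]]|[uL [phi [tphi cphi uphi]]]]; split.
- exact: uL.
- exists phi; split => //.
  have : (pint p (fun x => u x - phi k x) `^ p^-1)%:E @[k --> \oo] --> 0%:E.
    by move: uphi; under eq_fun do rewrite (Lnorm_EFin (Lpsub _ _ uL (tphi _))).
  move=> /fine_cvgP[_ /=] h.
  have := powR_cvg0p p0 (fun k => powR_ge0 _ _) h.
  by under eq_fun do rewrite /= -powRrM mulVf ?gt_eqF// powRr1 ?pint_ge0//.
- exact/LfunP.
- exists phi; split => //.
  under eq_fun do rewrite (Lnorm_EFin (Lpsub _ _ uL (tphi _))).
  apply: cvg_EFin; first exact: nearW.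
  apply: powR_cvg0p => //; first by rewrite invr_gt0.
  by move=> k; exact: pint_ge0.
Qed.

Lemma diffop_approx_cvg P u phi : diffop m P -> Dm2_approx u phi ->
  exists2 W, L2 mu W & cvg2 mu (fun k => P (phi k)) W.
Proof.
move=> dP [tphi cphi _]; have [C C0 PC] := diffop_bounded dP.
apply: L2_complete => [k|e e0]; first by apply: ccs_L2; apply: test_ccs; exact: (diffop_test dP (tphi k)).
pose A := C * N%:R ^+ m + 1.
have A0 : 0 < A by rewrite ltr_wpDl// mulr_ge0// exprn_ge0.
have d0 : 0 < Num.sqrt (e / A) by rewrite sqrtr_gt0 divr_gt0.
have [k0 k0P] := cphi _ d0; exists k0 => j k k0j k0k.
have tjk : test_function (fun x => phi j x - phi k x).
  have := testD (tphi j) (testZ (-1) (tphi k)).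
  by congr test_function; apply/funext => x; rewrite mulN1r.
rewrite -(diffopB dP (test_smooth (tphi j)) (test_smooth (tphi k))).
apply: (le_lt_trans (PC _ tjk)).
apply: (@le_lt_trans _ _ (C * N%:R ^+ m * Dm2_norm m (fun x => phi j x - phi k x) ^+ 2)).
  by rewrite -mulrA ler_wpM2l//; exact: derivative_energy_le.
have h : Dm2_norm m (fun x => phi j x - phi k x) ^+ 2 < e / A.
  rewrite -[ltRHS]sqr_sqrtr ?divr_ge0 ?(ltW e0) ?(ltW A0)//.
  by rewrite ltr_pXn2r// ?nnegrE ?Dm2_norm_ge0 ?sqrtr_ge0//; exact: k0P.
apply: (@le_lt_trans _ _ (A * Dm2_norm m (fun x => phi j x - phi k x) ^+ 2)).
  by rewrite ler_wpM2r ?sqr_ge0// lerDl.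
by rewrite -ltr_pdivlMl// mulrC.
Qed.

(** The limit in mean square of the classical derivatives of the approximations
    satisfies the integration by parts formula that defines the weak derivative. *)
Lemma diffop_weak_diff P u phi : diffop m P -> Lp p u -> Dm2_approx u phi ->
  L2 mu (weak_diff m P u) /\ cvg2 mu (fun k => P (phi k)) (weak_diff m P u).
Proof.
move=> dP uL uphi; have [W WL PW] := diffop_approx_cvg dP uphi.
have [tphi _ up] := uphi; have p1 := crit_exp_ge1; have p0 := crit_exp_gt0.
have PL k : L2 mu (P (phi k)) by apply: ccs_L2; apply: test_ccs; exact: (diffop_test dP (tphi k)).
have phiL k : Lp p (phi k) by apply: ccs_Lp => //; exact: test_ccs.
have WP psi : test_function psi ->
    \int[mu]_x (u x * P psi x) = (-1) ^+ m * \int[mu]_x (W x * psi x).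
  move=> tpsi.
  have tPpsi := test_ccs (diffop_test dP tpsi).
  have c1 := pint_cvg_pairing p1 phiL uL tPpsi up.
  have c2 := cvg2_ip PL WL (ccs_L2 (test_ccs tpsi)) PW.
  have c3 : (-1) ^+ m * ip mu (P (phi k)) psi @[k --> \oo] --> (-1) ^+ m * ip mu W psi.
    by apply: cvgM => //; exact: cvg_cst.
  apply: (cvg_unique _ c1) => //; apply: cvg_trans c3.
  apply: near_eq_cvg; apply: nearW => k.
  rewrite /ip (diffop_ibp dP (test_smooth (tphi k)) tpsi) mulrA -exprMn mulrNN mulr1 expr1n.
  by rewrite mul1r.
have [wl wW] := weak_diff_unique (L2_loc_integrable WL) WP.
have WwL : L2 mu (weak_diff m P u).
  split; first exact: wl.1.
  apply: (ae_integ _ _ WL.2); first by apply: measurable_funX; exact: wl.1.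
  by apply: filterS wW => x ->.
split => //; rewrite /cvg2 (_ : (fun k => sqn mu (fun x => P (phi k) x - weak_diff m P u x)) =
  fun k => sqn mu (fun x => P (phi k) x - W x)); first exact: PW.
apply/funext => k; apply: ae_eq_Rintegral.
- by apply: measurable_funX; apply: measurable_funB; [exact: (PL k).1|exact: wl.1].
- by apply: measurable_funX; apply: measurable_funB; [exact: (PL k).1|exact: WL.1].
- by apply: filterS wW => x ->.
Qed.

(** Indexing the components of [nabla^m] by naturals gives sums over ordinals. *)
Definition nabla_op (i : nat) : operator := nth id (nabla_ops m) i.

Lemma diffop_iter_laplacian k : diffop k.*2 (iter k (@laplacian R N)).
Proof.
elim: k => [|k IH]; first exact: diffop_id.
apply: (@diffop_sum _ _ k.+1.*2 (fun i f => partial i (partial i (iter k laplacian f)))) => i.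
by rewrite doubleS; do 2 apply: diffop_partial.
Qed.

Lemma diffop_nabla (i : 'I_(size (nabla_ops (R := R) (N := N) m))) : diffop m (nabla_op i).
Proof.
rewrite /nabla_op; case: i => i /=; rewrite /nabla_ops.
have := odd_double_half m; case: (odd m) => /= mE.
  rewrite size_map size_enum_ord => iN.
  rewrite (nth_map (Ordinal iN)) ?size_enum_ord// -[X in diffop X]mE.
  apply: diffop_partial; exact: diffop_iter_laplacian.
case: i => [|//] _ /=; rewrite -[X in diffop X]mE add0n; exact: diffop_iter_laplacian.
Qed.

Lemma sum_nabla_ops (F : operator -> R) :
  \sum_(P <- nabla_ops m) F P = \sum_(i < size (nabla_ops (R := R) (N := N) m)) F (nabla_op i).
Proof. by rewrite (big_nth id) big_mkord. Qed.

Lemma derivative_energy_nabla f : test_function f ->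
  derivative_energy m f = \sum_(i < size (nabla_ops (R := R) (N := N) m)) sqn mu (nabla_op i f).
Proof.
move=> tf; rewrite (derivative_energyE _ tf).
exact: (sum_nabla_ops (fun P => sqn mu (P f))).
Qed.

Lemma nabla_energyE u phi : Lp p u -> Dm2_approx u phi ->
  nabla_energy m u = \sum_(i < size (nabla_ops (R := R) (N := N) m))
     sqn mu (weak_diff m (nabla_op i) u).
Proof.
move=> uL uphi; rewrite /nabla_energy.
under eq_Rintegral do rewrite (sum_nabla_ops (fun P => weak_diff m P u _ ^+ 2)).
rewrite (@Rintegral_sum _ _ _ mu _ _ (fun (i : 'I_(size (nabla_ops m))) x =>
  weak_diff m (nabla_op i) u x ^+ 2))// => i.
exact: (diffop_weak_diff (diffop_nabla i) uL uphi).1.2.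
Qed.

Lemma nabla_pairingE u phi v : Lp p u -> Dm2_approx u phi -> test_function v ->
  \int[mu]_x (\sum_(P <- nabla_ops m) weak_diff m P u x * P v x) =
  \sum_(i < size (nabla_ops (R := R) (N := N) m))
     ip mu (weak_diff m (nabla_op i) u) (nabla_op i v).
Proof.
move=> uL uphi tv.
under eq_Rintegral do rewrite (sum_nabla_ops (fun P => weak_diff m P u _ * P v _)).
rewrite (@Rintegral_sum _ _ _ mu _ _ (fun (i : 'I_(size (nabla_ops m))) x =>
  weak_diff m (nabla_op i) u x * nabla_op i v x))// => i.
apply: L2_integM; first exact: (diffop_weak_diff (diffop_nabla i) uL uphi).1.
by apply: ccs_L2; apply: test_ccs; exact: diffop_test (diffop_nabla i) tv.
Qed.

Lemma cvg_seq_sum (I : Type) (s : seq I) (F : nat -> I -> R) (l : I -> R) :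
  (forall i, F k i @[k --> \oo] --> l i) ->
  \sum_(i <- s) F k i @[k --> \oo] --> \sum_(i <- s) l i.
Proof.
move=> Fl; elim: s => [|i s IH].
  rewrite (_ : (fun k => \sum_(i <- [::]) F k i) = fun=> 0); last first.
    by apply/funext => k; rewrite big_nil.
  by rewrite big_nil; exact: cvg_cst.
rewrite (_ : (fun k => \sum_(j <- i :: s) F k j) =
    fun k => F k i + \sum_(j <- s) F k j); last first.
  by apply/funext => k; rewrite big_cons.
by rewrite big_cons; exact: (cvgD (Fl i) IH).
Qed.

(** This makes every identity or inequality between energies of test functions
    available in the completion. *)
Lemma derivative_energy_cvg u phi : Lp p u -> Dm2_approx u phi ->
  derivative_energy m (phi k) @[k --> \oo] --> nabla_energy m u.
Proof.
move=> uL uphi; rewrite (nabla_energyE uL uphi).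
have [tphi _ _] := uphi.
under eq_fun do rewrite (derivative_energy_nabla (tphi _)).
apply: cvg_seq_sum => i; have [wL wc] := diffop_weak_diff (diffop_nabla i) uL uphi.
apply: cvg2_sqn => // k; apply: ccs_L2; apply: test_ccs.
exact: diffop_test (diffop_nabla i) (tphi k).
Qed.

Lemma nabla_energy_ge0 u : 0 <= nabla_energy m u.
Proof. by apply: Rintegral_ge0 => x _; apply: sumr_ge0 => P _; exact: sqr_ge0. Qed.

End Dm2_structure.

(** * Scaling and perturbation in the completion *)

Section Dm2_operations.
Context {R : realType} {N : nat} (m : nat).
Hypothesis hN : (2 * m < N)%N.
Local Notation mu := (@lebesgue_rv R N).
Local Notation p := (crit_exp R N m).
Implicit Types (u v w f g : 'rV[R]_N -> R) (phi : nat -> 'rV[R]_N -> R).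

Let p0 : 0 < p. Proof. exact: crit_exp_gt0. Qed.
Let p1 : 1 <= p. Proof. exact: crit_exp_ge1. Qed.

Lemma Dm2_approx_affine (c r : R) u phi : 0 < r -> Lp p u -> Dm2_approx m u phi ->
  Dm2_approx m (fun x => c * u (r *: x + 0)) (fun k x => c * phi k (r *: x + 0)).
Proof.
move=> r0 uL [tphi cphi uphi].
have tjk j k : test_function (fun x => phi j x - phi k x).
  have := testD (tphi j) (testZ (-1) (tphi k)).
  by congr test_function; apply/funext => x; rewrite mulN1r.
split.
- by move=> k; exact: test_affine.
- move=> e e0; pose A := c ^+ 2 * r ^+ m ^+ 2 * (r ^+ N)^-1.
  have A0 : 0 <= A by rewrite mulr_ge0 ?invr_ge0 ?exprn_ge0 ?(ltW r0)// mulr_ge0// sqr_ge0.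
  have d0 : 0 < e / Num.sqrt (A + 1) by rewrite divr_gt0// sqrtr_gt0 ltr_wpDl.
  have [k0 k0P] := cphi _ d0; exists k0 => j k k0j k0k.
  rewrite (_ : (fun x => _) = fun x => c * (fun y => phi j y - phi k y) (r *: x + 0)); last first.
    by apply/funext => x; rewrite mulrBr.
  have h := k0P _ _ k0j k0k.
  rewrite -(@ltr_pXn2r _ 2)// ?nnegrE ?Dm2_norm_ge0 ?(ltW e0)//.
  rewrite (sqr_Dm2_norm_affine m c 0 r0 (tjk j k)) -/A.
  have : Dm2_norm m (fun x => phi j x - phi k x) ^+ 2 < (e / Num.sqrt (A + 1)) ^+ 2.
    by rewrite ltr_pXn2r// nnegrE ?Dm2_norm_ge0 ?(ltW d0).
  have -> : (e / Num.sqrt (A + 1)) ^+ 2 = e ^+ 2 / (A + 1).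
    by rewrite expr_div_n sqr_sqrtr// addr_ge0.
  rewrite ltr_pdivlMr; last by rewrite ltr_wpDl.
  move=> h2.
  apply: le_lt_trans h2; rewrite mulrC ler_wpM2l ?sqr_ge0// lerDl//.
- have h k : pint p (fun x => c * u (r *: x + 0) - c * phi k (r *: x + 0)) =
     `|c| `^ p * ((r ^+ N)^-1 * pint p (fun x => u x - phi k x)).
    rewrite -(pint_affine c 0 p0 r0); last first.
      by apply: LpB => //; apply: ccs_Lp => //; exact: test_ccs.
    by congr pint; apply/funext => x; rewrite mulrBr.
  have h0 : `|c| `^ p * ((r ^+ N)^-1 * pint p (fun x => u x - phi k x)) @[k --> \oo] -->
      `|c| `^ p * ((r ^+ N)^-1 * 0).
    apply: cvgM; first exact: cvg_cst.
    by apply: cvgM; first exact: cvg_cst.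
  rewrite !mulr0 in h0; apply: cvg_trans h0; apply: near_eq_cvg.
  by apply: nearW => k; rewrite h.
Qed.

Lemma Dm2_scale (c r : R) u : 0 < r -> Dm2 m u -> Dm2 m (fun x => c * u (r *: x)).
Proof.
move=> r0 /(Dm2P hN)[uL [phi uphi]]; apply/(Dm2P hN).
rewrite (_ : (fun x => _) = fun x => c * u (r *: x + 0)); last first.
  by apply/funext => x; rewrite addr0.
split; first exact: Lp_affine.
by exists (fun k x => c * phi k (r *: x + 0)); exact: Dm2_approx_affine.
Qed.

Lemma derivative_energy_affine f (c r : R) a k : 0 < r -> test_function f ->
  derivative_energy k (fun x => c * f (r *: x + a)) =
  c ^+ 2 * r ^+ k ^+ 2 * (r ^+ N)^-1 * derivative_energy k f.
Proof.
move=> r0; elim: k c f => [|k IH] c f tf.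
  have fL := ccs_L2 (test_ccs tf).
  rewrite /= (sqnZ _ (L2_affine a r0 fL)) (sqn_affine a r0 fL).
  by rewrite !expr0 expr1n mulr1 mulrA.
rewrite [in LHS]/= [in RHS]/= mulr_sumr; apply: eq_bigr => i _.
rewrite (partial_affine _ _ _ _ (test_smooth tf)) (IH _ _ (test_partial i tf)).
rewrite (exprSr r k); move: (derivative_energy k _) (_^-1) (r ^+ k) => X Y Z; ring.
Qed.

Lemma nabla_energy_scale (c r : R) u : 0 < r -> Dm2 m u ->
  nabla_energy m (fun x => c * u (r *: x)) =
  c ^+ 2 * r ^+ m ^+ 2 * (r ^+ N)^-1 * nabla_energy m u.
Proof.
move=> r0 /(Dm2P hN)[uL [phi uphi]].
rewrite (_ : (fun x => _) = fun x => c * u (r *: x + 0)); last first.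
  by apply/funext => x; rewrite addr0.
have h1 := derivative_energy_cvg hN (Lp_affine c 0 p0 r0 uL) (Dm2_approx_affine c r0 uL uphi).
have h2 := derivative_energy_cvg hN uL uphi.
have [tphi _ _] := uphi.
have h3 : c ^+ 2 * r ^+ m ^+ 2 * (r ^+ N)^-1 * derivative_energy m (phi k) @[k --> \oo] -->
   c ^+ 2 * r ^+ m ^+ 2 * (r ^+ N)^-1 * nabla_energy m u.
  by apply: cvgM => //; exact: cvg_cst.
apply: (cvg_unique _ h1) => //; apply: cvg_trans h3.
apply: near_eq_cvg; apply: nearW => k.
by rewrite (derivative_energy_affine _ _ _ r0 (tphi k)).
Qed.

(** Modifying a function on a null set keeps its approximating sequence. *)
Lemma ae_Dm2 u v : measurable_fun setT v -> {ae mu, forall x, u x = v x} ->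
  Dm2 m u -> Dm2 m v /\ nabla_energy m v = nabla_energy m u.
Proof.
move=> mv uv /(Dm2P hN)[uL [phi uphi]].
have vL : Lp p v.
  split => //; apply: (ae_integ _ _ uL.2); first exact: measurable_norm_powR.
  by apply: filterS uv => x ->.
have [tphi cphi ucphi] := uphi.
have vphi : Dm2_approx m v phi.
  split; [exact: tphi|exact: cphi|].
  move: ucphi; apply: cvg_trans; apply: near_eq_cvg; apply: nearW => k.
  apply: ae_eq_Rintegral.
  - apply: measurable_norm_powR; apply: measurable_funB; first exact: uL.1.
    by apply: ccs_measurable; exact: test_ccs.
  - by apply: measurable_norm_powR; apply: measurable_funB => //;
      apply: ccs_measurable; exact: test_ccs.
  - by apply: filterS uv => x ->.
split; first by apply/(Dm2P hN); split => //; exists phi.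
have h1 := derivative_energy_cvg hN uL uphi.
have h2 := derivative_energy_cvg hN vL vphi.
exact: (cvg_unique _ h2 h1).
Qed.

(** The energy is quadratic, and the sequence of the [phi k + e v] approximates
    [u + e v]. *)
Lemma Dm2_add_test (e : R) u v : Dm2 m u -> test_function v ->
  Dm2 m (fun x => u x + e * v x) /\
  nabla_energy m (fun x => u x + e * v x) = nabla_energy m u +
    2 * e * \int[mu]_x (\sum_(P <- nabla_ops m) weak_diff m P u x * P v x) +
    e ^+ 2 * derivative_energy m v.
Proof.
move=> /(Dm2P hN)[uL [phi uphi]] tv.
have tev := testZ e tv.
have uvL : Lp p (fun x => u x + e * v x).
  by apply: LpD => //; apply: ccs_Lp => //; exact: test_ccs.
have [tphi cphi ucphi] := uphi.
have uvphi : Dm2_approx m (fun x => u x + e * v x) (fun k x => phi k x + e * v x).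
  split.
  - by move=> k; exact: testD.
  - move=> d d0; have [k0 k0P] := cphi _ d0; exists k0 => j k k0j k0k.
    rewrite (_ : (fun x => _) = fun x => phi j x - phi k x); first exact: k0P.
    by apply/funext => x; rewrite opprD addrACA subrr addr0.
  - move: ucphi; apply: cvg_trans; apply: near_eq_cvg; apply: nearW => k.
    by congr pint; apply/funext => x; rewrite opprD addrACA subrr addr0.
split; first by apply/(Dm2P hN); split => //; eexists; exact: uvphi.
have h1 := derivative_energy_cvg hN uvL uvphi.
apply: (cvg_unique _ h1) => //.
rewrite (nabla_pairingE hN uL uphi tv) (nabla_energyE hN uL uphi).
have h2 : \sum_(i < size (nabla_ops (R := R) (N := N) m))
    (sqn mu (nabla_op m i (phi k)) + 2 * e * ip mu (nabla_op m i (phi k)) (nabla_op m i v) +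
     e ^+ 2 * sqn mu (nabla_op m i v)) @[k --> \oo] -->
  \sum_(i < size (nabla_ops (R := R) (N := N) m))
    (sqn mu (weak_diff m (nabla_op m i) u) +
     2 * e * ip mu (weak_diff m (nabla_op m i) u) (nabla_op m i v) +
     e ^+ 2 * sqn mu (nabla_op m i v)).
  apply: cvg_seq_sum => i; have dP := @diffop_nabla R N m i.
  have [wL wc] := diffop_weak_diff hN dP uL uphi.
  have PL k : L2 mu (nabla_op m i (phi k)).
    by apply: ccs_L2; apply: test_ccs; exact: (diffop_test dP (tphi k)).
  have PvL : L2 mu (nabla_op m i v).
    by apply: ccs_L2; apply: test_ccs; exact: (diffop_test dP tv).
  apply: cvgD; last exact: cvg_cst.
  apply: cvgD; first exact: (cvg2_sqn PL wL wc).
  apply: cvgM; first exact: cvg_cst.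
  exact: (cvg2_ip PL wL PvL wc).
rewrite !big_split in h2.
rewrite -mulr_sumr -mulr_sumr -(derivative_energy_nabla m tv) in h2.
apply: cvg_trans h2; apply: near_eq_cvg; apply: nearW => k.
rewrite (derivative_energy_nabla m (testD (tphi k) tev)); apply: eq_bigr => i _.
have dP := @diffop_nabla R N m i.
rewrite (diffopD dP (test_smooth (tphi k)) (test_smooth tev)) (diffopZ _ dP (test_smooth tv)).
have PL f : test_function f -> L2 mu (nabla_op m i f).
  by move=> tf; apply: ccs_L2; apply: test_ccs; exact: (diffop_test dP tf).
symmetry; exact: (sqnD_scale e (PL _ (tphi k)) (PL _ tv)).
Qed.

End Dm2_operations.

(** * Finite differences of order m *)

Section finite_differences.
Context {R : realType} {N : nat}.
Local Notation mu := (@lebesgue_rv R N).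
Implicit Types (h : 'rV[R]_N) (u v w f g : 'rV[R]_N -> R) (phi : nat -> 'rV[R]_N -> R).

Definition fdiff h f : 'rV[R]_N -> R := fun x => f (x + h) - f x.

Lemma iter_fdiffB h k f g :
  iter k (fdiff h) (fun x => f x - g x) = fun x => iter k (fdiff h) f x - iter k (fdiff h) g x.
Proof.
by elim: k => //= k ->; apply/funext => x; rewrite /fdiff; ring.
Qed.

Lemma test_iter_fdiff h k f : test_function f -> test_function (iter k (fdiff h) f).
Proof.
move=> tf; elim: k => [|k IH]; first exact: tf.
have := testD (test_shift h IH) (testZ (-1) IH).
by congr test_function; apply/funext => x; rewrite mulN1r.
Qed.

Lemma partial_iter_fdiff h k i f : test_function f ->
  partial i (iter k (fdiff h) f) = iter k (fdiff h) (partial i f).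
Proof.
move=> tf; elim: k => // k IH; rewrite [in RHS]iterS -IH iterS.
have tk := test_iter_fdiff h k tf; have sk := test_smooth tk.
rewrite (_ : fdiff h _ = fun x => iter k (fdiff h) f (x + h) + (-1) * iter k (fdiff h) f x).
  rewrite (partialD _ (test_smooth (test_shift h tk)) (test_smooth (testZ (-1) tk))).
  rewrite (partialZ _ _ sk) (partial_shift h _ sk); apply/funext => x.
  by rewrite mulN1r.
by apply/funext => x; rewrite mulN1r.
Qed.

(** The coefficients are signed binomials, built here by Pascal's recursion. *)
Lemma iter_fdiffE k : exists c : nat -> R, c 0 = (-1) ^+ k /\
  forall h f x, iter k (fdiff h) f x = \sum_(j < k.+1) c j * f (x + j%:R *: h).
Proof.
elim: k => [|k [c [c0 cE]]].
  exists (fun=> 1); split=> // h f x.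
  by rewrite big_ord_recl big_ord0 /= mul1r scale0r !addr0.
exists (fun j => (if j is i.+1 then c i else 0) - (if (j <= k)%N then c j else 0)); split.
  by rewrite /= c0 sub0r exprS mulN1r.
move=> h f x; rewrite iterS {1}/fdiff !cE.
under [RHS]eq_bigr do rewrite mulrBl.
rewrite big_split/= sumrN; congr (_ - _).
  rewrite [RHS]big_ord_recl/= mul0r add0r; apply: eq_bigr => j _.
  rewrite add0n -addrA; congr (_ * f (_ + _)).
  have -> : (fintype.bump 0 j)%:R = 1 + j%:R :> R by rewrite -(natrD _ 1 j).
  by rewrite scalerDl scale1r.
rewrite [RHS]big_ord_recr/= ltnn mul0r addr0; apply: eq_bigr => j _.
by rewrite -ltnS ltn_ord.
Qed.

(** Each difference costs a factor [N t ^+ 2] and one derivative, and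
    differences commute with derivatives. *)
Lemma sqn_iter_fdiff_test h (t : R) k f : (forall i, `|h 0 i| <= t) -> test_function f ->
  sqn mu (iter k (fdiff h) f) <= (N%:R * t ^+ 2) ^+ k * derivative_energy k f.
Proof.
move=> ht; elim: k f => [|k IH] f tf; first by rewrite mul1r.
apply: le_trans (sqn_shift_le ht (test_iter_fdiff h k tf)) _.
rewrite (exprS (N%:R * t ^+ 2)) -(mulrA (N%:R * t ^+ 2)).
apply: ler_wpM2l; first by rewrite mulr_ge0 ?sqr_ge0.
change (\sum_(i < N) sqn mu (partial i (iter k (fdiff h) f)) <=
  (N%:R * t ^+ 2) ^+ k * \sum_(i < N) derivative_energy k (partial i f)).
rewrite mulr_sumr.
apply: ler_sum => i _; rewrite (partial_iter_fdiff _ _ _ tf).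
exact: IH (test_partial i tf).
Qed.

Variables (m : nat).
Hypothesis hN : (2 * m < N)%N.
Local Notation p := (crit_exp R N m).

Let p0 : 0 < p. Proof. exact: crit_exp_gt0. Qed.
Let p1 : 1 <= p. Proof. exact: crit_exp_ge1. Qed.

Lemma Lp_shift h f : Lp p f -> Lp p (fun x => f (x + h)).
Proof.
move=> /(Lp_affine 1 h p0 ltr01); congr Lp.
by apply/funext => x; rewrite mul1r scale1r.
Qed.

Lemma Lp_iter_fdiff h k f : Lp p f -> Lp p (iter k (fdiff h) f).
Proof.
move=> fL; elim: k => // k IH; rewrite iterS.
by apply: LpB p0 _ _; [exact: Lp_shift|].
Qed.

Lemma pint_fdiff_le h f : Lp p f -> pint p (fdiff h f) <= 2 `^ p * (2 * pint p f).
Proof.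
move=> fL; have sL := Lp_shift h fL.
have -> : 2 * pint p f = pint p (fun x => f (x + h)) + pint p f.
  have := pint_affine 1 h p0 ltr01 fL; rewrite normr1 powR1 expr1n invr1 !mul1r.
  under [pint p (fun x => 1 * _)]eq_Rintegral do rewrite mul1r scale1r.
  by rewrite -/(pint p (fun x => f (x + h))) => ->; rewrite mulr_natl mulr2n.
rewrite /pint -RintegralD//; [|exact: sL.2|exact: fL.2].
rewrite -RintegralZl//; last exact: (integD sL.2 fL.2).
apply: le_Rintegral => //.
- exact: (LpB p0 sL fL).2.
- exact: (integZ _ (integD sL.2 fL.2)).
move=> x _; have := ler_normB (f (x + h)) (f x); rewrite /fdiff.
set a := `|f (x + h)|; set b := `|f x| => ab.
have a0 : 0 <= a by exact: normr_ge0.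
have b0 : 0 <= b by exact: normr_ge0.
have h1 : `|f (x + h) - f x| <= 2 * Num.max a b.
  apply: le_trans ab _; rewrite mulr_natl mulr2n; apply: lerD; rewrite le_max lexx ?orbT//.
apply: le_trans (powR_ler p0 (normr_ge0 _) h1) _.
rewrite powRM ?le_max ?a0//; apply: ler_wpM2l; first exact: powR_ge0.
by case: (leP a b) => _; rewrite ?lerDl ?lerDr powR_ge0.
Qed.

Lemma pint_iter_fdiff_cvg h k (F : nat -> 'rV[R]_N -> R) : (forall j, Lp p (F j)) ->
  pint p (F j) @[j --> \oo] --> 0 -> pint p (iter k (fdiff h) (F j)) @[j --> \oo] --> 0.
Proof.
move=> FL F0; elim: k => [|k IH]; first exact: F0.
have c : 2 `^ p * (2 * pint p (iter k (fdiff h) (F j))) @[j --> \oo] --> 2 `^ p * (2 * 0).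
  apply: cvgM; first exact: cvg_cst.
  by apply: cvgM; first exact: cvg_cst.
rewrite !mulr0 in c.
apply: (squeeze_cvgr _ (cvg_cst 0) c); apply: nearW => j; rewrite pint_ge0/=.
by apply: pint_fdiff_le; exact: Lp_iter_fdiff.
Qed.

(** The differences of the approximations converge in mean square, and also to
    the difference of [u] in the sense of distributions; the two limits agree. *)
Lemma sqn_iter_fdiff h (t : R) u : (forall i, `|h 0 i| <= t) -> Dm2 m u ->
  L2 mu (iter m (fdiff h) u) /\
  sqn mu (iter m (fdiff h) u) <= (N%:R * t ^+ 2) ^+ m * nabla_energy m u.
Proof.
move=> ht /(Dm2P hN)[uL [phi uphi]]; have [tphi cphi ucphi] := uphi.
have tD k := test_iter_fdiff h m (tphi k).
have DL k : L2 mu (iter m (fdiff h) (phi k)) by apply: ccs_L2; exact: test_ccs.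
pose K := (N%:R * t ^+ 2) ^+ m * N%:R ^+ m.
have K0 : 0 <= K by rewrite mulr_ge0 ?exprn_ge0// mulr_ge0// sqr_ge0.
have [W WL DW] : exists2 W, L2 mu W & cvg2 mu (fun k => iter m (fdiff h) (phi k)) W.
  apply: L2_complete => [//|e e0].
  have d0 : 0 < Num.sqrt (e / (K + 1)) by rewrite sqrtr_gt0 divr_gt0// ltr_wpDl.
  have [k0 k0P] := cphi _ d0; exists k0 => j k k0j k0k.
  have tjk : test_function (fun x => phi j x - phi k x).
    have := testD (tphi j) (testZ (-1) (tphi k)).
    by congr test_function; apply/funext => x; rewrite mulN1r.
  rewrite -(iter_fdiffB h m (phi j) (phi k)).
  apply: le_lt_trans (sqn_iter_fdiff_test m ht tjk) _.
  apply: (@le_lt_trans _ _ (K * Dm2_norm m (fun x => phi j x - phi k x) ^+ 2)).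
    rewrite -mulrA; apply: ler_wpM2l; last exact: derivative_energy_le.
    by rewrite exprn_ge0// mulr_ge0 ?sqr_ge0.
  have hD : Dm2_norm m (fun x => phi j x - phi k x) ^+ 2 < e / (K + 1).
    rewrite -[ltRHS]sqr_sqrtr; last by rewrite divr_ge0 ?(ltW e0) ?addr_ge0.
    by rewrite ltr_pXn2r// ?nnegrE ?Dm2_norm_ge0 ?sqrtr_ge0//; exact: k0P.
  apply: (@le_lt_trans _ _ ((K + 1) * Dm2_norm m (fun x => phi j x - phi k x) ^+ 2)).
    by rewrite ler_wpM2r ?sqr_ge0// lerDl.
  by rewrite -ltr_pdivlMl ?ltr_wpDl// mulrC.
have DuL := Lp_iter_fdiff h m uL.
have mphiL k : Lp p (phi k) by apply: ccs_Lp => //; exact: test_ccs.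
have uW : {ae mu, forall x, iter m (fdiff h) u x = W x}.
  have wl : loc_integrable (fun x => iter m (fdiff h) u x - W x).
    by apply: loc_integrableB; [exact: Lp_loc_integrable DuL|exact: L2_loc_integrable].
  suff : {ae mu, forall x, iter m (fdiff h) u x - W x = 0}.
    by apply: filterS => x /eqP; rewrite subr_eq0 => /eqP.
  apply: du_bois_reymond wl _ => psi tpsi; have cpsi := test_ccs tpsi.
  under eq_Rintegral do rewrite mulrBl.
  rewrite RintegralB//; last 2 first.
  - exact: Lp_ccs_integ p1 DuL cpsi.
  - exact: loc_integ_ccs (L2_loc_integrable WL) cpsi.
  apply/eqP; rewrite subr_eq0; apply/eqP.
  have c1 := cvg2_ip DL WL (ccs_L2 cpsi) DW.
  apply: (cvg_unique _ _ c1) => //.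
  apply: (pint_cvg_pairing p1 _ DuL cpsi) => [k|].
    by apply: Lp_iter_fdiff; exact: mphiL.
  under eq_fun do rewrite -(iter_fdiffB h m u).
  by apply: pint_iter_fdiff_cvg => // k; apply: LpB.
have uL2 : L2 mu (iter m (fdiff h) u).
  split; first exact: DuL.1.
  apply: (ae_integ _ _ WL.2); first by apply: measurable_funX; exact: DuL.1.
  by apply: filterS uW => x ->.
split => //.
have -> : sqn mu (iter m (fdiff h) u) = sqn mu W.
  apply: ae_eq_Rintegral.
  - by apply: measurable_funX; exact: DuL.1.
  - by apply: measurable_funX; exact: WL.1.
  - by apply: filterS uW => x ->.
have c1 := cvg2_sqn DL WL DW.
have c2 : (N%:R * t ^+ 2) ^+ m * derivative_energy m (phi k) @[k --> \oo] -->
    (N%:R * t ^+ 2) ^+ m * nabla_energy m u.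
  have hc := derivative_energy_cvg hN uL uphi.
  apply: (cvgM _ hc); exact: cvg_cst.
apply: (ler_cvg_to c1 c2); apply: nearW => k; exact: sqn_iter_fdiff_test.
Qed.

End finite_differences.

(** * Energy bound for the mass of large values *)

Section cube_averages.
Context {R : realType} {N : nat}.
Local Notation mu := (@lebesgue_rv R N).
Implicit Types (h x : 'rV[R]_N) (u v w f g : 'rV[R]_N -> R).

Let L2_dilate k x u : (0 < k)%N -> L2 mu u -> L2 mu (fun h => u (x + k%:R *: h)).
Proof.
move=> k0 uL; have k0' : 0 < k%:R :> R by rewrite ltr0n.
by have := L2_affine x k0' uL; under eq_fun do rewrite addrC.
Qed.

Let sqn_dilate k x u : (0 < k)%N -> L2 mu u ->
  \int[mu]_h (u (x + k%:R *: h) ^+ 2) <= sqn mu u.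
Proof.
move=> k0 uL; have k0' : 0 < k%:R :> R by rewrite ltr0n.
have := sqn_affine x k0' uL; rewrite /sqn; under eq_Rintegral do rewrite addrC.
move=> ->; rewrite ler_piMl// ?sqn_ge0// invf_le1 ?exprn_gt0//.
by rewrite exprn_ege1// ler1n.
Qed.

Let cube_measure (t : R) : 0 <= t -> lebesgue_rv N (rv_cube 0 t) = (t ^+ N)%:E.
Proof. by move=> t0; rewrite lebesgue_rv_cube// subr0. Qed.

Let integ_indic_cube (t : R) : 0 <= t -> integ mu (fun h => \1_(rv_cube 0 t) h).
Proof.
move=> t0; apply: integ_indic; first exact: measurable_rv_cube.
suff : (lebesgue_rv N (rv_cube 0 t) < +oo)%E by [].
by rewrite cube_measure// ltry.
Qed.

Let integral_indic_cube (t : R) : 0 <= t -> \int[mu]_h \1_(rv_cube 0 t) h = t ^+ N.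
Proof.
move=> t0; rewrite /Rintegral integral_indic//; last exact: measurable_rv_cube.
rewrite setIT; suff : fine (lebesgue_rv N (rv_cube 0 t)) = t ^+ N by [].
by rewrite cube_measure.
Qed.

Let L2_indic_cst (t c : R) : 0 <= t -> L2 mu (fun h => \1_(rv_cube 0 t) h * c).
Proof.
move=> t0; have mt : measurable (rv_cube 0 t : set 'rV[R]_N) by exact: measurable_rv_cube.
split; first by apply: measurable_funM => //; exact: measurable_indic.
have ti := integ_indic_cube t0.
apply: (le_integ _ (integZ (c ^+ 2) ti)).
  by apply: measurable_funX; apply: measurable_funM => //; exact: measurable_indic.
move=> h; rewrite ger0_norm ?sqr_ge0// exprMn mulrC indicE.
by case: (h \in _); rewrite ?expr1n// expr0n.
Qed.

Lemma L2_indic_comb (c : nat -> R) n t u x : 0 <= t -> L2 mu u ->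
  L2 mu (fun h => \1_(rv_cube 0 t) h * \sum_(k < n.+1) c k * u (x + k%:R *: h)).
Proof.
move=> t0 uL; have mt : measurable (rv_cube 0 t : set 'rV[R]_N) by exact: measurable_rv_cube.
rewrite (_ : (fun h => _) = fun h => \1_(rv_cube 0 t) h * (c 0 * u x) +
    \sum_(k < n) c k.+1 * (\1_(rv_cube 0 t) h * u (x + k.+1%:R *: h))); last first.
  apply/funext => h; rewrite big_ord_recl/= scale0r addr0 mulrDr; congr (_ + _).
  rewrite mulr_sumr; apply: eq_bigr => k _.
  by rewrite mulrCA.
apply: L2D; first exact: L2_indic_cst.
apply: L2_sum => k; apply: L2Z.
have kL := @L2_dilate k.+1 x u isT uL.
split; first by apply: measurable_funM; [exact: measurable_indic|exact: kL.1].
apply: (le_integ _ kL.2).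
  by apply: measurable_funX; apply: measurable_funM; [exact: measurable_indic|exact: kL.1].
move=> h; rewrite ger0_norm ?sqr_ge0// exprMn indicE.
by case: (h \in _); rewrite ?expr1n ?mul1r// expr0n mul0r sqr_ge0.
Qed.

(** For [|u x| > 2 s] solve the expansion of the difference for [u x], multiply
    by [|u x|] and integrate over the steps [h] in the cube of side [t].  The translates
    of [u] contribute at most [sqn u] each, whatever [x] is, and the condition on [t]
    lets this be absorbed by the left hand side. *)
Lemma cube_average_ge (c : nat -> R) n (C s t : R) u x :
  `|c 0| = 1 -> \sum_(k < n) `|c k.+1| <= C -> 0 < C -> 0 < s -> 0 < t -> L2 mu u ->
  2 * s < `|u x| -> C ^+ 2 * sqn mu u <= s ^+ 2 * t ^+ N ->
  t ^+ N * u x ^+ 2 / 4 <=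
  \int[mu]_h ((\1_(rv_cube 0 t) h * \sum_(k < n.+1) c k * u (x + k%:R *: h)) ^+ 2).
Proof.
move=> c0 cC C0 s0 t0 uL us CL.
have mt : measurable (rv_cube 0 t : set 'rV[R]_N) by exact: measurable_rv_cube.
have ti := integ_indic_cube (ltW t0).
pose g (k : 'I_n) h := u (x + k.+1%:R *: h) ^+ 2.
have gi k : integ mu (g k) by exact: (@L2_dilate k.+1 x u isT uL).2.
have gs : integ mu (fun h => \sum_(k < n) `|c k.+1| * g k h).
  by apply: integ_sum => k; exact: integZ.
have AL := @L2_indic_comb c n t u x (ltW t0) uL.
set A := fun h => (_ * _) ^+ 2 in AL *.
have Ai : integ mu A := AL.2.
pose B := `|u x| * (C / (2 * s)).
have B0 : 0 <= B by rewrite mulr_ge0// divr_ge0 ?mulr_ge0 ?ltW.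
have main : \int[mu]_h (u x ^+ 2 / 2 * \1_(rv_cube 0 t) h) <=
    \int[mu]_h (A h + B * \sum_(k < n) `|c k.+1| * g k h).
  apply: le_Rintegral => //; first exact: integZ.
    by apply: integD => //; exact: integZ.
  move=> h _; rewrite /A indicE; have [ht|ht] := boolP (h \in _); last first.
    rewrite mulr0 addr_ge0 ?sqr_ge0// mulr_ge0// sumr_ge0// => k _.
    by rewrite mulr_ge0// sqr_ge0.
  rewrite mulr1 mul1r; set a := \sum_(k < n.+1) _.
  have ua : `|u x| <= `|a| + \sum_(k < n) `|c k.+1| * `|u (x + k.+1%:R *: h)|.
    have -> : `|u x| = `|c 0 * u (x + 0%:R *: h)|.
      by rewrite normrM c0 mul1r scale0r addr0.
    have -> : c 0 * u (x + 0%:R *: h) = a - \sum_(k < n) c k.+1 * u (x + k.+1%:R *: h).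
      by rewrite /a big_ord_recl/= addrK.
    apply: le_trans (ler_normB _ _) _; rewrite lerD2l.
    apply: le_trans (ler_norm_sum _ _ _) _; apply: ler_sum => k _.
    by rewrite normrM.
  have us2 : \sum_(k < n) `|c k.+1| * `|u (x + k.+1%:R *: h)| <=
      C / (2 * s) * (\sum_(k < n) `|c k.+1| * g k h) + s / 2.
    apply: (@le_trans _ _ (\sum_(k < n) (C / (2 * s) * (`|c k.+1| * g k h) +
      `|c k.+1| * (s / (2 * C))))).
      apply: ler_sum => k _; rewrite mulrCA -mulrDr ler_wpM2l// /g.
      rewrite -(real_normK (num_real (u _))); set y := `|u _|.
      have h1 : 0 <= (C * y - s) ^+ 2 by exact: sqr_ge0.
      rewrite -subr_ge0 (_ : _ - y = (C * y - s) ^+ 2 / (2 * s * C)).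
        by rewrite divr_ge0// ?mulr_ge0 ?ltW.
      by field; rewrite !gt_eqF.
    rewrite big_split/= -mulr_sumr lerD2l -mulr_suml.
    apply: (@le_trans _ _ (C * (s / (2 * C)))).
      by rewrite ler_wpM2r// divr_ge0 ?mulr_ge0 ?ltW.
    by rewrite le_eqVlt; apply/orP; left; apply/eqP; field; rewrite gt_eqF.
  set S := \sum_(k < n) `|c k.+1| * g k h in us2 *.
  rewrite /B -(real_normK (num_real (u x))) -(real_normK (num_real a)).
  move: ua us2 us (normr_ge0 (u x)) (normr_ge0 a).
  move: (\sum_(k < n) _) => X.
  rewrite -[_ * _ * S]mulrA; move: (C / (2 * s) * S) => Y.
  move: `|u x| `|a| => v b h1 h2 h3 v0 b0.
  have h4 : 0 <= v * (b + Y + s / 2 - v) by rewrite mulr_ge0//; lra.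
  have h5 : 0 <= v * (v - 2 * s) by rewrite mulr_ge0//; lra.
  have h6 : 0 <= (v / 2 - b) ^+ 2 by exact: sqr_ge0.
  rewrite -subr_ge0 (_ : _ - _ = (v / 2 - b) ^+ 2 + v * (b + Y + s / 2 - v) +
    v * (v - 2 * s) / 4); last by field.
  by rewrite !addr_ge0// divr_ge0.
rewrite RintegralZl// (integral_indic_cube (ltW t0)) in main.
rewrite RintegralD// in main; last exact: integZ.
rewrite RintegralZl// Rintegral_sum in main; last by move=> k; exact: integZ.
have sum_le : \sum_(k < n) \int[mu]_h (`|c k.+1| * g k h) <= C * sqn mu u.
  apply: (@le_trans _ _ (\sum_(k < n) `|c k.+1| * sqn mu u)).
    apply: ler_sum => k _.
    have -> : \int[mu]_h (`|c k.+1| * g k h) = `|c k.+1| * \int[mu]_h g k h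
      by apply: RintegralZl => //; exact: gi.
    apply: ler_wpM2l => //.
    exact: (@sqn_dilate k.+1 x u isT uL).
  by rewrite -mulr_suml ler_wpM2r// sqn_ge0.
have BC : B * (C * sqn mu u) <= t ^+ N * u x ^+ 2 / 4.
  apply: (@le_trans _ _ (`|u x| * (s * t ^+ N / 2))).
    rewrite /B -mulrA ler_wpM2l//.
    have -> : C / (2 * s) * (C * sqn mu u) = C ^+ 2 * sqn mu u / (2 * s).
      by field; rewrite gt_eqF.
    rewrite ler_pdivrMr ?mulr_gt0//.
    by have -> : s * t ^+ N / 2 * (2 * s) = s ^+ 2 * t ^+ N by field.
  rewrite -(real_normK (num_real (u x))).
  have : 0 <= t ^+ N by rewrite exprn_ge0 ?ltW.
  move: (t ^+ N) `|u x| us (normr_ge0 (u x)) => T y us y0 T0.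
  have h1 : 0 <= T * y * (y - 2 * s) by rewrite mulr_ge0 ?mulr_ge0// subr_ge0 ltW.
  rewrite -subr_ge0 (_ : _ - _ = T * y * (y - 2 * s) / 4); first by rewrite divr_ge0.
  by field.
have BS := ler_wpM2l B0 sum_le.
move: main BS BC.
by move: (u x ^+ 2) (t ^+ N) (\int[mu]_x A x) => v T I; lra.
Qed.

Lemma measurable_dilation_sum (c : nat -> R) n t u : measurable_fun setT u ->
  measurable_fun setT (fun p : 'rV[R]_N * 'rV[R]_N =>
    (\1_(rv_cube 0 t) p.2 * \sum_(k < n.+1) c k * u (p.1 + k%:R *: p.2)) ^+ 2).
Proof.
move=> mu'; apply: measurable_funX; apply: measurable_funM.
  apply: (@measurableT_comp _ _ _ _ _ _ (\1_(rv_cube 0 t) : 'rV[R]_N -> R) _ snd).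
    by apply: measurable_indic; exact: measurable_rv_cube.
  exact: measurable_snd.
apply: measurable_sum => k; apply: measurable_funM => //.
apply: (measurableT_comp mu'); apply: measurable_fun_rv => i.
rewrite (_ : (fun _ => _) = fun p : 'rV[R]_N * 'rV[R]_N => rv_coord i p.1 + k%:R * rv_coord i p.2).
  apply: measurable_funD; first exact: measurableT_comp (measurable_rv_coord i) measurable_fst.
  apply: measurable_funM => //; exact: measurableT_comp (measurable_rv_coord i) measurable_snd.
by apply/funext => p; rewrite !mxE.
Qed.

Variables (m : nat).
Hypothesis hN : (2 * m < N)%N.

(** By Tonelli the lower bound of [cube_average_ge], integrated over the points
    with large values, is at most the average over [h] of the squared norm of the
    difference of order [m]. *)
Lemma large_values_energy : exists2 C : R, 0 < C & forall u (s t : R),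
  Dm2 m u -> L2 mu u -> 0 < s -> 0 < t -> C ^+ 2 * sqn mu u <= s ^+ 2 * t ^+ N ->
  \int[mu]_x (\1_[set x | 2 * s < `|u x|] x * u x ^+ 2) <=
  4 * (N%:R * t ^+ 2) ^+ m * nabla_energy m u.
Proof.
have [c [c0 cE]] := @iter_fdiffE R N m.
(* adding one keeps the constant positive *)
exists (\sum_(k < m) `|c k.+1| + 1); first by rewrite ltr_wpDl// sumr_ge0.
set C := (_ + _) => u s t uD uL s0 t0 Cst; have mU := uL.1.
have T0 : 0 < t ^+ N by rewrite exprn_gt0.
pose F (p : 'rV[R]_N * 'rV[R]_N) :=
  (\1_(rv_cube 0 t) p.2 * \sum_(k < m.+1) c k * u (p.1 + k%:R *: p.2)) ^+ 2.
have mF : measurable_fun setT F by exact: measurable_dilation_sum.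
have F0 p : 0 <= F p by exact: sqr_ge0.
have mS : measurable [set x | 2 * s < `|u x|].
  rewrite (_ : [set x | _] = setT `&` (fun x => `|u x|) @^-1` `]2 * s, +oo[%classic).
    by apply: (measurableT_comp _ mU) => //; exact: measurable_itv.
  by rewrite setTI; apply/seteqP; split => x /=; rewrite in_itv/= andbT.
have gi : integ mu (fun x => \1_[set x | 2 * s < `|u x|] x * u x ^+ 2).
  apply: (le_integ _ uL.2).
    by apply: measurable_funM; [exact: measurable_indic|exact: measurable_funX].
  move=> x; rewrite indicE; case: (x \in _); rewrite ?mul1r ?mul0r ?normr0 ?sqr_ge0//.
  by rewrite ger0_norm// sqr_ge0.
have h1 : (\int[mu]_x (t ^+ N / 4 * (\1_[set x | 2 * s < `|u x|] x * u x ^+ 2))%:E <=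
    \int[mu]_x \int[mu]_h (F (x, h))%:E)%E.
  apply: ge0_le_integral => //.
  - move=> x _; rewrite lee_fin mulr_ge0 ?divr_ge0 ?(ltW T0)//.
    by rewrite mulr_ge0 ?sqr_ge0// indicE.
  - apply/measurable_EFinP; apply: measurable_funM => //.
    by apply: measurable_funM; [exact: measurable_indic|exact: measurable_funX].
  - apply: (@measurable_fun_fubini_tonelli_F _ _ _ _ _ (lebesgue_rv N) (EFin \o F)).
      exact/measurable_EFinP.
    by move=> p; rewrite lee_fin.
  move=> x _; rewrite indicE; have [xs|xs] := boolP (x \in _); last first.
    rewrite mul0r mulr0; apply: integral_ge0 => h _; by rewrite lee_fin.
  have FL := L2_indic_comb c m x (ltW t0) uL.
  rewrite -(EFin_Rintegral FL.2) lee_fin mul1r mulrAC.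
  apply: (@cube_average_ge c m C s t u x) => //.
  - by rewrite c0 normrX normrN1 expr1n.
  - by rewrite lerDl.
  - by rewrite ltr_wpDl// sumr_ge0.
  - by move: xs; rewrite inE.
pose K := (N%:R * t ^+ 2) ^+ m * nabla_energy m u.
have h2 : (\int[mu]_x \int[mu]_h (F (x, h))%:E <= (t ^+ N * K)%:E)%E.
  rewrite (@fubini_tonelli _ _ _ _ _ (lebesgue_rv N) (lebesgue_rv N) (EFin \o F))//; last exact/measurable_EFinP.
  rewrite -(integral_indic_cube (ltW t0)) mulrC -RintegralZl//; last exact: integ_indic_cube (ltW t0).
  rewrite EFin_Rintegral; last by apply: integZ; exact: integ_indic_cube (ltW t0).
  apply: ge0_le_integral => //.
  - by move=> h _; apply: integral_ge0 => x _; rewrite lee_fin.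
  - apply: (@measurable_fun_fubini_tonelli_G _ _ _ _ _ (lebesgue_rv N) (EFin \o F)).
      exact/measurable_EFinP.
    by move=> p; rewrite lee_fin.
  - by apply/measurable_EFinP; apply: measurable_funM => //; apply: measurable_indic; exact: measurable_rv_cube.
  move=> h _; rewrite /F /= indicE; have [ht|ht] := boolP (h \in _); last first.
    rewrite mulr0; under eq_integral do rewrite mul0r expr0n/=.
    by rewrite integral0.
  have hle i : `|h 0 i| <= t.
    by move: ht; rewrite inE => /(_ i); rewrite /= in_itv/= => /andP[h0 ?]; rewrite ger0_norm.
  have [DL De] := sqn_iter_fdiff hN hle uD.
  under eq_integral do rewrite mul1r -cE.
  by rewrite -(EFin_Rintegral DL.2) lee_fin mulr1.
have := le_trans h1 h2; rewrite -EFin_Rintegral; last exact: integZ.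
rewrite RintegralZl// lee_fin /K => h3.
rewrite -(ler_pM2l T0); move: h3; move: (\int[mu]_x _) ((_ * _) ^+ m) (nabla_energy m u) (t ^+ N).
by move=> a b e T; lra.
Qed.

End cube_averages.

(** * Energy bound for the logarithmic integral *)

Section logarithmic_bound.
Context {R : realType} {N : nat}.
Local Notation mu := (@lebesgue_rv R N).
Implicit Types (u v w f g : 'rV[R]_N -> R).

(** Consecutive levels [e^j] are one unit apart on the logarithmic scale. *)
Lemma ln_le_count (y : R) n : 0 < y -> y <= expR n%:R ->
  ln y <= \sum_(0 <= j < n) (expR j%:R < y)%R%:R.
Proof.
move=> y0; elim: n => [|n IH] yn.
  by rewrite big_geq//; rewrite expR0 in yn; exact: ln_le0.
rewrite big_nat_recr//=; have [yn'|yn'] := leP y (expR n%:R).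
  by rewrite addr0 IH.
have -> : \sum_(0 <= j < n) (expR j%:R < y)%R%:R = n%:R :> R.
  rewrite big_mkord (eq_bigr (fun=> 1)); first by rewrite sumr_const card_ord.
  move=> j _; rewrite (le_lt_trans _ yn')// ler_expR ler_nat ltnW//; exact: ltn_ord.
rewrite natr1 -[leRHS]expRK ler_ln ?posrE ?expR_gt0//.
Qed.

Lemma measurable_Glog : measurable_fun setT (@Glog R).
Proof.
apply: measurable_funM; first exact: measurable_funX.
by apply: (measurableT_comp (@measurable_ln R)); exact: normr_measurable.
Qed.

Variables (m : nat).
Hypothesis m0 : (0 < m)%N.
Hypothesis hN : (2 * m < N)%N.
Local Notation a := (2 * m%:R / N%:R : R).

(** Apply the bound on large values at the levels [S e^j]: the admissible side
    of the cube decreases geometrically in [j], and the bounds sum up. *)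
Lemma positive_log_energy : exists2 K : R, 0 < K & forall u (S : R),
  Dm2 m u -> L2 mu u -> 0 < sqn mu u -> 0 < S ->
  (\int[mu]_x (Num.max 0 (u x ^+ 2 * ln (`|u x| / S)))%:E <=
   (K * (sqn mu u / S ^+ 2) `^ a * nabla_energy m u)%:E)%E.
Proof.
have [C C0 large] := @large_values_energy R N m hN.
have N0 : 0 < N%:R :> R by rewrite ltr0n (leq_ltn_trans _ hN).
have a0 : 0 < a by rewrite divr_gt0// mulr_gt0// ltr0n.
pose th : R := expR (-2) `^ a.
have th0 : 0 < th by rewrite powR_gt0 ?expR_gt0.
have th1 : th < 1.
  have -> : 1 = 1 `^ a :> R by rewrite powR1.
  have e1 : expR (-2) < 1 :> R by rewrite -[ltRHS]expR0 ltr_expR oppr_lt0.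
  by rewrite /th gt0_ltr_powR ?nnegrE ?expR_ge0.
pose K0 : R := 4 * N%:R ^+ m * (4 * C ^+ 2) `^ a.
have K00 : 0 < K0 by rewrite mulr_gt0 ?powR_gt0 ?mulr_gt0 ?exprn_gt0.
exists (K0 / (1 - th)); first by rewrite divr_gt0// subr_gt0.
move=> u S uD uL L0 S0; set L := sqn mu u in L0 *.
pose I j x : R := \1_[set x | S * expR j%:R < `|u x|] x * u x ^+ 2.
pose Q := (L / S ^+ 2) `^ a * nabla_energy m u.
have Q0 : 0 <= Q by rewrite mulr_ge0 ?powR_ge0 ?nabla_energy_ge0.
have mS j : measurable [set x | S * expR j%:R < `|u x|].
  rewrite (_ : [set x | _] = setT `&` (fun x => `|u x|) @^-1` `]S * expR j%:R, +oo[%classic).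
    by apply: (measurableT_comp _ uL.1) => //; exact: measurable_itv.
  by rewrite setTI; apply/seteqP; split => x /=; rewrite in_itv/= andbT.
have mI j : measurable_fun setT (I j).
  by apply: measurable_funM; [exact: measurable_indic|apply: measurable_funX; exact: uL.1].
have Ii j : integ mu (I j).
  apply: (le_integ (mI j) uL.2) => x; rewrite /I indicE.
  by case: (x \in _); rewrite ?mul1r ?mul0r ?normr0 ?sqr_ge0// ger0_norm// sqr_ge0.
have I0 j x : 0 <= I j x by rewrite mulr_ge0 ?sqr_ge0// indicE.
have IK j : \int[mu]_x I j x <= K0 * Q * th ^+ j.
  (* [t ^+ N = b] gives equality in the size condition at the level [S e^j] *)
  pose b := 4 * C ^+ 2 * (L / S ^+ 2) * expR (-2) ^+ j.
  have b0 : 0 < b by rewrite !mulr_gt0 ?exprn_gt0 ?expR_gt0 ?invr_gt0 ?exprn_gt0.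
  pose t := b `^ (N%:R^-1).
  have tN : t ^+ N = b.
    rewrite -powR_mulrn ?powR_ge0// -powRrM mulVf ?gt_eqF// powRr1//.
    exact: ltW.
  have t2m : (t ^+ 2) ^+ m = (4 * C ^+ 2) `^ a * (L / S ^+ 2) `^ a * th ^+ j.
    have -> : (t ^+ 2) ^+ m = b `^ a.
      rewrite -exprM -powR_mulrn ?powR_ge0// -powRrM natrM; congr (_ `^ _).
      by rewrite mulrC.
    have -> : th ^+ j = (expR (-2) ^+ j) `^ a.
      by rewrite -powR_mulrn ?powR_ge0// powRAC powR_mulrn ?expR_ge0.
    have q1 : 0 <= 4 * C ^+ 2 by rewrite mulr_ge0// sqr_ge0.
    have q2 : 0 <= L / S ^+ 2 by rewrite divr_ge0 ?sqr_ge0// ltW.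
    have q3 : 0 <= expR (-2) ^+ j :> R by rewrite exprn_ge0// expR_ge0.
    by rewrite /b (powRM a (mulr_ge0 q1 q2) q3) (powRM a q1 q2).
  have s0 : 0 < S * expR j%:R / 2 by rewrite divr_gt0// mulr_gt0// expR_gt0.
  have t0 : 0 < t by rewrite powR_gt0.
  have CL : C ^+ 2 * sqn mu u <= (S * expR j%:R / 2) ^+ 2 * t ^+ N.
    rewrite tN le_eqVlt; apply/orP; left; apply/eqP; rewrite /b -/L.
    have -> : expR (-2) ^+ j = (expR j%:R ^+ 2)^-1 :> R.
      by rewrite -expRM_natl -expRM_natl -expRN; congr expR; ring.
    field; rewrite gt_eqF ?expR_gt0// gt_eqF//.
  have := large u _ _ uD uL s0 t0 CL.
  have -> : 2 * (S * expR j%:R / 2) = S * expR j%:R by rewrite mulrC divfK.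
  move=> /le_trans; apply.
  rewrite exprMn t2m /K0 /Q.
  rewrite le_eqVlt; apply/orP; left; apply/eqP.
  by move: (_ `^ _) (_ `^ _) (th ^+ j) (nabla_energy m u) (N%:R ^+ m) => *; ring.
have key x : ((Num.max 0 (u x ^+ 2 * ln (`|u x| / S)))%:E <=
    \sum_(0 <= j <oo) (I j x)%:E)%E.
  have [u0|u0] := eqVneq (u x) 0.
    by rewrite u0 expr0n mul0r maxxx; apply: nneseries_ge0 => j _ _; rewrite lee_fin.
  have y0 : 0 < `|u x| / S by rewrite divr_gt0// normr_gt0.
  pose n := (Num.truncn `|ln (`|u x| / S)|).+1.
  have yn : `|u x| / S <= expR n%:R.
    rewrite -[leLHS]lnK ?posrE// ler_expR (le_trans (ler_norm _))// ltW//.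
    exact: truncnS_gt.
  apply: le_trans (nneseries_lim_ge n _); last by move=> j _ _; rewrite lee_fin.
  rewrite sumEFin lee_fin ge_max sumr_ge0//=.
  apply: (@le_trans _ _ (u x ^+ 2 * \sum_(0 <= j < n) (expR j%:R < `|u x| / S)%R%:R)).
    by apply: ler_wpM2l; [exact: sqr_ge0|exact: ln_le_count].
  rewrite mulr_sumr; apply: ler_sum => j _; rewrite /I indicE mulrC.
  rewrite (_ : (x \in _) = (expR j%:R < `|u x| / S))//.
  rewrite ltr_pdivlMr// mulrC; apply/idP/idP; first by rewrite inE.
  by move=> h; rewrite inE.
apply: (@le_trans _ _ (\int[mu]_x \sum_(0 <= j <oo) (I j x)%:E)%E).
  apply: ge0_le_integral => //.
  - by move=> x _; rewrite lee_fin le_max lexx.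
  - apply/measurable_EFinP; apply: measurable_maxr => //.
    apply: measurable_funM; first by apply: measurable_funX; exact: uL.1.
    apply: (measurableT_comp (@measurable_ln R)).
    by apply: measurable_funM => //; apply: measurableT_comp => //; exact: uL.1.
  - apply: ge0_emeasurable_sum => [j x _|j _]; first by rewrite lee_fin.
    exact/measurable_EFinP.
rewrite integral_nneseries//; last 2 first.
- by move=> j; exact/measurable_EFinP.
- by move=> j x _; rewrite lee_fin.
apply: lime_le.
  by apply: is_cvg_nneseries => j _ _; apply: integral_ge0 => x _; rewrite lee_fin.
apply: nearW => n.
under eq_bigr do rewrite -(EFin_Rintegral (Ii _)).
rewrite sumEFin lee_fin -[leRHS]mulrA -/Q.
apply: (@le_trans _ _ (\sum_(0 <= j < n) K0 * Q * th ^+ j)); first exact: ler_sum.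
have := @geometric_le_lim R n (K0 * Q) th (mulr_ge0 (ltW K00) Q0) th0.
rewrite ger0_norm ?(ltW th0)// => /(_ th1).
by rewrite (mulrAC K0 _^-1).
Qed.

(** [Glog u - ln S u ^+ 2] is [u ^+ 2 ln (|u| / S)]. *)
Lemma integral_Glog_le : exists2 K : R, 0 < K & forall u (S : R),
  Dm2 m u -> L2 mu u -> integ mu (fun x => Glog (u x)) -> 0 < sqn mu u -> 0 < S ->
  \int[mu]_x Glog (u x) <=
  sqn mu u * ln S + K * (sqn mu u / S ^+ 2) `^ a * nabla_energy m u.
Proof.
have [K K0 KP] := positive_log_energy; exists K => // u S uD uL Gi L0 S0.
have GS x : Glog (u x) - ln S * u x ^+ 2 = u x ^+ 2 * ln (`|u x| / S).
  rewrite /Glog; have [->|u0] := eqVneq (u x) 0; first by rewrite expr0n/= !mul0r mulr0 subr0.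
  by rewrite ln_div ?posrE ?normr_gt0//; ring.
have Wi : integ mu (fun x => Glog (u x) - ln S * u x ^+ 2).
  by apply: integB => //; apply: integZ; exact: uL.2.
have Mi : integ mu (fun x => Num.max 0 (Glog (u x) - ln S * u x ^+ 2)).
  apply: (le_integ _ (integ_norm Wi)).
    by apply: measurable_maxr => //; exact: integ_measurable Wi.
  move=> x; rewrite ger0_norm ?le_max ?lexx// ge_max normr_ge0 ler_norm//.
have h : \int[mu]_x Num.max 0 (Glog (u x) - ln S * u x ^+ 2) <=
    K * (sqn mu u / S ^+ 2) `^ a * nabla_energy m u.
  rewrite -lee_fin EFin_Rintegral//; apply: le_trans (KP u S uD uL L0 S0).
  by under eq_integral do rewrite GS.
rewrite -lerBlDl; apply: le_trans h.
have -> : \int[mu]_x Glog (u x) - sqn mu u * ln S =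
    \int[mu]_x (Glog (u x) - ln S * u x ^+ 2).
  rewrite RintegralB//; last by apply: integZ; exact: uL.2.
  by rewrite RintegralZl//; [rewrite mulrC|exact: uL.2].
by apply: le_Rintegral => // x _; rewrite le_max lexx orbT.
Qed.

End logarithmic_bound.

(** * The logarithmic nonlinearity *)

Section log_nonlinearity.
Context {R : realType}.
Implicit Types y z : R.

Lemma Glog0 : Glog 0 = 0 :> R. Proof. by rewrite /Glog expr0n mul0r. Qed.

Lemma GlogM c y : 0 < c -> Glog (c * y) = c ^+ 2 * (Glog y + ln c * y ^+ 2).
Proof.
move=> c0; have [->|y0] := eqVneq y 0; first by rewrite mulr0 Glog0 expr0n !mulr0 addr0 mulr0.
rewrite /Glog normrM gtr0_norm// lnM ?posrE ?normr_gt0//; ring.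
Qed.

Lemma norm_ln_le y : 0 <= y -> `|y * ln y| <= 1 + y ^+ 2.
Proof.
rewrite le_eqVlt => /predU1P[<-|y0]; first by rewrite mul0r normr0 addr_ge0 ?sqr_ge0.
have [y1|y1] := leP y 1.
  have h : ln y^-1 <= y^-1 - 1.
    have := @le_ln1Dx R (y^-1 - 1); rewrite (addrC 1) subrK; apply.
    by rewrite ltrBrDl subrr invr_gt0.
  rewrite lnV ?posrE// in h; rewrite ler0_norm; last by rewrite mulr_ge0_le0 ?(ltW y0)// ln_le0.
  have := ler_wpM2l (ltW y0) h; rewrite mulrBr mulfV ?gt_eqF// mulr1 mulrN => h2.
  by apply: (le_trans h2); rewrite lerBlDr -addrA lerDl addr_ge0 ?sqr_ge0 ?ltW.
have h : ln y <= y - 1.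
  by have := @le_ln1Dx R (y - 1); rewrite (addrC 1) subrK; apply; rewrite ltrBrDl subrr.
rewrite ger0_norm; last by rewrite mulr_ge0 ?(ltW y0)// ln_ge0// ltW.
have := ler_wpM2l (ltW y0) h; nra.
Qed.

Lemma ln_sqr y : y != 0 -> ln (y ^+ 2) = 2 * ln `|y|.
Proof.
by move=> y0; rewrite -(real_normK (num_real y)) lnXn ?normr_gt0// mulr_natl.
Qed.

(** Away from the origin [Glog y] is half of [y ^+ 2 ln (y ^+ 2)].  At the origin
    the quotient [h ln |h|] tends to zero, which the bound [norm_ln_le] gives at the square
    root of [|h|]. *)
Lemma is_derive_Glog y : is_derive y 1 (@Glog R) (2 * (y * ln `|y|) + y).
Proof.
have GE : (@Glog R) = fun z => 2^-1 * (z ^+ 2 * ln (z ^+ 2)).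
  apply/funext => z; rewrite /Glog; have [->|z0] := eqVneq z 0.
    by rewrite expr0n !mul0r mulr0.
  by rewrite ln_sqr//; field.
have [->|y0] := eqVneq y 0; last first.
  have y2 : 0 < y ^+ 2 by rewrite exprn_even_gt0.
  have d2 : is_derive y 1 (fun z => z ^+ 2) (2 * y).
    by apply: is_derive_eq (is_deriveX 2 (is_derive_id y 1)) _; rewrite /= expr1; exact: mulr1.
  have dl : is_derive y 1 (fun z => ln (z ^+ 2)) ((y ^+ 2)^-1 * (2 * y)).
    exact: (@is_derive1_comp R (@ln R) (fun z => z ^+ 2) y _ _ (is_derive1_ln y2) d2).
  rewrite GE; apply: is_derive_eq (is_deriveZ 2^-1 (is_deriveM d2 dl)) _.
  rewrite ln_sqr//; change (2^-1 * (y ^+ 2 * ((y ^+ 2)^-1 * (2 * y)) + 2 * ln `|y| * (2 * y)) =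
    2 * (y * ln `|y|) + y); by field.
have sq0 : Num.sqrt `|h| @[h --> (0:R)^'] --> (0 : R).
  have c2 : continuous_at (0 : R) (fun h : R => Num.sqrt `|h|).
    by apply: continuous_comp; [exact: norm_continuous|exact: sqrt_continuous].
  have c3 : Num.sqrt `|h| @[h --> (0:R)] --> Num.sqrt `|0 : R| by exact: c2.
  by rewrite [X in _ `=>` nbhs X](_ : _ = 0) ?normr0 ?sqrtr0// in c3; exact: cvg_within_filter.
have bd : 2 * Num.sqrt `|h| * (1 + Num.sqrt `|h| ^+ 2) @[h --> (0:R)^'] -->
    (2 * 0 * (1 + 0 ^+ 2) : R).
  apply: cvgM; first by apply: cvgM => //; exact: cvg_cst.
  by apply: cvgD; [exact: cvg_cst|exact: cvgM].
rewrite mulr0 mul0r in bd.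
have lim0 : h^-1 *: (((@Glog R) \o shift 0) (h *: 1) - Glog 0) @[h --> (0:R)^'] --> (0 : R).
  apply/norm_cvg0P; apply: (squeeze_cvgr _ (cvg_cst 0) bd); near=> h.
  have h0 : h != 0 by near: h; exact: nbhs_dnbhs_neq.
  rewrite normr_ge0/= addr0 Glog0 subr0.
  have -> : h%:A = h by exact: mulr1.
  have -> : h^-1 *: Glog h = h * ln `|h|.
    by rewrite /Glog; change (h^-1 * (h ^+ 2 * ln `|h|) = h * ln `|h|); field.
  have s0 : 0 < Num.sqrt `|h| by rewrite sqrtr_gt0 normr_gt0.
  have hs : `|h| = Num.sqrt `|h| ^+ 2 by rewrite sqr_sqrtr.
  have -> : `|h * ln `|h| | = 2 * Num.sqrt `|h| * `|Num.sqrt `|h| * ln (Num.sqrt `|h|)|.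
    have lh : ln `|h| = 2 * ln (Num.sqrt `|h|) by rewrite {1}hs lnXn// mulr_natl.
    rewrite normrM lh; move: (Num.sqrt `|h|) hs s0 => s hs s0.
    by rewrite hs !normrM (gtr0_norm s0) (@ger0_norm _ 2)//; ring.
  by apply: ler_wpM2l; [rewrite mulr_ge0// ltW|apply: norm_ln_le; exact: ltW].
rewrite mul0r mulr0 addr0; apply: DeriveDef; last exact: cvg_lim lim0.
by apply/cvg_ex; exists 0.
Unshelve. all: by end_near.
Qed.

Lemma glogE y : glog y = 2 * (y * ln `|y|) + y.
Proof. by rewrite /glog derive1E; have [_ ->] := is_derive_Glog y. Qed.

Lemma norm_glog_le y : `|glog y| <= 3 * (1 + y ^+ 2).
Proof.
rewrite glogE; apply: le_trans (ler_normD _ _) _; rewrite normrM (@ger0_norm _ 2)//.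
have -> : `|y * ln `|y| | = `| `|y| * ln `|y| | by rewrite !normrM normr_id.
have := norm_ln_le (normr_ge0 y); rewrite real_normK ?num_real//.
have : `|y| <= 1 + y ^+ 2.
  rewrite -(real_normK (num_real y)).
  by have := sqr_ge0 (`|y| - 1); have := normr_ge0 y; nra.
move: (`|_ * _|) => *; lra.
Qed.

Lemma Glog_lipschitz y z : `|Glog (y + z) - Glog y| <= 3 * `|z| * (1 + (`|y| + `|z|) ^+ 2).
Proof.
have cG : continuous (@Glog R).
  by move=> x; apply: differentiable_continuous; apply/derivable1_diffP; have [] := is_derive_Glog x.
have main a b : a < b -> (forall c, c \in `]a, b[ -> `|c| <= `|y| + `|z|) -> b - a = `|z| ->
    `|Glog b - Glog a| <= 3 * `|z| * (1 + (`|y| + `|z|) ^+ 2).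
  move=> ab cle baz.
  have [c cab ->] : exists2 c, c \in `]a, b[ & Glog b - Glog a = glog c * (b - a).
    apply: MVT ab _ _ => [x _|]; first by rewrite glogE; exact: is_derive_Glog.
    exact: continuous_subspaceT.
  rewrite baz normrM normr_id mulrAC ler_wpM2r//; apply: le_trans (norm_glog_le c) _.
  rewrite ler_wpM2l// lerD2l -(real_normK (num_real c)).
  by rewrite lerXn2r ?nnegrE ?addr_ge0// cle.
have [z0|z0|->] := ltgtP z 0; last first.
- by rewrite addr0 subrr normr0 mulr_ge0// addr_ge0 ?sqr_ge0.
- apply: main; rewrite ?ltrDl//; last by rewrite addrC addKr gtr0_norm.
  move=> c; rewrite in_itv/= (gtr0_norm z0) => /andP[h1 h2].
  have := ler_norm y; have := ler_norm (- y); rewrite normrN => *.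
  by rewrite ler_norml; apply/andP; split; lra.
- rewrite distrC; apply: main; rewrite ?gtrDl//; last first.
    by rewrite opprD addrA subrr sub0r ltr0_norm.
  move=> c; rewrite in_itv/= (ltr0_norm z0) => /andP[h1 h2].
  have := ler_norm y; have := ler_norm (- y); rewrite normrN => *.
  by rewrite ler_norml; apply/andP; split; lra.
Qed.

End log_nonlinearity.

(** * The constraint set and its positive infimum *)

Section scaling.
Context {R : realType} {N : nat} (m : nat).
Hypothesis m0 : (0 < m)%N.
Hypothesis hN : (2 * m < N)%N.
Local Notation mu := (@lebesgue_rv R N).
Local Notation p := (crit_exp R N m).
Local Notation q := ((N%:R - 2 * m%:R) / (2 * m%:R) : R).
Local Notation E := (@nabla_energy R N m).
Local Notation B u := (\int[mu]_x Glog (u x)).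
Local Notation Gintegrable u := (integ mu (fun x => Glog (u x))).
Local Notation infJ := (inf [set J m v | v in @Mset R N m]).
Implicit Types (u v w f g : 'rV[R]_N -> R).

Let m0' : 0 < m%:R :> R. Proof. by rewrite ltr0n. Qed.
Let N0' : 0 < N%:R :> R. Proof. by rewrite ltr0n (leq_ltn_trans _ hN). Qed.
Let gap0 : 0 < N%:R - 2 * m%:R :> R. Proof. exact: dim_gap_gt0. Qed.
Let p0 : 0 < p. Proof. exact: crit_exp_gt0. Qed.

Lemma q_gt0 : 0 < q. Proof. by rewrite divr_gt0// mulr_gt0. Qed.

Lemma crit_expE : p = 2 * (1 + q) / q.
Proof.
by rewrite /crit_exp; field; rewrite !gt_eqF ?m0'//.
Qed.

Lemma half_sub_inv_crit_exp : 2^-1 - p^-1 = m%:R / N%:R.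
Proof. by rewrite /crit_exp; field; rewrite !gt_eqF. Qed.

(** For [|u| <= 1/e] the square is at most [|Glog u|], and for larger values it is
    at most a multiple of the critical power. *)
Lemma Glog_integ_L2 u : Lp p u -> Gintegrable u -> L2 mu u.
Proof.
move=> [mu' up] Gi; split => //.
apply: (le_integ _ (integD (integ_norm Gi) (integZ (expR 1 `^ p) up))).
  exact: measurable_funX.
move=> x; rewrite ger0_norm ?sqr_ge0//.
have [ux|ux] := leP `|u x| (expR (-1)).
  rewrite -[leLHS]addr0 lerD ?mulr_ge0 ?powR_ge0//.
  have [->|u0] := eqVneq (u x) 0; first by rewrite expr0n/= normr_ge0.
  rewrite /Glog normrM ger0_norm ?sqr_ge0//; apply: ler_peMr; first exact: sqr_ge0.
  have h : ln `|u x| <= -1 by rewrite -[leRHS]expRK ler_ln ?posrE ?expR_gt0 ?normr_gt0.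
  by rewrite ler0_norm; [rewrite lerNr|apply: le_trans h _; rewrite oppr_le0].
rewrite -[leLHS]add0r lerD// -powRM ?expR_ge0//.
have h1 : 1 <= expR 1 * `|u x|.
  by rewrite mulrC -ler_pdivrMr ?expR_gt0// mul1r -expRN ltW.
apply: (@le_trans _ _ ((expR 1 * `|u x|) `^ 2)).
  rewrite powR_mulrn ?mulr_ge0 ?expR_ge0// exprMn real_normK ?num_real//.
  apply: ler_peMl; first exact: sqr_ge0.
  by rewrite exprn_ege1// -[leLHS]expR0 ler_expR.
by apply: ler_powR => //; exact: crit_exp_ge2.
Qed.

Lemma sqn_scale c r u : 0 < r -> L2 mu u ->
  L2 mu (fun x => c * u (r *: x)) /\
  sqn mu (fun x => c * u (r *: x)) = (r ^+ N)^-1 * (c ^+ 2 * sqn mu u).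
Proof.
move=> r0 uL; have h := L2_affine 0 r0 uL; have h2 := sqn_affine 0 r0 uL.
rewrite (_ : (fun x => c * u (r *: x)) = fun x => c * u (r *: x + 0)); last first.
  by apply/funext => x; rewrite addr0.
by split; [exact: L2Z|rewrite (sqnZ _ h) h2 mulrCA].
Qed.

Lemma Glog_scale c r u : 0 < c -> 0 < r -> L2 mu u -> Gintegrable u ->
  Gintegrable (fun x => c * u (r *: x)) /\
  B (fun x => c * u (r *: x)) = (r ^+ N)^-1 * (c ^+ 2 * (B u + ln c * sqn mu u)).
Proof.
move=> c0 r0 uL Gi.
pose F x : R := c ^+ 2 * (Glog (u x) + ln c * u x ^+ 2).
have Si : integ mu (fun x => ln c * u x ^+ 2) by apply: integZ; exact: uL.2.
have GSi := integD Gi Si.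
have Fi : integ mu F by exact: (integZ (c ^+ 2) GSi).
have FE x : Glog (c * u (r *: x)) = F (r *: x + 0) by rewrite addr0 GlogM.
have Bu : \int[mu]_x F x = c ^+ 2 * (B u + ln c * sqn mu u).
  apply: etrans (RintegralZl _ measurableT GSi) _; congr (_ * _).
  apply: etrans (RintegralD measurableT Gi Si) _; congr (_ + _).
  by apply: RintegralZl measurableT uL.2.
split; first by under eq_fun do rewrite FE; exact: (integ_affine 0 r0 Fi).
by under eq_Rintegral do rewrite FE; rewrite (Rintegral_affine 0 r0 Fi) Bu.
Qed.

Lemma sqn_eq0 u : L2 mu u -> sqn mu u = 0 -> {ae mu, forall x, u x = 0}.
Proof.
move=> uL u0.
have : (\int[mu]_x `|(u x ^+ 2)%:E| = 0)%E.
  under eq_integral do rewrite gee0_abs ?lee_fin ?sqr_ge0//.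
  by rewrite -(EFin_Rintegral uL.2) -/(sqn mu u) u0.
have mu2 : measurable_fun setT (fun x => (u x ^+ 2)%:E).
  by apply/measurable_EFinP; apply: measurable_funX; exact: uL.1.
move/(ae_eq_integral_abs mu measurableT mu2); apply: filterS => x /(_ I) [/eqP].
by rewrite expf_eq0/= => /eqP.
Qed.

(** With zero energy, [integral_Glog_le] for [S] close to zero would make the
    logarithmic integral arbitrarily negative. *)
Lemma energy_gt0 u : Dm2 m u -> L2 mu u -> Gintegrable u -> 0 < sqn mu u -> 0 < E u.
Proof.
move=> uD uL Gi L0; have [K K0 KP] := @integral_Glog_le R N m m0 hN.
rewrite lt_neqAle nabla_energy_ge0 andbT; apply/eqP => e0.
(* this [S] makes [L ln S] equal to [B - L] *)
have := KP u (expR (B u / sqn mu u - 1)) uD uL Gi L0 (expR_gt0 _).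
rewrite -e0 mulr0 addr0 expRK mulrBr mulr1 mulrC divfK ?gt_eqF//.
by rewrite lerBrDl gerDr leNgt L0.
Qed.

Lemma Mset_facts u : Mset m u -> [/\ Dm2 m u, L2 mu u, Gintegrable u, 0 < sqn mu u & 0 < E u] /\
  [/\ E u = p * B u, 0 < B u & J m u = m%:R / N%:R * E u].
Proof.
move=> [uD u0 Gi Eu]; have uL : L2 mu u.
  by apply: Glog_integ_L2 Gi; have [] := (Dm2P hN u).1 uD.
have L0 : 0 < sqn mu u.
  rewrite lt_neqAle sqn_ge0 andbT; apply/eqP => h; apply: u0.
  exact: sqn_eq0 uL (esym h).
have E0 := energy_gt0 uD uL Gi L0; split; split => //.
  by move: E0; rewrite Eu pmulr_rgt0.
rewrite /J -half_sub_inv_crit_exp mulrBl; congr (_ - _).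
by rewrite Eu mulKf// gt_eqF.
Qed.

Lemma J_ge0 u : Mset m u -> 0 <= J m u.
Proof.
by move=> /Mset_facts[[_ _ _ _ E0] [_ _ ->]]; rewrite mulr_ge0 ?divr_ge0 ?ltW.
Qed.

Lemma infJ_le u : Mset m u -> infJ <= J m u.
Proof.
move=> uM; apply: ge_inf; last by exists u.
by exists 0 => _ [v vM <-]; exact: J_ge0.
Qed.

(** On the constraint set the logarithmic integral is [E / p].  The choice [S = 1]
    in [integral_Glog_le] bounds the squared norm from below, and then [S = 1/e] bounds
    the energy from below, since [2 m / N < 1]. *)
Lemma infJ_gt0 u : Mset m u -> 0 < infJ.
Proof.
move=> uM; have [K K0 KP] := @integral_Glog_le R N m m0 hN.
pose a : R := 2 * m%:R / N%:R.
have a0 : 0 < a by rewrite divr_gt0// mulr_gt0.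
have a1 : a < 1 by rewrite ltr_pdivrMr// mul1r -natrM ltr_nat.
(* a lower bound for the power of the squared norm, from [S = 1] *)
pose l : R := (p * K)^-1.
have pK0 : 0 < p * K by apply: mulr_gt0.
have l0 : 0 < l by rewrite invr_gt0.
pose e : R := l `^ (a^-1 * (1 - a)) / (K * (expR 2) `^ a).
have e0 : 0 < e by rewrite divr_gt0 ?mulr_gt0 ?powR_gt0 ?expR_gt0.
apply: (@lt_le_trans _ _ (m%:R / N%:R * e)); first by rewrite mulr_gt0// divr_gt0.
apply: lb_le_inf; first by exists (J m u), u.
move=> _ [v vM <-]; have [[vD vL Gi L0 E0] [EB B0 ->]] := Mset_facts vM.
rewrite ler_pM2l ?divr_gt0//.
have h1 := KP v 1 vD vL Gi L0 ltr01.
rewrite ln1 mulr0 add0r expr1n divr1 -/a in h1.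
have lL : l <= sqn mu v `^ a.
  rewrite /l -[leLHS]mul1r ler_pdivrMr//.
  rewrite -(ler_pM2r E0) mul1r {1}EB; apply: le_trans (ler_wpM2l (ltW p0) h1) _.
  by rewrite le_eqVlt; apply/orP; left; apply/eqP; ring.
have h2 := KP v (expR (-1)) vD vL Gi L0 (expR_gt0 _).
rewrite expRK mulrN1 -/a in h2.
have h3 : sqn mu v <= K * (sqn mu v / expR (-1) ^+ 2) `^ a * E v.
  by rewrite -subr_ge0 addrC; apply: le_trans h2; exact: ltW.
have h4 : (sqn mu v / expR (-1) ^+ 2) `^ a = sqn mu v `^ a * expR 2 `^ a.
  rewrite -powRM ?expR_ge0 ?(ltW L0)//; congr ((_ * _) `^ _).
  by rewrite -expRM_natl -expRN mulrN1 opprK.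
rewrite h4 in h3.
have h5 : sqn mu v `^ (1 - a) * sqn mu v `^ a = sqn mu v.
  by rewrite -powRD ?subrK ?powRr1 ?(ltW L0)//; rewrite gt_eqF// implybT.
have La0 : 0 < sqn mu v `^ a by rewrite powR_gt0.
rewrite -{1}h5 in h3.
have h6 : sqn mu v `^ (1 - a) <= K * expR 2 `^ a * E v.
  by rewrite -(ler_pM2r La0); apply: le_trans h3 _; rewrite le_eqVlt; apply/orP; left; apply/eqP; ring.
rewrite /e ler_pdivrMr ?mulr_gt0 ?powR_gt0 ?expR_gt0// (mulrC (E v)); apply: le_trans h6.
rewrite powRrM; apply: powR_ler; rewrite ?subr_gt0 ?powR_ge0//.
have a_neq0 : a != 0 by rewrite gt_eqF.
rewrite -[leRHS](powRr1 (ltW L0)) -(mulfV a_neq0) powRrM.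
by apply: powR_ler; rewrite ?invr_gt0 ?(ltW l0).
Qed.

End scaling.

(** * Dilation invariance and minimizers *)

Section minimization.
Context {R : realType} {N : nat} (m : nat).
Hypothesis m0 : (0 < m)%N.
Hypothesis hN : (2 * m < N)%N.
Local Notation mu := (@lebesgue_rv R N).
Local Notation p := (crit_exp R N m).
Local Notation q := ((N%:R - 2 * m%:R) / (2 * m%:R) : R).
Local Notation E := (@nabla_energy R N m).
Local Notation B u := (\int[mu]_x Glog (u x)).
Local Notation Gintegrable u := (integ mu (fun x => Glog (u x))).
Local Notation infJ := (inf [set J m v | v in @Mset R N m]).
Implicit Types (u v w f g : 'rV[R]_N -> R).

Let m0' : 0 < m%:R :> R. Proof. by rewrite ltr0n. Qed.
Let N0' : 0 < N%:R :> R. Proof. by rewrite ltr0n (leq_ltn_trans _ hN). Qed.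
Let mN0 : 0 < m%:R / N%:R :> R. Proof. by rewrite divr_gt0. Qed.
Let p0 : 0 < p. Proof. exact: crit_exp_gt0. Qed.
Let q0 : 0 < q. Proof. exact: q_gt0. Qed.

Let lnMp (x y : R) : 0 < x -> 0 < y -> ln (x * y) = ln x + ln y.
Proof. by move=> x0 y0; rewrite lnM ?posrE. Qed.

Let lnXp (x : R) n : 0 < x -> ln (x ^+ n) = n%:R * ln x.
Proof. by move=> x0; rewrite lnXn// mulr_natl. Qed.

(** A line above the graph of [ln (1 + y)] that passes through the origin is the
    tangent. *)
Lemma slope_ln (k : R) : (forall y, -1 < y -> ln (1 + y) <= k * y) -> k = 1.
Proof.
move=> h; have h2 y : -1 < y -> y / (1 + y) <= k * y.
  move=> y1; apply: le_trans (h y y1); have y10 : 0 < 1 + y by rewrite -ltrBlDl sub0r.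
  have := @le_ln1Dx R ((1 + y)^-1 - 1); rewrite (addrC 1 (_ - 1)) subrK lnV ?posrE//.
  have -> : - 1 < (1 + y)^-1 - 1 by rewrite ltrBrDl subrr invr_gt0.
  move=> /(_ isT); rewrite lerNl => h3; apply: le_trans h3.
  by rewrite le_eqVlt; apply/orP; left; apply/eqP; field; rewrite gt_eqF.
apply/eqP; rewrite eq_le; apply/andP; split; rewrite leNgt; apply/negP => k1.
  have k0 : 0 < k by rewrite (lt_trans _ k1).
  (* for [k > 1] the line is below the logarithm at this point *)
  pose y := - ((k - 1) / (2 * k)).
  have y0 : 0 < (k - 1) / (2 * k) by rewrite divr_gt0 ?subr_gt0 ?mulr_gt0.
  have y1 : (k - 1) / (2 * k) < 1 by rewrite ltr_pdivrMr ?mulr_gt0//; lra.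
  have := h2 y; rewrite /y ltrN2 => /(_ y1); rewrite mulNr mulrN lerN2 leNgt => /negP; apply.
  rewrite mulrC ltr_pM2r// -[ltRHS]invrK ltf_pV2 ?posrE ?invr_gt0//; last by rewrite subr_gt0.
  rewrite -subr_gt0 (_ : _ - _ = (k - 1) / (2 * k))//.
  by field; rewrite gt_eqF.
(* for [k < 1] the line is below the logarithm at this point *)
pose y := (1 - k) / 2; have y0 : 0 < y by rewrite divr_gt0// subr_gt0.
have y1 : -1 < y by rewrite (lt_trans _ y0)// oppr_lt0.
have := h2 y y1; rewrite leNgt => /negP; apply.
rewrite ltr_pdivlMr ?addr_gt0// -subr_gt0 (_ : _ - _ = y * y * (2 - k)).
  have k2 : 0 < 2 - k by lra.
  by apply: mulr_gt0 => //; exact: mulr_gt0.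
by rewrite /y; field.
Qed.

Lemma sqn_ae0 u : measurable_fun setT u -> {ae mu, forall x, u x = 0} -> sqn mu u = 0.
Proof.
move=> uM u0; apply: (@etrans _ _ (\int[mu]_x (0 : R))); last by rewrite Rintegral_cst// mul0r.
apply: ae_eq_Rintegral; [exact: measurable_funX|exact: measurable_cst|].
by apply: filterS u0 => x ->; rewrite expr0n.
Qed.

Lemma sqn_gt0 u : L2 mu u -> B u != 0 -> 0 < sqn mu u.
Proof.
move=> uL; apply: contraNT; rewrite -leNgt => h.
have u0 : sqn mu u = 0 by apply/eqP; rewrite eq_le h sqn_ge0.
have -> : B u = \int[mu]_x (0 : R).
  apply: ae_eq_Rintegral.
  - exact: (measurableT_comp measurable_Glog uL.1).
  - exact: measurable_cst.
  - by apply: filterS (sqn_eq0 uL u0) => x ->; rewrite Glog0.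
by rewrite Rintegral_cst// mul0r.
Qed.

(** The amplitude [c] and the powers [r ^ -N] cancel in the constraint. *)
Lemma Mset_scale (c r : R) u : 0 < c -> 0 < r -> Dm2 m u -> L2 mu u -> Gintegrable u ->
  0 < sqn mu u ->
  (r ^+ m) ^+ 2 * E u = p * (B u + ln c * sqn mu u) <->
  Mset m (fun x => c * u (r *: x)).
Proof.
move=> c0 r0 uD uL Gi L0; have [Gs Bs] := Glog_scale c0 r0 uL Gi.
have [sL sE] := sqn_scale c r0 uL; have Es := nabla_energy_scale hN c r0 uD.
have rN : 0 < r ^+ N by rewrite exprn_gt0.
split=> [h|[_ _ _]].
  split.
  - exact: Dm2_scale.
  - move=> z; have : 0 < sqn mu (fun x => c * u (r *: x)).
      by rewrite sE !mulr_gt0 ?invr_gt0 ?exprn_gt0.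
    by rewrite (sqn_ae0 sL.1 z) ltxx.
  - exact: Gs.
  - apply: (@etrans _ _ (c ^+ 2 * (r ^+ N)^-1 * ((r ^+ m) ^+ 2 * E u))).
      by rewrite Es; ring.
    by rewrite h Bs; ring.
rewrite Es Bs => h; apply: (mulfI (_ : c ^+ 2 * (r ^+ N)^-1 != 0)).
  by apply: mulf_neq0; rewrite ?invr_neq0// ?expf_neq0// gt_eqF.
by apply: etrans (etrans _ h) _; ring.
Qed.

Lemma ln_J_scale (c r : R) u : 0 < c -> 0 < r -> Dm2 m u -> L2 mu u -> Gintegrable u ->
  0 < sqn mu u -> (r ^+ m) ^+ 2 * E u = p * (B u + ln c * sqn mu u) ->
  ln (J m (fun x => c * u (r *: x))) =
  ln (m%:R / N%:R) + (1 + q) * ln (E u) + 2 * ln c - q * ln (p * (B u + ln c * sqn mu u)).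
Proof.
move=> c0 r0 uD uL Gi L0 h; have E0 := energy_gt0 m0 hN uD uL Gi L0.
have sM := (Mset_scale c0 r0 uD uL Gi L0).1 h.
have [_ [_ _ ->]] := Mset_facts m0 hN sM.
rewrite (nabla_energy_scale hN c r0 uD) -h.
have rm : 0 < (r ^+ m) ^+ 2 by rewrite !exprn_gt0.
have rN : 0 < (r ^+ N)^-1 by rewrite invr_gt0 exprn_gt0.
have c2 : 0 < c ^+ 2 by rewrite exprn_gt0.
have lrm : ln ((r ^+ m) ^+ 2) = 2 * (m%:R * ln r) by rewrite !lnXp ?exprn_gt0.
have lrN : ln ((r ^+ N)^-1) = - (N%:R * ln r) by rewrite lnV ?posrE ?exprn_gt0// lnXp.
have lc : ln (c ^+ 2) = 2 * ln c by rewrite lnXp.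
rewrite (lnMp mN0); last by apply: mulr_gt0 => //; apply: mulr_gt0 => //; exact: mulr_gt0.
rewrite (lnMp (mulr_gt0 (mulr_gt0 c2 rm) rN) E0) (lnMp (mulr_gt0 c2 rm) rN).
rewrite (lnMp c2 rm) (lnMp rm E0) lrm lrN lc.
move: (ln r) (ln c) (ln (E u)) (ln _) m0'; move: (m%:R : R) (N%:R : R) => x y a b d e x0.
by field; rewrite gt_eqF.
Qed.

(** The dilation is [r = (p B / E) ^ (1 / 2m)]. *)
Lemma constraint_dilation u : Dm2 m u -> Gintegrable u -> 0 < B u -> exists2 r : R, 0 < r &
  (r ^+ m) ^+ 2 * E u = p * B u.
Proof.
move=> uD Gi B0; have [uL _] := (Dm2P hN u).1 uD; have u2 := Glog_integ_L2 hN uL Gi.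
have L0 : 0 < sqn mu u by apply: sqn_gt0 => //; rewrite gt_eqF.
have E0 := energy_gt0 m0 hN uD u2 Gi L0.
have pBE : 0 < p * B u / E u by rewrite divr_gt0// mulr_gt0.
exists ((p * B u / E u) `^ (2 * m%:R)^-1); first by rewrite powR_gt0.
rewrite -exprM -powR_mulrn ?powR_ge0// -powRrM natrM (mulrC m%:R) mulVf ?powRr1 ?(ltW pBE)//.
  by rewrite divfK// gt_eqF.
by rewrite gt_eqF// mulr_gt0.
Qed.

(** The dilation of [constraint_dilation] is a competitor. *)
Lemma ln_infJ_le u : Dm2 m u -> Gintegrable u -> 0 < B u ->
  0 < infJ /\ ln infJ <= ln (m%:R / N%:R) + (1 + q) * ln (E u) - q * ln (p * B u).
Proof.
move=> uD Gi B0; have [uL _] := (Dm2P hN u).1 uD; have u2 := Glog_integ_L2 hN uL Gi.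
have L0 : 0 < sqn mu u by apply: sqn_gt0 => //; rewrite gt_eqF.
have [r r0 h] := constraint_dilation uD Gi B0.
have h1 : (r ^+ m) ^+ 2 * E u = p * (B u + ln 1 * sqn mu u) by rewrite ln1 mul0r addr0.
have sM := (Mset_scale ltr01 r0 uD u2 Gi L0).1 h1.
have i0 := infJ_gt0 m0 hN sM; split => //.
have := ln_J_scale ltr01 r0 uD u2 Gi L0 h1; rewrite ln1 mul0r !addr0 mulr0 addr0 => <-.
have hJ := infJ_le m0 hN sM; rewrite ler_ln ?posrE//; exact: lt_le_trans hJ.
Qed.

Lemma minimizer_ln u : Mset m u -> J m u = infJ ->
  ln infJ = ln (m%:R / N%:R) + (1 + q) * ln (E u) - q * ln (p * B u).
Proof.
move=> uM Ju; have [[_ _ _ _ E0] [EB B0 JE]] := Mset_facts m0 hN uM.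
rewrite -EB -Ju JE (lnMp mN0 E0); ring.
Qed.

(** The bound [ln_infJ_le] for the competitors [e^s u] says that a line through the
    origin stays above the logarithm; its slope is the quotient of [2 B] by [q L]. *)
Lemma minimizer_Glog u : Mset m u -> J m u = infJ -> B u = q / 2 * sqn mu u.
Proof.
move=> uM Ju; have [[uD uL Gi L0 E0] [EB B0 JE]] := Mset_facts m0 hN uM.
have uln := minimizer_ln uM Ju.
have solve (Q b l : R) : 0 < Q -> 0 < l -> 2 * b / (Q * l) = 1 -> b = Q / 2 * l.
  move=> Q0 l0 h; have -> : b = 2 * b / (Q * l) * (Q / 2 * l) by field; rewrite !gt_eqF.
  by rewrite h mul1r.
apply: (solve _ _ _ q0 L0).
apply: slope_ln => y y1; pose s := B u / sqn mu u * y.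
have y10 : 0 < 1 + y by rewrite -ltrBlDl sub0r.
have BE : B u + s * sqn mu u = B u * (1 + y).
  by rewrite /s mulrDr mulr1 mulrAC divfK// gt_eqF.
pose w := fun x => expR s * u (1 *: x).
have [wG wB] := Glog_scale (expR_gt0 s) ltr01 uL Gi.
have wD : Dm2 m w by exact: Dm2_scale.
have wE := nabla_energy_scale hN (expR s) ltr01 uD.
rewrite expRK BE expr1n invr1 mul1r in wB.
rewrite !expr1n invr1 !mulr1 in wE.
have es0 : 0 < expR s ^+ 2 by rewrite exprn_gt0// expR_gt0.
have wB0 : 0 < B w by rewrite wB; apply: mulr_gt0 => //; exact: mulr_gt0.
have [_] := ln_infJ_le wD wG wB0.
rewrite uln wE wB mulrCA (lnMp es0 E0) (lnMp es0 (mulr_gt0 p0 (mulr_gt0 B0 y10))).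
rewrite (lnMp p0 B0) (lnMp p0 (mulr_gt0 B0 y10)) (lnMp B0 y10) lnXp ?expR_gt0// expRK.
have sE : s * sqn mu u = B u * y by rewrite /s mulrAC divfK// gt_eqF.
move: sE; clearbody s; move: (ln _) (ln _) (ln p) (ln _) (ln (1 + y)) q q0 L0.
move: (sqn mu u) (B u) => l b a1 a2 a3 a4 a5 Q Q0 l0 sE h.
rewrite -(ler_pM2l Q0) (_ : Q * (2 * b / (Q * l) * y) = 2 * s).
  by rewrite -subr_ge0; rewrite -subr_ge0 in h; move: h; congr (0 <= _); ring.
rewrite (_ : Q * _ = 2 * (b * y) / l); last by field; rewrite !gt_eqF.
by rewrite -sE; field; rewrite gt_eqF.
Qed.

End minimization.

(** * The Euler-Lagrange equation *)

Section euler_lagrange.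
Context {R : realType} {N : nat} (m : nat).
Hypothesis m0 : (0 < m)%N.
Hypothesis hN : (2 * m < N)%N.
Local Notation mu := (@lebesgue_rv R N).
Local Notation p := (crit_exp R N m).
Local Notation q := ((N%:R - 2 * m%:R) / (2 * m%:R) : R).
Local Notation E := (@nabla_energy R N m).
Local Notation B u := (\int[mu]_x Glog (u x)).
Local Notation Gintegrable u := (integ mu (fun x => Glog (u x))).
Local Notation infJ := (inf [set J m v | v in @Mset R N m]).
Implicit Types (u v w f g : 'rV[R]_N -> R).

Lemma is_derive_Glog_line (a b e : R) :
  is_derive e 1 (fun t => Glog (a + t * b)) (glog (a + e * b) * b).
Proof.
have d : is_derive e 1 (fun t => a + t * b) b.
  have dab : is_derive e 1 (fun t : R => a + b * t) b.
    apply: is_derive_eq (is_deriveD (is_derive_cst a e 1) (is_deriveZ b (is_derive_id e 1))) _.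
    by rewrite add0r; exact: mulr1.
  by under eq_fun do rewrite mulrC.
rewrite glogE.
exact: (@is_derive1_comp R (@Glog R) (fun t => a + t * b) e _ _ (is_derive_Glog _) d).
Qed.

(** The test function is bounded, so the cubic terms reduce to integrable ones. *)
Lemma glog_line_dominated u v : L2 mu u -> test_function v ->
  exists g, [/\ integ mu g, forall x, 0 <= g x &
    forall x, 3 * `|v x| * (1 + (`|u x| + `|v x|) ^+ 2) <= g x].
Proof.
move=> uL tv; have vc := test_ccs tv; have [C C0 vC] := ccs_bounded vc.
have vi := integ_norm (ccs_integ vc).
exists (fun x => 3 * `|v x| + (6 * C * u x ^+ 2 + 6 * C ^+ 2 * `|v x|)); split.
- by apply: integD; [exact: integZ|apply: integD; apply: integZ => //; exact: uL.2].
- move=> x; apply: addr_ge0; first by rewrite mulr_ge0.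
  by apply: addr_ge0; apply: mulr_ge0; rewrite ?sqr_ge0// mulr_ge0// sqr_ge0.
move=> x; rewrite -[u x ^+ 2](real_normK (num_real _)).
have := vC x; have := normr_ge0 (v x); have := normr_ge0 (u x).
move: `|u x| `|v x| => a b a0 b0 bC.
have h1 : (a + b) ^+ 2 <= 2 * a ^+ 2 + 2 * b ^+ 2.
  by have := sqr_ge0 (a - b); rewrite sqrrB sqrrD; lra.
have h2 : b * a ^+ 2 <= C * a ^+ 2 by rewrite ler_wpM2r ?sqr_ge0.
have h3 : b * b ^+ 2 <= C ^+ 2 * b.
  by rewrite mulrC ler_wpM2r// lerXn2r ?nnegrE.
have := ler_wpM2l b0 h1; lra.
Qed.

(** Derivation under the integral sign; the derivative of the integrand is
    dominated by [glog_line_dominated]. *)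
Lemma Glog_line_derivative u v : L2 mu u -> Gintegrable u -> test_function v ->
  (forall e : R, `|e| < 1 -> Gintegrable (fun x => u x + e * v x)) /\
  (forall e : R, `|e| < 1 -> is_derive e 1 (fun t => B (fun x => u x + t * v x))
    (\int[mu]_x (glog (u x + e * v x) * v x))).
Proof.
move=> uL Gi tv; have [g [gi g0 gP]] := glog_line_dominated uL tv.
have mv : measurable_fun setT v by apply: ccs_measurable; exact: test_ccs.
have Gline e : `|e| < 1 -> Gintegrable (fun x => u x + e * v x).
  move=> e1; apply: (le_integ _ (integD (integ_norm Gi) gi)).
    apply: (measurableT_comp measurable_Glog); apply: measurable_funD; first exact: uL.1.
    exact: measurable_funM.
  move=> x; rewrite -[X in `|X|](subrK (Glog (u x))) addrC.
  apply: le_trans (ler_normD _ _) _; rewrite lerD2l.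
  apply: le_trans (Glog_lipschitz _ _) _; apply: le_trans (gP x).
  have ev : `|e * v x| <= `|v x| by rewrite normrM ler_piMl// ltW.
  apply: ler_pM; rewrite ?mulr_ge0 ?addr_ge0 ?sqr_ge0//.
    by rewrite ler_wpM2l.
  by rewrite lerD2l lerXn2r ?nnegrE ?addr_ge0// lerD2l.
split => // e e1.
pose f (t : R) x := Glog (u x + t * v x).
have eI : `]-1, 1[%classic e by rewrite /= in_itv/= -ltr_norml.
have I1 (t : R) : `]-1, 1[%classic t -> `|t| < 1 by rewrite /= in_itv/= -ltr_norml.
have fi t : `]-1, 1[%classic t -> mu.-integrable setT (EFin \o f t).
  by move=> /I1 t1; exact: Gline.
have fd t x : `]-1, 1[%classic t -> setT x -> derivable (f ^~ x) t 1.
  by move=> _ _; have [] := is_derive_Glog_line (u x) (v x) t.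
have d1 t x : partial1of2 f t x = glog (u x + t * v x) * v x.
  by rewrite partial1of2E; have [_ ->] := is_derive_Glog_line (u x) (v x) t.
have fg t x : `]-1, 1[%classic t -> setT x -> `|partial1of2 f t x| <= g x.
  move=> /I1 t1 _; rewrite d1 normrM; apply: le_trans (gP x).
  rewrite mulrAC ler_wpM2r//; apply: le_trans (norm_glog_le _) _.
  rewrite ler_wpM2l// lerD2l -[leLHS](real_normK (num_real _)).
  rewrite lerXn2r ?nnegrE ?addr_ge0//; apply: le_trans (ler_normD _ _) _.
  by rewrite lerD2l normrM ler_piMl// ltW.
have D1 := derivable_under_integral measurableT eI fi fd g0 gi fg.
have D2 := differentiation_under_integral measurableT eI fi fd g0 gi fg.
apply: DeriveDef; first exact: D1.
rewrite -derive1E; apply: etrans D2 _.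
by apply: eq_Rintegral => x _; rewrite d1.
Qed.

(** By [ln_infJ_le] the function [(1 + q) ln E - q ln (p B)] has a minimum at
    [t = 0] along [u + t v]. *)
Lemma minimizer_weak u : Mset m u -> J m u = infJ -> weak_solution m u.
Proof.
move=> uM Ju; have [[uD uL Gi L0 E0] [EB B0 JE]] := Mset_facts m0 hN uM.
split => // v tv.
set P := \int[mu]_x _; set Q := \int[mu]_x _.
have [Gline dB] := Glog_line_derivative uL Gi tv.
pose Bf (t : R) := B (fun x => u x + t * v x).
pose Ef (t : R) := E u + (2 * P * t + derivative_energy m v * t ^+ 2).
have EfE t : E (fun x => u x + t * v x) = Ef t.
  by have [_ ->] := Dm2_add_test hN t uD tv; rewrite /Ef -/P; ring.
have Dline t : Dm2 m (fun x => u x + t * v x) by have [] := Dm2_add_test hN t uD tv.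
have B00 : Bf 0 = B u.
  by apply: eq_Rintegral => x _; rewrite mul0r addr0.
have E00 : Ef 0 = E u by rewrite /Ef mulr0 expr0n/= mulr0 !addr0.
have dB0 : is_derive (0 : R) 1 Bf Q.
  apply: is_derive_eq (dB 0 _) _; first by rewrite normr0.
  by apply: eq_Rintegral => x _; rewrite mul0r addr0.
have [d d0 Bpos] : exists2 d : R, 0 < d <= 1 & forall t, `|t| < d -> 0 < Bf t.
  have cB : {for 0, continuous Bf}.
    by apply: differentiable_continuous; apply/derivable1_diffP; have [] := dB0.
  have : \forall t \near (0 : R), 0 < Bf t.
    by apply: (cvgr_gt (Bf 0) cB); rewrite B00.
  move=> /nbhs_ballP[d /= d0 dP]; exists (Num.min d 1).
    by rewrite lt_min d0 ltr01 ge_min lexx orbT.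
  move=> t; rewrite lt_min => /andP[td _]; apply: dP.
  by rewrite /ball/= sub0r normrN.
have [d00 d1] := andP d0.
have Epos t : `|t| < d -> 0 < Ef t.
  move=> td; rewrite -EfE; have t1 : `|t| < 1 by exact: lt_le_trans d1.
  have u2 : L2 mu (fun x => u x + t * v x).
    by apply: L2D => //; apply: L2Z; apply: ccs_L2; exact: test_ccs.
  apply: (energy_gt0 m0 hN (Dline t) u2 (Gline t t1)).
  by apply: sqn_gt0 => //; rewrite gt_eqF// Bpos.
have dE (t : R) : is_derive t 1 Ef (2 * P + derivative_energy m v * (2 * t)).
  have d2 : is_derive t 1 (fun z : R => z ^+ 2) (2 * t).
    by apply: is_derive_eq (is_deriveX 2 (is_derive_id t 1)) _; rewrite /= expr1; exact: mulr1.
  apply: is_derive_eq (is_deriveD (is_derive_cst (E u) t 1)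
    (is_deriveD (is_deriveZ (2 * P) (is_derive_id t 1))
      (is_deriveZ (derivative_energy m v) d2))) _.
  by rewrite add0r; congr (_ + _); exact: mulr1.
pose h (t : R) := (1 + q) * ln (Ef t) - q * ln (p * Bf t).
have p0 : 0 < p by exact: crit_exp_gt0.
have dh (t : R) : `|t| < d -> is_derive t 1 h
    ((1 + q) * ((Ef t)^-1 * (2 * P + derivative_energy m v * (2 * t))) -
     q * ((p * Bf t)^-1 * (p * \int[mu]_x (glog (u x + t * v x) * v x)))).
  move=> td; have t1 : `|t| < 1 by exact: lt_le_trans d1.
  have l1 := @is_derive1_comp R (@ln R) Ef t _ _ (is_derive1_ln (Epos t td)) (dE t).
  have pB : 0 < p * Bf t by rewrite mulr_gt0// Bpos.
  have dpB := is_deriveZ p (dB t t1).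
  have l2 := @is_derive1_comp R (@ln R) (p \*: Bf) t _ _ (is_derive1_ln pB) dpB.
  exact: (is_deriveB (is_deriveZ (1 + q) l1) (is_deriveZ q l2)).
have hmin : is_derive (0 : R) 1 h 0.
  apply: (@derive1_at_min R h (- d) d 0).
  - by rewrite ge0_cp// ltW.
  - move=> t; rewrite in_itv/= -ltr_norml => td; by have [] := dh t td.
  - by rewrite in_itv/= oppr_lt0 d00.
  - move=> t; rewrite in_itv/= -ltr_norml => td; have t1 : `|t| < 1 by exact: lt_le_trans d1.
    have [_] := ln_infJ_le m0 hN (Dline t) (Gline t t1) (Bpos t td).
    by rewrite (minimizer_ln m0 hN uM Ju) EfE /h B00 E00 -!addrA lerD2l.
have h0 := dh 0; rewrite normr0 in h0.
have [_ e1] := hmin; have [_ e2] := h0 d00.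
have := etrans (esym e1) e2; rewrite E00 B00 !mulr0 addr0 EB.
have -> : \int[mu]_x (glog (u x + 0 * v x) * v x) = Q.
  by apply: eq_Rintegral => x _; rewrite mul0r addr0.
have q0 : 0 < q := q_gt0 m0 hN.
have pE : p = 2 * (1 + q) / q := crit_expE m0 hN.
move: pE q0 p0 B0; move: q (p) (B u) => z y b -> z0 y0 b0.
clearbody P Q; have z1 : 0 < 1 + z by rewrite addr_gt0.
rewrite (_ : _ - _ = (P - Q) * (z / b)); last by field; rewrite !gt_eqF.
move=> /esym/eqP; rewrite mulf_eq0 subr_eq0 => /orP[/eqP//|].
by rewrite gt_eqF// divr_gt0.
Qed.

End euler_lagrange.

(** * The logarithmic Sobolev equality *)

(** An integral is finite only if both its positive and negative parts are. *)
Lemma integ_fin_integral d (T : measurableType d) (R : realType)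
    (mu : {measure set T -> \bar R}) (f : T -> R) (a : R) :
  measurable_fun setT f -> (\int[mu]_x (f x)%:E = a%:E)%E -> integ mu f.
Proof.
move=> mf fa; have mF : measurable_fun setT (EFin \o f) by exact/measurable_EFinP.
have : (\int[mu]_x ((EFin \o f)^\+ x) - \int[mu]_x ((EFin \o f)^\- x))%E \is a fin_num.
  by rewrite -integralE fa.
rewrite fin_numB => /andP[fp fn]; apply/integrableP; split => //.
have -> : (fun x => `|(f x)%:E|%E) = (fun x => (EFin \o f)^\+ x + (EFin \o f)^\- x)%E.
  by rewrite -/(abse \o (EFin \o f)) -fune_abse.
rewrite ge0_integralD//; last 2 first.
- exact: measurable_funepos.
- exact: measurable_funeneg.
by rewrite ltey_eq fin_numD fp fn.
Qed.

Section log_sobolev.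
Context {R : realType} {N : nat} (m : nat).
Hypothesis m0 : (0 < m)%N.
Hypothesis hN : (2 * m < N)%N.
Local Notation mu := (@lebesgue_rv R N).
Local Notation p := (crit_exp R N m).
Local Notation q := ((N%:R - 2 * m%:R) / (2 * m%:R) : R).
Local Notation E := (@nabla_energy R N m).
Local Notation B u := (\int[mu]_x Glog (u x)).
Local Notation Gintegrable u := (integ mu (fun x => Glog (u x))).
Local Notation infJ := (inf [set J m v | v in @Mset R N m]).
Implicit Types (u v w f g : 'rV[R]_N -> R).

Let lnMp (x y : R) : 0 < x -> 0 < y -> ln (x * y) = ln x + ln y.
Proof. by move=> x0 y0; rewrite lnM ?posrE. Qed.

Let ln_sq (x : R) : 0 < x -> ln (x ^+ 2) = 2 * ln x.
Proof. by move=> x0; rewrite lnXn// mulr_natl. Qed.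

Let sqr_abs (x : R) : `|x| ^+ 2 = x ^+ 2.
Proof. by rewrite real_normK// num_real. Qed.

Let m0' : 0 < m%:R :> R. Proof. by rewrite ltr0n. Qed.
Let N0' : 0 < N%:R :> R. Proof. by rewrite ltr0n (leq_ltn_trans _ hN). Qed.
Let p0 : 0 < p. Proof. exact: crit_exp_gt0. Qed.
Let q0 : 0 < q. Proof. exact: q_gt0. Qed.
Let pq0 : 0 < p * (q / 2). Proof. by apply: mulr_gt0 => //; exact: divr_gt0. Qed.

(** The left hand side of the equality as a function of the energy, with the
    powers expanded. *)
Definition log_constant (e : R) : R :=
  2^-1 * (q + ln (m%:R / N%:R) - ln infJ + (1 + q) * ln e - q * ln (p * (q / 2))).

Lemma log_constantE (e : R) : 0 < infJ -> 0 < e ->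
  N%:R / (4 * m%:R) * ln ((4 * m%:R * expR 1 / (C_log R N m * (N%:R - 2 * m%:R)))
          `^ ((N%:R - 2 * m%:R) / N%:R) * e) = log_constant e.
Proof.
move=> i0 e0; have g0 : 0 < N%:R - 2 * m%:R :> R by exact: dim_gap_gt0.
have q20 : 0 < q / 2 by exact: divr_gt0.
pose s : R := 2 * m%:R / (N%:R - 2 * m%:R).
have mN0 : 0 < m%:R / N%:R :> R by exact: divr_gt0.
have CE : C_log R N m = p * (m%:R / N%:R) `^ (- s) * infJ `^ s.
  by rewrite /C_log (@half_sub_inv_crit_exp R N m hN).
have a0 : 0 < (m%:R / N%:R) `^ (- s) :> R by exact: powR_gt0.
have b0 : 0 < infJ `^ s by exact: powR_gt0.
have C0 : 0 < C_log R N m by rewrite CE; apply: mulr_gt0 => //; exact: mulr_gt0.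
have lC : ln (C_log R N m) = ln p - s * ln (m%:R / N%:R) + s * ln infJ.
  rewrite CE (lnMp (mulr_gt0 p0 a0) b0) (lnMp p0 a0).
  by rewrite !ln_powR mulNr.
have -> : 4 * m%:R * expR 1 / (C_log R N m * (N%:R - 2 * m%:R)) =
    expR 1 / (C_log R N m * (q / 2)).
  move: (C_log R N m) C0 (expR 1) => C C0 z; field.
  by rewrite !gt_eqF.
have Cq0 : 0 < C_log R N m * (q / 2) by exact: mulr_gt0.
have X0 : 0 < expR 1 / (C_log R N m * (q / 2)) by rewrite divr_gt0// expR_gt0.
rewrite (lnMp (powR_gt0 _ X0) e0) ln_powR ln_div ?posrE ?expR_gt0// expRK.
rewrite (lnMp C0 q20) lC /log_constant (lnMp p0 q20) /s.
move: (ln infJ) (ln p) (ln e) (ln _) (ln _) m0' N0' g0.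
move: (m%:R : R) (N%:R : R) => x y a b c d f x0 y0 g0.
by field; rewrite !gt_eqF.
Qed.

Let Glog_normE u x : `|u x| ^+ 2 * ln `|u x| = Glog (u x).
Proof. by rewrite /Glog real_normK// num_real. Qed.

Lemma log_sobolev_equalityE u : 0 < infJ -> 0 < E u -> Gintegrable u ->
  log_sobolev_equality m u <-> log_constant (E u) = B u.
Proof.
move=> i0 E0 Gi; rewrite /log_sobolev_equality (log_constantE i0 E0).
under eq_integral do rewrite Glog_normE.
rewrite -(EFin_Rintegral Gi); split; first exact: EFin_inj.
by move=> ->.
Qed.

(** Dividing by the norm multiplies [u0] by [c] with [c ^+ 2 L = 1], and
    turns [B = (q / 2) L] into [B = q / 2 + ln c]. *)
Lemma ground_state_log_sobolev u u0 : Dm2 m u -> ground_state m u0 ->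
  {ae mu, forall x, u x = u0 x / fine ('N[mu]_2%:E[EFin \o u0])%E} ->
  \int[mu]_x (`|u x| ^+ 2) = 1 /\ log_sobolev_equality m u.
Proof.
move=> uD [_ uM Ju] ae; have [[u0D u0L Gi L0 E0] _] := Mset_facts m0 hN uM.
have [uL _] := (Dm2P hN u).1 uD.
have mu' := uL.1.
set nu := fine _ in ae.
have nu2 : nu ^+ 2 = sqn mu u0 by exact: Lnorm2E.
have nu0 : 0 < nu.
  rewrite lt_neqAle fine_ge0 ?Lnorm_ge0// andbT eq_sym.
  by apply/eqP => z; move: L0; rewrite -nu2 z expr0n ltxx.
pose c := nu^-1; have c0 : 0 < c by rewrite invr_gt0.
have cL : c ^+ 2 * sqn mu u0 = 1 by rewrite -nu2 -exprMn mulVf ?expr1n// gt_eqF.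
pose w := fun x => c * u0 (1 *: x).
have [wL wS] := sqn_scale c ltr01 u0L.
have [wG wB] := Glog_scale c0 ltr01 u0L Gi.
have wE := nabla_energy_scale hN c ltr01 u0D.
rewrite expr1n invr1 mul1r in wS; rewrite expr1n invr1 mul1r in wB.
rewrite !expr1n invr1 !mulr1 in wE.
have uw : {ae mu, forall x, u x = w x}.
  by apply: filterS ae => x ->; rewrite /w scale1r mulrC.
have [wD uE] := ae_Dm2 hN wL.1 uw uD.
have GiU : Gintegrable u.
  apply: (ae_integ _ _ wG); first exact: (measurableT_comp measurable_Glog mu').
  by apply: filterS uw => x ->.
have uBw : B u = B w.
  apply: ae_eq_Rintegral.
  - exact: (measurableT_comp measurable_Glog mu').
  - exact: integ_measurable wG.
  - by apply: filterS uw => x ->.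
split.
  apply: (@etrans _ _ (sqn mu w)); last by rewrite wS.
  apply: ae_eq_Rintegral.
  - by apply: measurable_funX; exact: measurableT_comp.
  - by apply: measurable_funX; exact: wL.1.
  - by apply: filterS uw => x ->; exact: sqr_abs.
have c20 : 0 < c ^+ 2 by rewrite exprn_gt0.
have i0 := infJ_gt0 m0 hN uM.
have Ew0 : 0 < E u by rewrite -uE wE mulr_gt0.
apply: (log_sobolev_equalityE i0 Ew0 GiU).2.
have lc := ln_sq c0.
have lL : ln (sqn mu u0) = - (2 * ln c).
  by apply/eqP; rewrite -addr_eq0 addrC -lc -(lnMp c20 L0) cL ln1.
have ul := minimizer_ln m0 hN uM Ju; have uB := minimizer_Glog m0 hN uM Ju.
rewrite uBw wB -uE wE /log_constant ul (lnMp c20 E0) lc.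
have -> : p * B u0 = p * (q / 2) * sqn mu u0 by rewrite uB mulrA.
have -> : c ^+ 2 * (B u0 + ln c * sqn mu u0) = q / 2 + ln c.
  rewrite uB -mulrDl (mulrC (c ^+ 2)) -mulrA (mulrC _ (c ^+ 2)) cL mulr1//.
rewrite (lnMp pq0 L0) lL.
move: (ln c) (ln (E u0)) (ln (p * (q / 2))) (ln (m%:R / N%:R)) q => a b d f z.
by field.
Qed.

(** The amplitude [l] is chosen so that [B + ln l = q / 2], as [minimizer_Glog]
    requires of a minimizer, and the dilation [r] so that the constraint holds; the
    equality then says that the value of [J] is the infimum. *)
Lemma log_sobolev_minimizer u : Dm2 m u -> \int[mu]_x (`|u x| ^+ 2) = 1 ->
  log_sobolev_equality m u ->
  exists! lr : R * R,
    let u0 := fun x => lr.1 * u (lr.2 *: x) in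
    [/\ 0 < lr.1, 0 < lr.2, Mset m u0 & ground_state m u0].
Proof.
move=> uD u1 uLS; have [uL _] := (Dm2P hN u).1 uD; have mu' := uL.1.
have Gi : Gintegrable u.
  apply: integ_fin_integral; first exact: (measurableT_comp measurable_Glog mu').
  apply: etrans (esym uLS); apply: eq_integral => x _.
  by rewrite Glog_normE.
have u2 := Glog_integ_L2 hN uL Gi.
have s1 : sqn mu u = 1.
  by rewrite -u1; apply: eq_Rintegral => x _; rewrite real_normK// num_real.
have L0 : 0 < sqn mu u by rewrite s1.
have E0 := energy_gt0 m0 hN uD u2 Gi L0.
have i0 : 0 < infJ.
  have [wG wB] := Glog_scale (expR_gt0 (1 - B u)) ltr01 u2 Gi.
  have wD := Dm2_scale hN (expR (1 - B u)) ltr01 uD.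
  have wB0 : 0 < B (fun x => expR (1 - B u) * u (1 *: x)).
    rewrite wB expr1n invr1 mul1r expRK s1 mulr1 (addrC (B u)) subrK mulr1.
    by rewrite exprn_gt0// expR_gt0.
  by have [] := ln_infJ_le m0 hN wD wG wB0.
have A := (log_sobolev_equalityE i0 E0 Gi).1 uLS.
pose l := expR (q / 2 - B u); have l0 : 0 < l by exact: expR_gt0.
have lB : B u + ln l * sqn mu u = q / 2 by rewrite s1 mulr1 expRK addrC subrK.
have x0 : 0 < p * (q / 2) / E u by rewrite divr_gt0.
pose r := (p * (q / 2) / E u) `^ (2 * m%:R)^-1.
have r0 : 0 < r by rewrite powR_gt0.
have rE : (r ^+ m) ^+ 2 * E u = p * (B u + ln l * sqn mu u).
  rewrite lB -exprM -powR_mulrn ?powR_ge0// -powRrM natrM (mulrC m%:R) mulVf.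
    by rewrite powRr1 ?(ltW x0)// divfK// gt_eqF.
  by rewrite gt_eqF// mulr_gt0.
have uM := (Mset_scale hN l0 r0 uD u2 Gi L0).1 rE.
have uJ : J m (fun x => l * u (r *: x)) = infJ.
  have J0 : 0 < J m (fun x => l * u (r *: x)) by exact: lt_le_trans (infJ_le m0 hN uM).
  apply: ln_inj; rewrite ?posrE// (ln_J_scale m0 hN l0 r0 uD u2 Gi L0 rE) lB expRK.
  rewrite -A /log_constant.
  move: (ln infJ) (ln (E u)) (ln (p * (q / 2))) (ln (m%:R / N%:R)) q => a b d f z.
  by field.
exists (l, r); split => /=.
  by split => //; split => //; exact: minimizer_weak.
move=> [l' r'] /= [l'0 r'0 vM [_ _ vJ]].
have h1 := minimizer_Glog m0 hN vM vJ.
have [_ vB] := Glog_scale l'0 r'0 u2 Gi; have [_ vS] := sqn_scale l' r'0 u2.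
have lB' : B u + ln l' * sqn mu u = q / 2.
  have z : (r' ^+ N)^-1 * l' ^+ 2 != 0.
    by apply: mulf_neq0; [rewrite invr_neq0// expf_neq0// gt_eqF|rewrite expf_neq0// gt_eqF].
  apply: (mulfI z); rewrite -mulrA -vB h1 vS s1; ring.
have ll : l = l'.
  apply: ln_inj; rewrite ?posrE//; move: lB'; rewrite -lB s1 !mulr1 => /addrI ->.
  by [].
have h2 := (Mset_scale hN l'0 r'0 uD u2 Gi L0).2 vM.
have rr : r = r'.
  have h3 : (r ^+ m) ^+ 2 = (r' ^+ m) ^+ 2.
    by apply: (@mulIf _ (E u)); [rewrite gt_eqF|rewrite h2 lB' rE lB].
  apply/eqP; rewrite -(@eqrXn2 _ (m * 2))//; last 3 first.
  - by rewrite muln_gt0 m0.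
  - exact: ltW.
  - exact: ltW.
  by rewrite !exprM h3.
by rewrite ll rr.
Qed.

End log_sobolev.

Theorem mainTheorem4 (R : realType) (m N : nat) (hm : (2 <= m)%N)
    (hN : (2 * m < N)%N) :
  (forall u u0 : 'rV[R]_N -> R,
      Dm2 m u -> ground_state m u0 ->
      {ae lebesgue_rv N, forall x,
        u x = u0 x / fine ('N[lebesgue_rv N]_2%:E[EFin \o u0])%E} ->
      \int[lebesgue_rv N]_x (`|u x| ^+ 2) = 1 /\ log_sobolev_equality m u) /\
  (forall u : 'rV[R]_N -> R,
      Dm2 m u -> \int[lebesgue_rv N]_x (`|u x| ^+ 2) = 1 ->
      log_sobolev_equality m u ->
      exists! lr : R * R,
        let u0 := fun x => lr.1 * u (lr.2 *: x) in
        [/\ 0 < lr.1, 0 < lr.2, Mset m u0 & ground_state m u0]).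
Proof.
have m0 : (0 < m)%N by exact: leq_trans hm.
split=> [u u0 uD u0G ae|u uD u1 uLS].
  exact: (ground_state_log_sobolev m0 hN uD u0G ae).
exact: (log_sobolev_minimizer m0 hN uD u1 uLS).
Qed.
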